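(* Let $v_1, v_2$ be an orthonormal basis of $\mathbb{R}^2$ and let $a_1, a_2>0$. Define $g:\mathbb{R}\to\mathbb{R}$ by $$g(x) = -\frac{\sqrt{2}}{\pi^{3/2}}\, a_1 a_2 \sum_{n\in\mathbb{Z}^2,\ n \neq 0} \left((a_1 n \cdot v_1)^2 + (a_2 n \cdot v_2)^2\right)^{-5/4} \cos\left(\left((a_1 n \cdot v_1)^2 + (a_2 n \cdot v_2)^2\right)^{1/2} x - \frac{\pi}{4}\right).$$ Then $$A(R) = g(R^{1/2})\, R^{-1/4} + O(R^{-3/4}) \quad \text{as } R \to \infty.$$ More generally, there exists a sequence of uniformly almost periodic functions $g_1, g_2, \ldots$ with $g_1 = g$ such that for every integer $m\ge 1$, $$A(R) = \sum_{j=1}^m g_j(R^{1/2})\, R^{\frac{1}{4} - \frac{j}{2}} + O\left(R^{-\frac{1}{4} - \frac{m}{2}}\right)\quad \text{as } R\to\infty.$$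
   Context: For $t\ge 0$ let $$N(t) = \# \left\{ n \in \mathbb{Z}^2 : \left( \left( \frac{n \cdot v_1}{a_1} \right)^2 + \left( \frac{n \cdot v_2}{a_2} \right)^2 \right)^{1/2} \leq \frac{\sqrt{t}}{2\pi} \right\},$$ the number of integer lattice points in the ellipse $E_t = \{ x \in \mathbb{R}^2 : (2\pi)^2 ( ( \frac{x \cdot v_1}{a_1} )^2 + ( \frac{x \cdot v_2}{a_2} )^2 ) \leq t \}$, whose area is $\frac{a_1a_2t}{4\pi}$. (The eigenvalue counting function of the Laplacian on any flat 2-dimensional torus $\mathbb{R}^2/\mathcal{L}$ is of this form for suitable $v_1,v_2,a_1,a_2$, obtained by diagonalizing the quadratic form $\xi\cdot\xi$ on the dual lattice $\mathcal{L}'$.) Let $D(t) = N(t) - \frac{a_1 a_2 t}{4\pi}$, and for $R>0$ let $$A(R) = \frac{1}{R} \int_0^R D(t)\, dt.$$ ''Uniformly almost periodic'' means almost periodic in the sense of Bohr (a uniform limit on $\mathbb{R}$ of finite linear combinations of functions $e^{i\lambda x}$, $\lambda\in\mathbb{R}$). *)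

(* Defs.v *)
From HB Require Import structures.
From mathcomp Require Import all_boot all_order all_algebra.
From mathcomp Require Import all_classical all_reals all_analysis.
From mathcomp Require Import finmap complex.
Import Order.TTheory GRing.Theory Num.Theory.
Import numFieldNormedType.Exports.

Set Implicit Arguments.
Unset Strict Implicit.
Unset Printing Implicit Defensive.

Local Open Scope classical_set_scope.
Local Open Scope ring_scope.

Definition dot (R : realType) (u v : 'rV[R]_2) : R := (u *m v^T) 0 0.

(* Two orthonormal vectors of a plane automatically form a basis of it. *)
Definition orthonormal_basis (R : realType) (v1 v2 : 'rV[R]_2) : Prop :=
  [/\ dot v1 v1 = 1, dot v2 v2 = 1 & dot v1 v2 = 0].

(* The lattice Z^2 is 'rV[int]_2; [latdot n v] is n . v in R^2. *)
Definition latdot (R : realType) (n : 'rV[int]_2) (v : 'rV[R]_2) : R :=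
  dot (map_mx intr n) v.

Definition lattice_points (R : realType) (v1 v2 : 'rV[R]_2) (a1 a2 t : R) :
    set 'rV[int]_2 :=
  [set n | Num.sqrt ((latdot n v1 / a1) ^+ 2 + (latdot n v2 / a2) ^+ 2)
           <= Num.sqrt t / (2 * pi)].

(* [fset_set] is the finite set of elements of a finite set, and empty on an
   infinite one; [lattice_points] is finite for orthonormal v1, v2 and
   positive a1, a2. *)
Definition Ncount (R : realType) (v1 v2 : 'rV[R]_2) (a1 a2 t : R) : nat :=
  (#|` fset_set (lattice_points v1 v2 a1 a2 t) |)%N.

Definition Derr (R : realType) (v1 v2 : 'rV[R]_2) (a1 a2 t : R) : R :=
  (Ncount v1 v2 a1 a2 t)%:R - a1 * a2 * t / (4 * pi).

Definition Aavg (R : realType) (v1 v2 : 'rV[R]_2) (a1 a2 r : R) : R :=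
  r^-1 * (\int[lebesgue_measure]_(t in `[0, r]) Derr v1 v2 a1 a2 t).

(* Sum of an absolutely summable real family over a countable set, as the
   difference of the sums of its positive and negative parts. *)
Definition rsum (R : realType) (T : choiceType) (S : set T) (f : T -> R) : R :=
  fine (\esum_(n in S) (EFin \o f)^\+ n - \esum_(n in S) (EFin \o f)^\- n)%E.

Definition gfun (R : realType) (v1 v2 : 'rV[R]_2) (a1 a2 x : R) : R :=
  - (Num.sqrt 2 / pi `^ (3 / 2)) * a1 * a2 *
  rsum [set n : 'rV[int]_2 | n != 0] (fun n =>
    let q := (a1 * latdot n v1) ^+ 2 + (a2 * latdot n v2) ^+ 2 in
    q `^ (- (5 / 4)) * cos (Num.sqrt q * x - pi / 4)).

(* e^{iy} for real y *)
Definition expi (R : realType) (y : R) : R[i] := (cos y +i* sin y)%C.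

Definition trig_poly (R : realType) (p : R -> R[i]) : Prop :=
  exists (d : nat) (c : 'I_d -> R[i]) (lam : 'I_d -> R),
    forall x, p x = \sum_(k < d) c k * expi (lam k * x).

Definition uniformly_almost_periodic (R : realType) (f : R -> R[i]) : Prop :=
  exists p : nat -> R -> R[i],
    (forall k, trig_poly (p k)) /\
    (forall e : R, 0 < e ->
       \forall k \near \oo, forall x, `|p k x - f x| < (e%:C)%C).

(* Makes the Landau notations [=O_] and [+O_] available at +oo. *)
Canonical pinfty_filter_on (R : realType) : filter_on R :=
  FilterType (pinfty_nbhs R) _.

(* Main.v *)
Require Import Defs.
From HB Require Import structures.
From mathcomp Require Import all_boot all_order all_algebra.
From mathcomp Require Import all_classical all_reals all_analysis.
From mathcomp Require Import finmap complex.
From mathcomp Require Import zify ring lra.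
Import Order.TTheory GRing.Theory Num.Theory.
Import numFieldNormedType.Exports.

(** Let Q(x) = 4 pi^2 ((x.v1/a1)^2 + (x.v2/a2)^2), so that N(t) counts the lattice
points n with Q(n) <= t.  Integrating the count gives

  int_0^T N(t) dt = sum_n max(0, T - Q(n))                          (Aavg_sum),

a sum of values of a compactly supported Lipschitz function at the points of Z^2:
averaging over t has smoothed the indicator of the ellipse just enough for Poisson
summation to converge absolutely.  The Fourier transform of max(0, T - Q) at n is

  kappa T^2 bess(sqrt T eta(n)),   kappa = a1 a2 / (3 pi^2),
  eta(n) = sqrt((a1 n.v1)^2 + (a2 n.v2)^2),

where bess k = int_{-pi/2}^{pi/2} cos^4 t cos(k sin t) dt = 3 pi J_2(k) / k^2
(fourier2_qcap).  The term n = 0 is the integral of the area term, so dividing by T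

  A(T) = kappa T sum_{n != 0} bess(sqrt T eta(n))                   (Aavg_bess).

It remains to insert the complete asymptotic expansion of bess (bess_expansion)

  bess k = k^(-5/2) sum_{j <= m} k^(-j) w_j(k) + O(k^(-5/2-m-1)),

each w_j being a linear combination of cos and sin.  As sum_{n != 0} eta(n)^(-5/2)
is finite (abs_summable_eta) and the expansion holds for all k > 0, it can be summed
over n, with T sqrt T^(-5/2-j) = T^(1/4-(j+1)/2).  The coefficient of this power is
kappa sum_n eta(n)^(-5/2-j) w_j(eta(n) x) at x = sqrt T, a uniformly absolutely
convergent series of waves in x, hence uniformly almost periodic
(almost_periodic_waves).  For j = 0, w_0 = -3 sqrt pi (cos + sin) and the coefficient
is g (gfun_wavesum).

Poisson summation (poisson_plane).  Integrate F against the product of two Fejer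
kernels over a box that contains the support.  The kernels concentrate at the
integers, so the integral tends to the sum of F over the lattice points of the box
(fejer_plane); expanding the kernels shows that it is also an average of partial sums
of the Fourier transform of F over translated boxes of frequencies
(fejer_plane_expand), which tends to the full sum (box_average_cvg).

Fourier transform (oint_qcap_wave).  In the coordinate s along the frequency, every
slice of max(0, T - Q) is a parabolic cap, of integral proportional to h^3, h being
its half-width.  The substitution s = s0 sin t turns h into a multiple of cos t, and
the remaining integral over s into bess.

Expansion of bess.  The function y(k) = k^(5/2) bess k solves
y'' + (1 - 15/4 k^-2) y = 0 (der_bess_scaled1).  The equation has formal solutions
sum_j k^(-j) w_j(k), determined recursively by w_0, with an explicit residual
(bessterm_telescope).  Once y is known to be asymptotic to w_0, variation of constants
gains one power of k per iteration (bess_scaled_expansion).  The ODE cannot tell what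
w_0 is: that comes from stationary phase (bess_leading), and ultimately from the
common limit sqrt (pi/8) of the two Fresnel integrals (fresnel_limit). *)

Set Implicit Arguments.
Unset Strict Implicit.
Unset Printing Implicit Defensive.
Local Open Scope classical_set_scope.
Local Open Scope ring_scope.

(** * Derivatives *)

Section Calculus.
Variable R : realType.
Implicit Types (f g F : R -> R) (a b x y : R).

(** A predicate of its own, so that a derivative is found by applying the rules below
to the shape of the function. *)
Definition is_der x f (l : R) : Prop := is_derive x 1 f l.

Lemma der_eq f x a b : is_der x f a -> a = b -> is_der x f b.
Proof. by move=> ? <-. Qed.

Lemma derC a x : is_der x (fun=> a : R) 0.
Proof. exact: is_derive_cst. Qed.

Lemma derI x : is_der x (fun x => x) 1.
Proof. exact: is_derive_id. Qed.

Lemma derD f g x a b : is_der x f a -> is_der x g b ->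
  is_der x (fun x => f x + g x) (a + b).
Proof. exact: is_deriveD. Qed.

Lemma derN f x a : is_der x f a -> is_der x (fun x => - f x) (- a).
Proof. exact: is_deriveN. Qed.

Lemma derM f g x a b : is_der x f a -> is_der x g b ->
  is_der x (fun x => f x * g x) (f x * b + g x * a).
Proof. exact: is_deriveM. Qed.

Lemma derX f n x a : is_der x f a ->
  is_der x (fun x => f x ^+ n) (n%:R * f x ^+ n.-1 * a).
Proof. by move=> ?; rewrite -exprfctE; exact: is_deriveX. Qed.

Lemma der_comp f g x a b : is_der (g x) f a -> is_der x g b ->
  is_der x (fun x => f (g x)) (a * b).
Proof. by move=> da db; exact: (is_derive1_comp da db). Qed.

Lemma der_sin f x a : is_der x f a ->
  is_der x (fun x => sin (f x)) (cos (f x) * a).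
Proof. by apply: der_comp; exact: is_derive_sin. Qed.

Lemma der_cos f x a : is_der x f a ->
  is_der x (fun x => cos (f x)) (- sin (f x) * a).
Proof. by apply: der_comp; exact: is_derive_cos. Qed.

Lemma der_atan f x a : is_der x f a ->
  is_der x (fun x => atan (f x)) ((1 + f x ^+ 2)^-1 * a).
Proof. by apply: der_comp; exact: is_derive1_atan. Qed.

Lemma der_inv f x a : f x != 0 -> is_der x f a ->
  is_der x (fun x => (f x)^-1) (- (f x) ^- 2 * a).
Proof. by move=> f0 da; exact: (is_deriveV f0 da). Qed.

Lemma der_sqrt f x a : 0 < f x -> is_der x f a ->
  is_der x (fun x => Num.sqrt (f x)) ((2 * Num.sqrt (f x))^-1 * a).
Proof.
by move=> f0; apply: (@der_comp Num.sqrt); exact: is_derive1_sqrt.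
Qed.

Lemma der_sum n (h : 'I_n -> R -> R) (dh : 'I_n -> R) x :
  (forall i, is_der x (h i) (dh i)) ->
  is_der x (fun x => \sum_(i < n) h i x) (\sum_(i < n) dh i).
Proof.
move=> H; have := is_derive_sum H.
by congr (is_derive _ _ _ _); apply/funext => z; rewrite fct_sumE.
Qed.

Lemma der_cont f x a : is_der x f a -> {for x, continuous f}.
Proof.
by move=> [df _]; apply: differentiable_continuous; apply/derivable1_diffP.
Qed.

(** Continuity for the one topology of R that is used here; the rules for [cont] then
apply by syntactic matching. *)
Definition cont f : Prop := continuous f.

Lemma cont_der f (df : R -> R) : (forall x, is_der x f (df x)) -> cont f.
Proof. by move=> H x; exact: der_cont (H x). Qed.

Lemma mean_value f (df : R -> R) a b : a <= b ->
  (forall x, a <= x <= b -> is_der x f (df x)) ->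
  exists2 c, a <= c <= b & f b - f a = df c * (b - a).
Proof.
move=> ab H; have [||c cab E] := @MVT_segment _ f df a b ab.
- by move=> x /itvP xab; apply: H; rewrite !xab.
- by apply: continuous_in_subspaceT => x; rewrite in_setE /= in_itv => /H /der_cont.
- by exists c; rewrite // -?in_itv.
Qed.

Lemma le_of_der_le f g (df dg : R -> R) a b : a <= b ->
  (forall x, a <= x <= b -> is_der x f (df x)) ->
  (forall x, a <= x <= b -> is_der x g (dg x)) ->
  (forall x, a <= x <= b -> df x <= dg x) ->
  f b - f a <= g b - g a.
Proof.
move=> ab Hf Hg H.
have [|c cab E] := @mean_value (fun x => g x - f x) (fun x => dg x - df x) a b ab.
  by move=> x xab; apply: derD; [exact: Hg|exact/derN/Hf].
rewrite -subr_ge0; have -> : g b - g a - (f b - f a) = g b - f b - (g a - f a) by ring.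
by rewrite E mulr_ge0 // subr_ge0 // H.
Qed.

Lemma norm_le_of_der_le f g (df dg : R -> R) a b : a <= b ->
  (forall x, a <= x <= b -> is_der x f (df x)) ->
  (forall x, a <= x <= b -> is_der x g (dg x)) ->
  (forall x, a <= x <= b -> `|df x| <= dg x) ->
  `|f b - f a| <= g b - g a.
Proof.
move=> ab Hf Hg H; rewrite ler_norml; apply/andP; split; last first.
  apply: (le_of_der_le ab Hf Hg) => x /H; exact: le_trans (ler_norm _).
rewrite lerNl; have -> : - (f b - f a) = - f b - - f a by ring.
apply: (@le_of_der_le (fun x => - f x) g (fun x => - df x) dg a b ab _ Hg)
  => [x /Hf|x /H]; first exact: derN.
by apply: le_trans; rewrite -normrN ler_norm.
Qed.

(** Two primitives of one function have the same increments; only the increments are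
ever needed. *)
Lemma eq_increment_on f g (df : R -> R) a b : a <= b ->
  (forall x, a <= x <= b -> is_der x f (df x)) ->
  (forall x, a <= x <= b -> is_der x g (df x)) ->
  f b - f a = g b - g a.
Proof.
by move=> ab Hf Hg; apply/le_anti/andP; split;
  [apply: le_of_der_le Hf Hg _|apply: le_of_der_le Hg Hf _].
Qed.

Lemma eq_increment f g (df : R -> R) :
  (forall x, is_der x f (df x)) -> (forall x, is_der x g (df x)) ->
  forall a b, f b - f a = g b - g a.
Proof.
move=> Hf Hg a b; wlog ab : a b / a <= b.
  move=> W; have [/W//|/ltW /W E] := leP a b.
  by rewrite -[LHS]opprB E opprB.
exact: eq_increment_on ab (fun x _ => Hf x) (fun x _ => Hg x).
Qed.

(** A second-order bound of the remainder is how derivatives are obtained under an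
integral sign, where the bound can be integrated. *)
Lemma der_of_quadratic f x a (K : R) :
  (forall h, `|h| <= 1 -> `|f (x + h) - f x - h * a| <= K * h ^+ 2) ->
  is_der x f a.
Proof.
move=> H.
have K0 : 0 <= K.
  by have := H 1; rewrite normr1 lexx expr1n mulr1 => /(_ isT); exact: le_trans.
have E (h : R) : h != 0 -> a - h^-1 *: (f (h + x) - f x) =
    - h^-1 * (f (x + h) - f x - h * a).
  move=> h0; have -> : h^-1 *: (f (h + x) - f x) = h^-1 * (f (h + x) - f x) by [].
  by rewrite (addrC h x); field.
have B (e h : R) : 0 < e -> `|h| <= e / (K + 1) -> K * h ^+ 2 <= `|h| * e.
  move=> e0; rewrite ler_pdivlMr; last lra.
  move=> h2; rewrite -real_normK ?num_real // expr2 mulrA mulrC ler_wpM2l //.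
  apply: le_trans h2; rewrite mulrDr mulr1 mulrC lerDl //.
have L : h^-1 *: (f (h + x) - f x) @[h --> 0^'] --> a.
  apply/cvgrPdist_le => e e0; near=> h.
  have h0 : h != 0 by near: h; exact: nbhs_dnbhs_neq.
  have h1 : `|h| <= Num.min 1 (e / (K + 1)).
    near: h; apply: dnbhs0_le; rewrite lt_min ltr01 divr_gt0 //.
    exact: ltr_wpDl.
  move: h1; rewrite le_min => /andP[h1 h2].
  rewrite (E h h0) normrM normrN normfV ler_pdivrMl ?normr_gt0 //.
  exact: le_trans (H _ h1) (B _ _ e0 h2).
have D : derivable f x 1.
  apply/cvg_ex; exists a; apply: cvg_trans L; apply: near_eq_cvg.
  by near=> h; rewrite /= [_%:A]mulr1.
split => //; apply: cvg_lim => //; apply: cvg_trans L; apply: near_eq_cvg.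
by near=> h; rewrite /= [_%:A]mulr1.
Unshelve. all: by end_near.
Qed.

Section exists_primitive.
Variables (f : R -> R) (fc : cont f).

Let mu := @lebesgue_measure R.

Let primR (f : R -> R) x := \int[mu]_(t in `[(-1 : R), x]) f t.

Let der_primR (h : R -> R) x : cont h -> -1 < x -> is_der x (primR h) (h x).
Proof.
move=> hc x1.
have xu : x < x + 1 by rewrite ltrDl.
have /= := @continuous_FTC1_closed R h (-1) x (x + 1) xu _ x1 (hc x).
case.
  apply: continuous_compact_integrable; first exact: segment_compact.
  by apply: continuous_subspaceT; exact: hc.
by move=> D E; split; [exact: D|rewrite -derive1E; exact: E].
Qed.

(** The integral from a fixed base point is differentiable only to the right of that
point.  The integral from -1, and the reflected integral of the reflected function,
are primitives for x > -1 and for x < 1; they are glued at 0, where they differ by a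
constant. *)
Lemma exists_primitive : exists F : R -> R, forall x, is_der x F (f x).
Proof.
pose G := primR f; pose H x := - primR (fun t => f (- t)) (- x).
have dG x : -1 < x -> is_der x G (f x) by exact: der_primR.
have dH x : x < 1 -> is_der x H (f x).
  move=> x1; have fN : cont (fun t => f (- t)).
    by move=> t; apply: continuous_comp; [exact: opp_continuous|exact: fc].
  have := derN (@der_comp (primR (fun t => f (- t))) -%R x _ _ (der_primR fN _)
    (derN (derI x))).
  by move=> /(_ ltac:(lra)) /der_eq; apply; rewrite opprK; ring.
pose c := G 0 - H 0.
have GH x : -1 < x -> x < 1 -> G x = H x + c.
  move=> x1 x2; have [x0|x0] := leP 0 x.
    have : G x - G 0 = H x - H 0.
      have dG' z : 0 <= z <= x -> is_der z G (f z) by move=> ?; apply: dG; lra.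
      have dH' z : 0 <= z <= x -> is_der z H (f z) by move=> ?; apply: dH; lra.
      exact: eq_increment_on x0 dG' dH'.
    rewrite /c; lra.
  have : G 0 - G x = H 0 - H x.
    have dG' z : x <= z <= 0 -> is_der z G (f z) by move=> ?; apply: dG; lra.
    have dH' z : x <= z <= 0 -> is_der z H (f z) by move=> ?; apply: dH; lra.
    exact: eq_increment_on (ltW x0) dG' dH'.
  rewrite /c; lra.
exists (fun x => if 0 < x then G x else H x + c) => x.
have [x1|x1] := ltP (-(1/2)) x.
  apply: (@near_eq_is_derive _ _ _ G); last by apply: dG; lra.
  near=> z; have [//|z0] := ltP 0 z; apply: GH; last lra.
  have : -1 < z; last by [].
  by near: z; apply: (cvgr_gt x cvg_id); lra.
apply: (@near_eq_is_derive _ _ _ (fun x => H x + c)).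
  near=> z; have z0 : z < 0 by near: z; apply: (cvgr_lt x cvg_id); lra.
  by rewrite ltNge (ltW z0).
by rewrite -[f x]addr0; apply: derD; [apply: dH; lra|exact: derC].
Unshelve. all: by end_near.
Qed.

End exists_primitive.
End Calculus.

Ltac solve_der := lazymatch goal with
  | |- is_der ?z ?f ?l => lazymatch f with
    | (fun x => x) => exact: derI
    | (fun _ => ?c) => exact: derC
    | (fun x => @Algebra.add _ (@?g x) (@?h x)) =>
        refine (@derD _ g h z _ _ _ _); solve_der
    | (fun x => @Algebra.opp _ (@?g x)) => refine (@derN _ g z _ _); solve_der
    | (fun x => @GRing.mul _ (@?g x) (@?h x)) =>
        refine (@derM _ g h z _ _ _ _); solve_der
    | (fun x => @GRing.exp _ (@?g x) ?n) => refine (@derX _ g n z _ _); solve_der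
    | (fun x => cos (@?g x)) => refine (@der_cos _ g z _ _); solve_der
    | (fun x => sin (@?g x)) => refine (@der_sin _ g z _ _); solve_der
    | (fun x => atan (@?g x)) => refine (@der_atan _ g z _ _); solve_der
    | (fun x => @GRing.inv _ (@?g x)) =>
        refine (@der_inv _ g z _ _ _); [|solve_der]
    | (fun x => Num.sqrt (@?g x)) =>
        refine (@der_sqrt _ g z _ _ _); [|solve_der]
    | (fun x => ?g x) => change (is_der z g l); solve_der
    | _ => try eassumption; match goal with H : _ |- _ => apply: H end
    end
  end.

(** * Continuity *)

Section Continuity.
Variable R : realType.
Implicit Types (f g : R -> R) (a b x y M : R).

Lemma contC a : cont (fun _ : R => a).
Proof. by move=> x; exact: cvg_cst. Qed.
Lemma contI : cont (fun x : R => x).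
Proof. by move=> x; exact: cvg_id. Qed.
Lemma contD f g : cont f -> cont g -> cont (fun x => f x + g x).
Proof. by move=> fc gc x; apply: cvgD; [exact: fc|exact: gc]. Qed.
Lemma contN f : cont f -> cont (fun x => - f x).
Proof. by move=> fc x; apply: cvgN; exact: fc. Qed.
Lemma contM f g : cont f -> cont g -> cont (fun x => f x * g x).
Proof. by move=> fc gc x; apply: cvgM; [exact: fc|exact: gc]. Qed.
Lemma cont_comp f g : cont f -> cont g -> cont (fun x => f (g x)).
Proof. by move=> fc gc x; apply: continuous_comp; [exact: gc|exact: fc]. Qed.
Lemma contX f n : cont f -> cont (fun x => f x ^+ n).
Proof.
move=> fc; apply: (@cont_comp (fun x => x ^+ n)) => //.
exact: cont_der (fun x => derX _ (derI x)).
Qed.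
Lemma cont_sin f : cont f -> cont (fun x => sin (f x)).
Proof. by apply: cont_comp; exact: continuous_sin. Qed.
Lemma cont_cos f : cont f -> cont (fun x => cos (f x)).
Proof. by apply: cont_comp; exact: continuous_cos. Qed.
Lemma cont_sum n (h : 'I_n -> R -> R) : (forall i, cont (h i)) ->
  cont (fun x => \sum_(i < n) h i x).
Proof.
elim: n h => [|n IH] h H.
  by rewrite (_ : (fun _ => _) = fun=> 0); [exact: contC|apply/funext => x; rewrite big_ord0].
rewrite (_ : (fun _ => _) = fun x => \sum_(i < n) h (widen_ord (leqnSn n) i) x +
  h ord_max x); first by apply: contD; [exact: IH|exact: H].
by apply/funext => x; rewrite big_ord_recr.
Qed.
Lemma cont_inv f : (forall x, f x != 0) -> cont f ->
  cont (fun x => (f x)^-1).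
Proof. by move=> f0 fc x; apply: cvgV; [exact: f0|exact: fc]. Qed.

Lemma cont_norm f : cont f -> cont (fun x => `|f x|).
Proof. by apply: cont_comp; exact: norm_continuous. Qed.

(** Lipschitz on every bounded interval. *)
Definition lip1 f := forall M, exists2 L, 0 <= L & forall x x', `|x| <= M -> `|x'| <= M ->
  `|f x - f x'| <= L * `|x - x'|.

Lemma lip1_cont f : lip1 f -> cont f.
Proof.
move=> H x; have [L L0 HL] := H (`|x| + 1).
have {}HL y : `|x - y| <= 1 -> `|f x - f y| <= L * `|x - y|.
  move=> xy; apply: HL; first lra.
  have := ler_normB x (x - y); rewrite subKr; lra.
apply/cvgrPdist_le => e e0; near=> y.
have : `|x - y| <= Num.min 1 (e / (L + 1)).
  near: y; apply: cvgr_dist_le; first exact: cvg_id.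
  by rewrite lt_min ltr01 divr_gt0 // ltr_wpDl.
rewrite le_min => /andP[/HL xy]; rewrite ler_pdivlMr ?ltr_wpDl // => h.
apply: le_trans xy (le_trans _ h); rewrite mulrDr mulr1 mulrC lerDl //.
Unshelve. all: by end_near.
Qed.

End Continuity.

Ltac solve_cont := lazymatch goal with
  | |- forall _, _ => move=> ?; solve_cont
  | |- cont ?f => lazymatch f with
    | (fun x => x) => exact: contI
    | (fun _ => ?c) => exact: contC
    | (fun x => @Algebra.add _ (@?g x) (@?h x)) => apply: (@contD _ g h); solve_cont
    | (fun x => @Algebra.opp _ (@?g x)) => apply: (@contN _ g); solve_cont
    | (fun x => @GRing.mul _ (@?g x) (@?h x)) => apply: (@contM _ g h); solve_cont
    | (fun x => @GRing.exp _ (@?g x) ?n) => apply: (@contX _ g n); solve_cont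
    | (fun x => cos (@?g x)) => apply: (@cont_cos _ g); solve_cont
    | (fun x => sin (@?g x)) => apply: (@cont_sin _ g); solve_cont
    | (fun x => Num.norm (@?g x)) => apply: (@cont_norm _ g); solve_cont
    | (fun x => ?g x) => change (cont g); solve_cont
    | _ => try eassumption
    end
  end.

(** * The oriented integral of a continuous function *)

Section OrientedIntegral.
Variable R : realType.
Implicit Types (f g u v : R -> R) (a b c x y M : R).

(** The integral is the increment of a primitive: additivity, orientation and
substitution are then immediate, and no integrability question arises. *)
Definition primitive f : R -> R :=
  xget (fun=> 0) [set F | forall x, is_der x F (f x)].

Definition oint f a b := primitive f b - primitive f a.

Lemma der_primitive f x : cont f -> is_der x (primitive f) (f x).
Proof.
move=> /exists_primitive[F FP]; rewrite /primitive.
by case: xgetP => [G -> /(_ x)//|/(_ F)/(_ FP)].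
Qed.

Lemma oint_primitive f (F : R -> R) a b :
  (forall x, is_der x F (f x)) -> oint f a b = F b - F a.
Proof.
move=> FP; apply: (eq_increment (df := f)) => // x.
by rewrite /primitive; case: xgetP => [G -> /(_ x)//|/(_ F)/(_ FP)].
Qed.

Lemma der_oint f a x : cont f -> is_der x (oint f a) (f x).
Proof.
move=> fc; rewrite -[f x]subr0; have := der_primitive x fc.
by move=> /derD/(_ (derN (derC (primitive f a) x))); rewrite oppr0.
Qed.

Lemma oint_cat f b a c : oint f a c = oint f a b + oint f b c.
Proof. by rewrite /oint; ring. Qed.

Lemma oint_swap f a b : oint f a b = - oint f b a.
Proof. by rewrite /oint; ring. Qed.

Lemma oint_refl f a : oint f a a = 0.
Proof. by rewrite /oint subrr. Qed.

Lemma eq_oint f g a b : f =1 g -> oint f a b = oint g a b.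
Proof. by move=> /funext ->. Qed.

Lemma ointD f g a b : cont f -> cont g ->
  oint (fun x => f x + g x) a b = oint f a b + oint g a b.
Proof.
move=> fc gc; rewrite (@oint_primitive _ (fun x => primitive f x + primitive g x)).
  by rewrite /oint; ring.
by move=> x; apply: derD; exact: der_primitive.
Qed.

Lemma ointZ f k a b : cont f ->
  oint (fun x => k * f x) a b = k * oint f a b.
Proof.
move=> fc; rewrite (@oint_primitive _ (fun x => k * primitive f x)).
  by rewrite /oint; ring.
by move=> x; apply: der_eq (derM (derC k x) (der_primitive x fc)) _; ring.
Qed.

Lemma ointZr f k a b : cont f ->
  oint (fun x => f x * k) a b = oint f a b * k.
Proof.
by move=> fc; rewrite mulrC -ointZ //; apply: eq_oint => x; rewrite mulrC.
Qed.

Lemma ointN f a b : cont f -> oint (fun x => - f x) a b = - oint f a b.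
Proof.
by move=> fc; rewrite -mulN1r -ointZ //; apply: eq_oint => x; rewrite mulN1r.
Qed.

Lemma ointB f g a b : cont f -> cont g ->
  oint (fun x => f x - g x) a b = oint f a b - oint g a b.
Proof. by move=> fc gc; rewrite ointD ?ointN //; exact: contN. Qed.

Lemma oint_cst k a b : oint (fun=> k) a b = k * (b - a).
Proof.
rewrite (@oint_primitive _ (fun x => k * x)) ?mulrBr // => x.
by apply: der_eq (derM (derC k x) (derI x)) _; ring.
Qed.

Lemma oint_sum n (h : 'I_n -> R -> R) a b : (forall i, cont (h i)) ->
  oint (fun x => \sum_(i < n) h i x) a b = \sum_(i < n) oint (h i) a b.
Proof.
move=> hc; rewrite (@oint_primitive _ (fun x => \sum_(i < n) primitive (h i) x)).
  by rewrite -sumrB.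
by move=> x; apply: der_sum => i; exact: der_primitive.
Qed.

Lemma oint_le f g a b : a <= b -> cont f -> cont g ->
  (forall x, a <= x <= b -> f x <= g x) -> oint f a b <= oint g a b.
Proof.
move=> ab fc gc H; apply: le_of_der_le ab _ _ H => x _; exact: der_primitive.
Qed.

Lemma oint_norm_le f g a b : a <= b -> cont f -> cont g ->
  (forall x, a <= x <= b -> `|f x| <= g x) -> `|oint f a b| <= oint g a b.
Proof.
move=> ab fc gc H; apply: norm_le_of_der_le ab _ _ H => x _; exact: der_primitive.
Qed.

Lemma eq_oint_on f g a b : a <= b -> cont f -> cont g ->
  (forall x, a <= x <= b -> f x = g x) -> oint f a b = oint g a b.
Proof.
move=> ab fc gc H; apply/le_anti/andP.
by split; apply: oint_le => // x /H ->.
Qed.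

Lemma oint_bound f (K : R) a b : cont f ->
  (forall x, Num.min a b <= x <= Num.max a b -> `|f x| <= K) ->
  `|oint f a b| <= K * `|b - a|.
Proof.
wlog ab : a b / a <= b => [W fc H|fc H].
  have [ab|/ltW ba] := leP a b; first exact: W ab fc H.
  rewrite oint_swap normrN (distrC b a); apply: (W b a ba fc) => x.
  by rewrite minC maxC; exact: H.
have := @oint_norm_le f (fun=> K) a b ab fc (@contC R K).
rewrite oint_cst (@ger0_norm _ (b - a)) ?subr_ge0 //; apply => x xab.
by apply: H; rewrite (min_idPl ab) (max_idPr ab).
Qed.

Lemma oint_subst f (p dp : R -> R) a b : cont f ->
  (forall x, is_der x p (dp x)) ->
  oint (fun x => f (p x) * dp x) a b = oint f (p a) (p b).
Proof.
move=> fc dpP; rewrite (@oint_primitive _ (fun x => primitive f (p x))) // => x.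
exact: der_comp (der_primitive _ fc) (dpP x).
Qed.

Lemma oint_affine f (k c a b : R) : cont f -> k != 0 ->
  oint (fun x => f (k * x + c)) a b = k^-1 * oint f (k * a + c) (k * b + c).
Proof.
move=> fc k0; rewrite -(@oint_subst f (fun x => k * x + c) (fun=> k)) //; last first.
  by move=> x; apply: der_eq (derD (derM (derC k x) (derI x)) (derC c x)) _; ring.
rewrite ointZr; last by apply: cont_comp => //; solve_cont.
by field.
Qed.

Lemma oint_by_parts u v (du dv : R -> R) a b :
  (forall x, is_der x u (du x)) -> (forall x, is_der x v (dv x)) ->
  cont du -> cont dv ->
  oint (fun x => u x * dv x) a b = u b * v b - u a * v a - oint (fun x => du x * v x) a b.
Proof.
move=> Hu Hv duc dvc; have uc := cont_der Hu; have vc := cont_der Hv.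
apply/eqP; rewrite eq_sym subr_eq eq_sym -ointD; [|solve_cont..].
rewrite (@oint_primitive _ (fun x => u x * v x)) // => x.
by apply: der_eq (derM (Hu x) (Hv x)) _; ring.
Qed.

(** Lipschitz on every square.  This regularity is stable under products and under
integration in one variable, and gives the explicit errors used for Fubini's theorem
and for the Fejer means. *)
Definition lip2 (f : R -> R -> R) := forall M, exists2 L, 0 <= L & forall x x' y y',
  `|x| <= M -> `|x'| <= M -> `|y| <= M -> `|y'| <= M ->
  `|f x y - f x' y'| <= L * (`|x - x'| + `|y - y'|).

Lemma lip2_lip1l (f : R -> R -> R) y : lip2 f -> lip1 (fun x => f x y).
Proof.
move=> H M; have [L L0 HL] := H (Num.max M `|y|); exists L => // x x' xM x'M.
by have := HL x x' y y; rewrite subrr normr0 addr0 !le_max xM x'M lexx orbT; apply.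
Qed.

Lemma lip2_lip1r (f : R -> R -> R) x : lip2 f -> lip1 (f x).
Proof.
move=> H M; have [L L0 HL] := H (Num.max M `|x|); exists L => // y y' yM y'M.
by have := HL x x y y'; rewrite subrr normr0 add0r !le_max yM y'M lexx orbT; apply.
Qed.

Lemma lip2_contl (f : R -> R -> R) y : lip2 f -> cont (fun x => f x y).
Proof. by move=> /(lip2_lip1l y)/lip1_cont. Qed.

Lemma lip2_contr (f : R -> R -> R) x : lip2 f -> cont (f x).
Proof. by move=> /(lip2_lip1r x)/lip1_cont. Qed.

Lemma lip2_swap (f : R -> R -> R) : lip2 f -> lip2 (fun x y => f y x).
Proof.
by move=> H M; have [L L0 HL] := H M; exists L => // *; rewrite (addrC `|_ - _|); exact: HL.
Qed.

Lemma between_norm a b x M : `|a| <= M -> `|b| <= M ->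
  Num.min a b <= x <= Num.max a b -> `|x| <= M.
Proof.
rewrite !ler_norml => /andP[? ?] /andP[? ?] /andP[].
by rewrite ge_min le_max => /orP[] ? /orP[] ?; apply/andP; split; lra.
Qed.

Lemma lip1_oint (f : R -> R -> R) a b : lip2 f -> lip1 (fun y => oint (fun t => f t y) a b).
Proof.
move=> H M; have [L L0 HL] := H (Num.max M (Num.max `|a| `|b|)).
exists (L * `|b - a|) => [|y y']; first exact: mulr_ge0.
move=> yM y'M.
rewrite -ointB; [|exact: lip2_contl..].
rewrite mulrAC; apply: oint_bound => [|x xab].
  by apply: contD; [|apply: contN]; exact: lip2_contl.
have := HL x x y y'; rewrite subrr normr0 add0r !le_max yM y'M.
have := between_norm (M := Num.max `|a| `|b|) _ _ xab.
by rewrite !le_max !lexx orbT => -> //; rewrite orbT; apply.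
Qed.

Lemma cont_oint (f : R -> R -> R) a b : lip2 f -> cont (fun y => oint (fun t => f t y) a b).
Proof. by move=> /(lip1_oint a b)/lip1_cont. Qed.

(** With h the increment of x, the error is the integral of f t y - f x y over t between
x and x + h, of size L h^2 by the Lipschitz condition. *)
Lemma der_oint_param (f : R -> R -> R) a c d x : lip2 f ->
  is_der x (fun x => oint (fun y => oint (fun t => f t y) a x) c d)
    (oint (f x) c d).
Proof.
move=> fl; have [L L0 HL] := fl (Num.max (`|x| + 1) (Num.max `|c| `|d|)).
apply: (@der_of_quadratic _ _ _ _ (L * `|d - c|)) => h h1.
have ct (y w : R) : cont (fun t => f t y - f w y).
  by apply: contD; [exact: lip2_contl|exact: contC].
have -> : oint (fun y => oint (fun t => f t y) a (x + h)) c d -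
    oint (fun y => oint (fun t => f t y) a x) c d - h * oint (f x) c d =
    oint (fun y => oint (fun t => f t y - f x y) x (x + h)) c d.
  rewrite -ointB; [|exact: cont_oint..].
  rewrite -ointZ -?ointB; [|..|exact: lip2_contr]; last first.
  - by apply: contM; [exact: contC|exact: lip2_contr].
  - by apply: contD; [|apply: contN]; exact: cont_oint.
  apply: eq_oint => y; rewrite ointB; [|exact: lip2_contl|exact: contC].
  rewrite oint_cst (oint_cat _ x a (x + h)); ring.
rewrite (_ : L * `|d - c| * h ^+ 2 = (L * `|h|) * `|h| * `|d - c|); last first.
  by rewrite -[h ^+ 2]real_normK ?num_real //; ring.
apply: oint_bound => [|y ycd].
  have -> : (fun y => oint (fun t => f t y - f x y) x (x + h)) =
      (fun y => oint (fun t => f t y) x (x + h) - f x y * h).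
    apply/funext => y; rewrite ointB; [|exact: lip2_contl|exact: contC].
    by rewrite oint_cst (addrC x) addrK.
  apply: contD; first exact: cont_oint.
  by apply/contN/contM; [exact: lip2_contr|exact: contC].
rewrite {3}(_ : h = x + h - x); last by ring.
apply: oint_bound => // t tx.
have th : `|t - x| <= `|h|.
  move: tx; rewrite ge_min le_max => /andP[/orP tx1 /orP tx2].
  have := ler_norm h; have := ler_norm (- h); rewrite normrN => ? ?.
  by rewrite ler_norml; case: tx1 tx2 => ? [] ?; apply/andP; split; lra.
have yM : `|y| <= Num.max `|c| `|d|.
  by apply: between_norm ycd; rewrite le_max lexx ?orbT.
have xM : `|x| <= `|x| + 1 by rewrite lerDl.
have tM : `|t| <= `|x| + 1.
  by have := ler_normD x (t - x); rewrite addrC subrK; lra.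
rewrite le_max in yM; have := HL t x y y.
rewrite subrr normr0 addr0 !le_max yM xM tM !orbT => /(_ isT isT isT isT).
by move=> /le_trans; apply; rewrite ler_wpM2l.
Qed.

(** Both sides vanish for b = a and have the same derivative in b. *)
Lemma fubini (f : R -> R -> R) a b c d : lip2 f ->
  oint (fun y => oint (fun x => f x y) a b) c d =
  oint (fun x => oint (f x) c d) a b.
Proof.
move=> fl; set G := fun x => oint (fun y => oint (fun t => f t y) a x) c d.
have Ga : G a = 0.
  by rewrite /G (@eq_oint _ (fun=> 0)) ?oint_cst ?mul0r // => y; rewrite oint_refl.
rewrite [RHS](@oint_primitive _ G) ?Ga ?subr0 // => x; exact: der_oint_param.
Qed.

End OrientedIntegral.

(** * Differentiation under the integral sign *)

Section DerUnder.
Variable R : realType.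
Implicit Types (f g u w : R -> R) (a b x y : R).

Lemma norm_sin_le x : `|sin x| <= `|x|.
Proof.
wlog x0 : x / 0 <= x => [W|].
  have [/W//|/ltW x0] := leP 0 x.
  by rewrite -normrN -sinN -(normrN x) W // oppr_ge0.
have := @norm_le_of_der_le R (@sin R) id (@cos R) (fun=> 1) 0 x x0.
rewrite sin0 !subr0 (ger0_norm x0); apply => *; [|exact: derI|exact: cos_max].
by apply: der_eq (der_sin (derI _)) _; rewrite mulr1.
Qed.

Lemma cosB1_le x : `|cos x - 1| <= x ^+ 2 / 2.
Proof.
wlog x0 : x / 0 <= x => [W|].
  have [/W//|/ltW x0] := leP 0 x.
  by have := W (- x); rewrite cosN sqrrN oppr_ge0; apply.
have := @norm_le_of_der_le R (@cos R) (fun x => x ^+ 2 / 2) (fun x => - sin x) id 0 x x0.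
rewrite cos0 expr0n /= mul0r subr0; apply => [t _|t _|t /andP[t0 _]].
- by apply: der_eq (der_cos (derI _)) _; rewrite mulr1.
- by apply: der_eq; [solve_der|rewrite /=; field].
- by rewrite normrN (le_trans (norm_sin_le t)) // ger0_norm.
Qed.

Lemma sinB_le x : `|sin x - x| <= x ^+ 2 / 2.
Proof.
wlog x0 : x / 0 <= x => [W|].
  have [/W//|/ltW x0] := leP 0 x.
  by have := W (- x); rewrite sinN -opprD normrN sqrrN oppr_ge0; apply.
have := @norm_le_of_der_le R (fun x => sin x - x) (fun x => x ^+ 2 / 2) (fun x => cos x - 1) id 0 x x0.
rewrite sin0 expr0n /= mul0r !subr0; apply => [t _|t _|t /andP[t0 _]].
- by apply: der_eq; [solve_der|rewrite /=; ring].
- by apply: der_eq; [solve_der|rewrite /=; field].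
- have [t2|t2] := leP t 2.
    apply: le_trans (cosB1_le t) _; nra.
  have := cos_max t; rewrite !ler_norml => /andP[? ?]; apply/andP; split; lra.
Qed.

Lemma cos_taylor x y : `|cos (x + y) - cos x + y * sin x| <= y ^+ 2.
Proof.
have -> : cos (x + y) - cos x + y * sin x =
    cos x * (cos y - 1) - sin x * (sin y - y) by rewrite cosD; ring.
apply: le_trans (ler_normB _ _) _; rewrite !normrM.
have -> : y ^+ 2 = 1 * (y ^+ 2 / 2) + 1 * (y ^+ 2 / 2) by field.
by apply: lerD; apply: ler_pM; rewrite ?cos_max ?sin_max ?cosB1_le ?sinB_le.
Qed.

Lemma sin_taylor x y : `|sin (x + y) - sin x - y * cos x| <= y ^+ 2.
Proof.
have := cos_taylor (x - pi / 2) y.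
by rewrite (_ : x - pi / 2 + y = x + y - pi / 2) ?cosBpihalf ?sinBpihalf ?mulrN //; ring.
Qed.

(** The second-order Taylor bound of the cosine, multiplied by |w| and integrated, is
the quadratic bound that [der_of_quadratic] asks for. *)
Lemma der_oint_cos w u a b s : a <= b -> cont w -> cont u ->
  is_der s (fun s => oint (fun t => w t * cos (s * u t)) a b)
    (- oint (fun t => w t * u t * sin (s * u t)) a b).
Proof.
move=> ab wc uc.
apply: (@der_of_quadratic _ _ _ _ (oint (fun t => `|w t| * u t ^+ 2) a b)) => h h1.
rewrite mulrN opprK -ointZ; last by solve_cont.
rewrite -ointB; [|solve_cont..].
rewrite -ointD; [|solve_cont..].
rewrite -ointZr; last by solve_cont.
apply: oint_norm_le ab _ _ _ => [||t _]; first by solve_cont.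
  by solve_cont.
have -> : w t * cos ((s + h) * u t) - w t * cos (s * u t) +
    h * (w t * u t * sin (s * u t)) =
    w t * (cos (s * u t + h * u t) - cos (s * u t) + (h * u t) * sin (s * u t)).
  by rewrite mulrDl; ring.
by rewrite normrM -(mulrA `|w t|) ler_wpM2l // -exprMn [u t * h]mulrC cos_taylor.
Qed.

Lemma der_oint_sin w u a b s : a <= b -> cont w -> cont u ->
  is_der s (fun s => oint (fun t => w t * sin (s * u t)) a b)
    (oint (fun t => w t * u t * cos (s * u t)) a b).
Proof.
move=> ab wc uc.
apply: (@der_of_quadratic _ _ _ _ (oint (fun t => `|w t| * u t ^+ 2) a b)) => h h1.
rewrite -ointZ; last by solve_cont.
rewrite -ointB; [|solve_cont..].
rewrite -ointB; [|solve_cont..].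
rewrite -ointZr; last by solve_cont.
apply: oint_norm_le ab _ _ _ => [||t _]; first by solve_cont.
  by solve_cont.
have -> : w t * sin ((s + h) * u t) - w t * sin (s * u t) -
    h * (w t * u t * cos (s * u t)) =
    w t * (sin (s * u t + h * u t) - sin (s * u t) - (h * u t) * cos (s * u t)).
  by rewrite mulrDl; ring.
by rewrite normrM -(mulrA `|w t|) ler_wpM2l // -exprMn [u t * h]mulrC sin_taylor.
Qed.
End DerUnder.

(** * Fresnel integrals *)

Section Fresnel.
Variable R : realType.
Implicit Types (a b d x y k : R).

(** Integration by parts with the primitive sin(t^2 + d) / (2t): the integral minus this
function has derivative sin(t^2 + d) / (2t^2), dominated by that of -1/(2t).  The
phase d makes one bound serve for the cosine, the sine and their combinations. *)
Lemma oint_quadratic_phase_tail d x y : 0 < x -> x <= y ->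
  `|oint (fun t => cos (t ^+ 2 + d)) x y| <= x^-1.
Proof.
move=> x0 xy; set f := fun t => cos (t ^+ 2 + d).
have fc : cont f by rewrite /f; solve_cont.
have y0 : 0 < y by exact: lt_le_trans xy.
have t0 t : x <= t <= y -> t != 0.
  by move=> /andP[xt _]; rewrite gt_eqF // (lt_le_trans x0).
have : `|(oint f x y - sin (y ^+ 2 + d) / (2 * y)) -
    (oint f x x - sin (x ^+ 2 + d) / (2 * x))| <= - (2 * y)^-1 - - (2 * x)^-1.
  apply: (@norm_le_of_der_le R (fun t => oint f x t - sin (t ^+ 2 + d) * (2 * t)^-1)
  (fun t => - (2 * t)^-1) (fun t => sin (t ^+ 2 + d) / (2 * t ^+ 2))
  (fun t => (2 * t ^+ 2)^-1) x y xy) => [t /t0 tn0|t /t0 tn0|t _].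
- apply: der_eq.
    refine (derD (der_oint _ _ fc) _); solve_der; by rewrite mulf_neq0.
  by rewrite /f /=; field.
- apply: der_eq; first by solve_der; rewrite mulf_neq0.
  by rewrite /=; field.
- rewrite normrM [X in _ * X]ger0_norm; last by rewrite invr_ge0 mulr_ge0 // sqr_ge0.
  by rewrite ler_piMl ?sin_max // invr_ge0 mulr_ge0 // sqr_ge0.
rewrite oint_refl sub0r => H.
set I := oint f x y in H *.
set A := sin (y ^+ 2 + d) / (2 * y) in H; set B := sin (x ^+ 2 + d) / (2 * x) in H.
have bd z : 0 < z -> `|sin (z ^+ 2 + d) / (2 * z)| <= (2 * z)^-1.
  move=> z0; rewrite normrM [X in _ * X]ger0_norm ?invr_ge0 ?mulr_ge0 ?(ltW z0) //.
  by rewrite ler_piMl ?sin_max // invr_ge0 mulr_ge0 // (ltW z0).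
have HA : `|A| <= _ := bd y y0; have HB : `|B| <= _ := bd x x0.
have -> : x^-1 = (2 * x)^-1 + (2 * x)^-1 by field; rewrite gt_eqF.
move: H HA HB; rewrite !ler_norml => /andP[? ?] /andP[? ?] /andP[? ?].
apply/andP; split; lra.
Qed.

Lemma oint_quadratic_phase_bound d x : 0 <= x ->
  `|oint (fun t => cos (t ^+ 2 + d)) 0 x| <= 2.
Proof.
move=> x0; have fc : cont (fun t : R => cos (t ^+ 2 + d)) by solve_cont.
have small y : 0 <= y <= 1 -> `|oint (fun t => cos (t ^+ 2 + d)) 0 y| <= 1.
  move=> /andP[y0 y1]; have := @oint_bound R _ 1 0 y fc.
  rewrite subr0 mul1r (ger0_norm y0) => H; apply: le_trans (H _) y1 => t _; exact: cos_max.
have [x1|x1] := leP x 1; first by apply: le_trans (small x _) _; rewrite ?x0 //; lra.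
rewrite (oint_cat _ 1); apply: le_trans (ler_normD _ _) _.
have := @oint_quadratic_phase_tail d 1 x ltr01 (ltW x1).
have := small 1; rewrite invr1 ler01 lexx => /(_ isT); lra.
Qed.

(** The primitive P of cos((x t)^2 + d) is O(1/x) uniformly, by the previous bound and
scaling; integrating by parts against 1 / (1 + t^2) keeps this rate. *)
Lemma oint_damped_phase d x : 0 < x ->
  `|oint (fun t => (1 + t ^+ 2)^-1 * cos ((x * t) ^+ 2 + d)) 0 1| <= 5 / x.
Proof.
move=> x0; have fc : cont (fun t : R => cos (t ^+ 2 + d)) by solve_cont.
pose f := fun t : R => cos (t ^+ 2 + d).
have q0 t : 1 + t ^+ 2 != 0 :> R by rewrite gt_eqF // ltr_wpDr ?ltr01 ?sqr_ge0.
have qc : cont (fun t : R => (1 + t ^+ 2)^-1) by apply: cont_inv => //; solve_cont.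
pose P t := x^-1 * oint f 0 (x * t).
have dP t : is_der t P (cos ((x * t) ^+ 2 + d)).
  apply: der_eq.
    refine (derM (derC _ _) _).
    exact: (@der_comp R (oint f 0) (fun t => x * t) t _ _ (der_oint 0 _ fc) (derM (derC x t) (derI t))).
  by rewrite /f /=; field; rewrite gt_eqF.
rewrite (@oint_by_parts R _ P (fun t => - (1 + t ^+ 2) ^- 2 * (2 * t)) (fun t => cos ((x * t) ^+ 2 + d))) //; last 3 first.
- by move=> t; apply: der_eq; [solve_der; exact: q0|rewrite /=; ring].
- have -> : (fun t : R => - (1 + t ^+ 2) ^- 2 * (2 * t)) = fun t => - ((1 + t ^+ 2)^-1 ^+ 2) * (2 * t).
    by apply/funext => t; rewrite exprVn.
  by solve_cont.
- by solve_cont.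
have Pb t : 0 <= t -> `|P t| <= 2 / x.
  move=> t0; rewrite normrM normfV (gtr0_norm x0) mulrC ler_wpM2r ?invr_ge0 ?(ltW x0) //.
  by apply: oint_quadratic_phase_bound; rewrite mulr_ge0 // ltW.
have P0 : P 0 = 0 by rewrite /P mulr0 oint_refl mulr0.
have Pc : cont P by exact: cont_der dP.
have B : `|oint (fun t => - (1 + t ^+ 2) ^- 2 * (2 * t) * P t) 0 1| <= 4 / x.
  have := @oint_bound R (fun t => - (1 + t ^+ 2) ^- 2 * (2 * t) * P t) (4 / x) 0 1.
  rewrite subr0 normr1 mulr1; apply.
    have -> : (fun t : R => - (1 + t ^+ 2) ^- 2 * (2 * t) * P t) =
        fun t => - ((1 + t ^+ 2)^-1 ^+ 2) * (2 * t) * P t.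
      by apply/funext => t; rewrite exprVn.
    by solve_cont.
  move=> t; rewrite (min_idPl ler01) (max_idPr ler01) => /andP[t0 t1].
  rewrite normrM (_ : 4 / x = 2 * (2 / x)); last by ring.
  apply: ler_pM => //; last exact: Pb.
  rewrite normrM normrN [X in X * _]ger0_norm ?invr_ge0 ?sqr_ge0 //.
  rewrite [X in _ * X]ger0_norm ?mulr_ge0 // -[leRHS]mul1r.
  apply: ler_pM; rewrite ?invr_ge0 ?sqr_ge0 ?mulr_ge0 //; last lra.
  rewrite invf_le1 ?exprn_gt0 ?expr_ge1 //; have := sqr_ge0 t; lra.
have := Pb 1 ler01; rewrite P0 mulr0 subr0 expr1n => B1.
apply: le_trans (ler_normB _ _) _.
have -> : 5 / x = 1 / x + 4 / x by ring.
apply: lerD => //; rewrite normrM ger0_norm ?invr_ge0 //.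
by rewrite (_ : 1 / x = (1 + 1)^-1 * (2 / x)) ?ler_wpM2l ?invr_ge0 //; field; rewrite gt_eqF.
Qed.

End Fresnel.

Section FresnelLimit.
Variable R : realType.
Implicit Types (a b d x y k : R).

Definition fresnelC x : R := oint (fun t => cos (t ^+ 2)) 0 x.
Definition fresnelS x : R := oint (fun t => sin (t ^+ 2)) 0 x.
Local Notation C := fresnelC.
Local Notation S := fresnelS.

Let cc : cont (fun t : R => cos (t ^+ 2)). Proof. by solve_cont. Qed.
Let cs : cont (fun t : R => sin (t ^+ 2)). Proof. by solve_cont. Qed.

Lemma oint_phase_shift d a b : oint (fun t => cos (t ^+ 2 + d)) a b =
  cos d * oint (fun t => cos (t ^+ 2)) a b - sin d * oint (fun t => sin (t ^+ 2)) a b.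
Proof.
rewrite -!ointZ // -ointB; [|solve_cont..].
by apply: eq_oint => t; rewrite cosD; ring.
Qed.

(** The real form of the polar-coordinates evaluation of the square of the Fresnel
integral C + iS: the derivative in x of the real or imaginary part of (C + iS)^2 is
obtained by differentiating exp(i x^2 (1 + t^2)) / (1 + t^2) under the integral, after
rescaling C(x) and S(x) to integrals over [0, 1].  The constant pi/4 is the integral
of 1 / (1 + t^2). *)
Lemma fresnel_squares x : C x ^+ 2 - S x ^+ 2 =
    oint (fun t => (1 + t ^+ 2)^-1 * cos ((x * t) ^+ 2 + (x ^+ 2 - pi / 2))) 0 1 /\
  2 * C x * S x =
    pi / 4 - oint (fun t => (1 + t ^+ 2)^-1 * cos ((x * t) ^+ 2 + x ^+ 2)) 0 1.
Proof.
have q0 t : 1 + t ^+ 2 != 0 :> R by rewrite gt_eqF // ltr_wpDr ?ltr01 ?sqr_ge0.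
pose q t : R := (1 + t ^+ 2)^-1; pose u t : R := 1 + t ^+ 2.
have qc : cont q by apply: cont_inv => //; solve_cont.
have uc : cont u by rewrite /u; solve_cont.
have dC z : is_der z C (cos (z ^+ 2)) by exact: der_oint.
have dS z : is_der z S (sin (z ^+ 2)) by exact: der_oint.
have C0 : C 0 = 0 by exact: oint_refl.
have S0 : S 0 = 0 by exact: oint_refl.
have sq (z : R) : is_der z (fun z => z ^+ 2) (2 * z).
  by apply: der_eq; [solve_der|rewrite /=; ring].
have half d z : z * oint (fun t => cos ((z * t) ^+ 2 + d)) 0 1 = cos d * C z - sin d * S z.
  rewrite -oint_phase_shift.
  have -> : oint (fun t => cos (t ^+ 2 + d)) 0 z =
    oint (fun t => cos (t ^+ 2 + d)) (z * 0) (z * 1) by rewrite mulr0 mulr1.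
  rewrite -(@oint_subst R (fun t => cos (t ^+ 2 + d)) (fun t => z * t) (fun=> z)); last 2 first.
  - by solve_cont.
  - by move=> t; apply: der_eq; [solve_der|rewrite /=; ring].
  by rewrite ointZr 1?mulrC //; solve_cont.
split.
- have -> : C x ^+ 2 - S x ^+ 2 = (C x ^+ 2 - S x ^+ 2) - (C 0 ^+ 2 - S 0 ^+ 2).
    by rewrite C0 S0; ring.
  have -> : oint (fun t => (1 + t ^+ 2)^-1 * cos ((x * t) ^+ 2 + (x ^+ 2 - pi / 2))) 0 1 =
      oint (fun t => q t * sin (x ^+ 2 * u t)) 0 1 -
      oint (fun t => q t * sin (0 ^+ 2 * u t)) 0 1.
    rewrite [X in _ = _ - X](@eq_oint _ _ (fun=> 0)) => [|t].
      rewrite oint_cst mul0r subr0; apply: eq_oint => t.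
      by rewrite /q addrA cosBpihalf /u; congr (_ * sin _); ring.
    by rewrite expr0n /= mul0r sin0 mulr0.
  apply: (@eq_increment R (fun x => C x ^+ 2 - S x ^+ 2)
    (fun x => oint (fun t => q t * sin (x ^+ 2 * u t)) 0 1)
    (fun x => 2 * (cos (x ^+ 2) * C x - sin (x ^+ 2) * S x))) => z.
    by apply: der_eq; [solve_der|rewrite /=; ring].
  apply: der_eq.
    exact: (@der_comp R (fun s => oint (fun t => q t * sin (s * u t)) 0 1) (fun z => z ^+ 2) z _ _ (der_oint_sin (z ^+ 2) ler01 qc uc) (sq z)).
  rewrite (@eq_oint _ _ (fun t => cos ((z * t) ^+ 2 + z ^+ 2))) => [|t].
    by rewrite -half; ring.
  by rewrite /q /u mulVf // mul1r; congr cos; ring.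
- have -> : 2 * C x * S x = 2 * C x * S x - 2 * C 0 * S 0 by rewrite C0 S0; ring.
  have -> : pi / 4 - oint (fun t => (1 + t ^+ 2)^-1 * cos ((x * t) ^+ 2 + x ^+ 2)) 0 1 =
      - oint (fun t => q t * cos (x ^+ 2 * u t)) 0 1 -
      - oint (fun t => q t * cos (0 ^+ 2 * u t)) 0 1.
    rewrite [X in _ = _ - - X](@oint_primitive _ _ (@atan R)) => [|t].
      rewrite atan1 atan0 subr0 opprK addrC; congr (- _ + _); apply: eq_oint => t.
      by rewrite /q /u; congr (_ * cos _); ring.
    rewrite expr0n /= mul0r cos0 mulr1.
    by apply: der_eq (der_atan (derI t)) _; rewrite mulr1.
  apply: (@eq_increment R (fun x => 2 * C x * S x)
    (fun x => - oint (fun t => q t * cos (x ^+ 2 * u t)) 0 1)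
    (fun x => 2 * (cos (x ^+ 2) * S x + sin (x ^+ 2) * C x))) => z.
    by apply: der_eq; [solve_der|rewrite /=; ring].
  apply: der_eq.
    apply: derN.
    exact: (@der_comp R (fun s => oint (fun t => q t * cos (s * u t)) 0 1) (fun z => z ^+ 2) z _ _ (der_oint_cos (z ^+ 2) ler01 qc uc) (sq z)).
  rewrite (@eq_oint _ _ (fun t => cos ((z * t) ^+ 2 + (z ^+ 2 - pi / 2)))) => [|t].
    have := half (z ^+ 2 - pi / 2) z; rewrite cosBpihalf sinBpihalf => H.
    transitivity (2 * (z * oint (fun t => cos ((z * t) ^+ 2 + (z ^+ 2 - pi / 2))) 0 1)); first ring.
    by rewrite H; ring.
  by rewrite /q /u mulVf // mul1r addrA cosBpihalf; congr sin; ring.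
Qed.

Lemma cos_pi4 : cos (pi / 4) = (Num.sqrt 2)^-1 :> R.
Proof.
have := pi_gt0 R => p0.
have c0 : 0 < cos (pi / 4 : R) by apply: cos_gt0_pihalf; apply/andP; split; lra.
have r2 : 0 < Num.sqrt 2 :> R by rewrite sqrtr_gt0.
apply/eqP; rewrite -(@eqrXn2 _ 2) ?invr_ge0 ?(ltW c0) ?(ltW r2) //.
rewrite exprVn sqr_sqrtr // eq_sym -subr_eq0; apply/eqP.
have : cos (pi / 4 *+ 2) = 0 :> R by rewrite -cos_pihalf; congr cos; field.
rewrite cos_mulr2n => h; lra.
Qed.

Lemma sin_pi4 : sin (pi / 4) = (Num.sqrt 2)^-1 :> R.
Proof. by rewrite -cos_pi4 -cosBpihalf -cosN; congr cos; field. Qed.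

(** Otherwise cos(sqrt 2) < 0, against cos x >= 1 - x^2/2. *)
Lemma sqrt2_le_pihalf : Num.sqrt 2 <= pi / 2 :> R.
Proof.
rewrite leNgt; apply/negP => h.
have s2 : (Num.sqrt 2 : R) ^+ 2 = 2 by rewrite sqr_sqrtr.
have s0 : 0 <= Num.sqrt 2 :> R by exact: sqrtr_ge0.
have := cosB1_le (Num.sqrt 2 : R); rewrite s2 divff // ler_norml => /andP[h1 _].
have p2 := pi_ge2 R.
have : cos (Num.sqrt 2) < cos (pi / 2) :> R.
  by rewrite ltr_cos // in_itv /=; apply/andP; split; nra.
rewrite cos_pihalf; lra.
Qed.

(** This settles the sign of the limits, which the squares leave open.  With
x0^2 = pi/2 one has cos(t^2) + sin(t^2) >= 1 on [0, x0], which contributes at least x0,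
while the rest is at least - sqrt 2 / x0 >= - x0 as sqrt 2 <= pi/2. *)
Lemma fresnel_sum_ge0 x : Num.sqrt (pi / 2) <= x -> 0 <= C x + S x.
Proof.
have p0 := pi_gt0 R; have p2 := sqrt2_le_pihalf.
set x0 := Num.sqrt (pi / 2); have x0sq : x0 ^+ 2 = pi / 2 by rewrite sqr_sqrtr //; lra.
have x00 : 0 < x0 by rewrite sqrtr_gt0; lra.
move=> xx0; rewrite /C /S (oint_cat _ x0 0 x) (oint_cat (fun t => sin _) x0 0 x).
have tail := oint_quadratic_phase_tail (- (pi / 4)) x00 xx0.
rewrite oint_phase_shift cosN sinN cos_pi4 sin_pi4 in tail.
have head : x0 <= oint (fun t => cos (t ^+ 2)) 0 x0 + oint (fun t => sin (t ^+ 2)) 0 x0.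
  rewrite -ointD // -{1}(subr0 x0) -[X in X <= _]mul1r -oint_cst.
  apply: oint_le => [||| t /andP[t0 tx]]; [exact: ltW|exact: contC|solve_cont|].
  set s := t ^+ 2; have s0 : 0 <= s by exact: sqr_ge0.
  have s1 : s <= pi / 2 by rewrite -x0sq lerXn2r // nnegrE // ltW.
  have c0 : 0 <= cos s by apply: cos_ge0_pihalf; apply/andP; split; lra.
  have si0 : 0 <= sin s by apply: sin_ge0_pi; apply/andP; split; lra.
  have := cos2Dsin2 s; nra.
have r2 : 0 < Num.sqrt 2 :> R by rewrite sqrtr_gt0.
have xi : (Num.sqrt 2) * x0^-1 <= x0 by rewrite ler_pdivrMr // -expr2 x0sq.
move: tail head; set u := oint _ x0 x; set v := oint _ x0 x.
rewrite mulNr opprK -mulrDr normrM normfV (gtr0_norm r2) ler_pdivrMl // ler_norml => /andP[? _] ?.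
lra.
Qed.

(** By [fresnel_squares] and [oint_damped_phase], C^2 - S^2 = O(1/x) and
2CS = pi/4 + O(1/x).  Since (C + S)^2 >= 4CS and C + S >= 0, the sum C + S is bounded
below, and dividing C^2 - S^2 by it gives C - S = O(1/x).  Then
(C + S)^2 = (C - S)^2 + 4CS = pi/2 + O(1/x), which determines C + S. *)
Lemma fresnel_limit : exists2 K, 0 <= K & forall x, 0 < x ->
  `|C x - Num.sqrt (pi / 8)| <= K / x /\ `|S x - Num.sqrt (pi / 8)| <= K / x.
Proof.
have p0 := pi_gt0 R; have p2 := pi_ge2 R.
set c := Num.sqrt (pi / 8); have c0 : 0 <= c by exact: sqrtr_ge0.
have c2 : c ^+ 2 = pi / 8 by rewrite sqr_sqrtr //; lra.
have p4 : pi < 4 :> R by have := pihalf_lt2 R; lra.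
have c1 : c <= 1 by rewrite leNgt; apply/negP => h; nra.
have c12 : 1 / 2 <= c by rewrite leNgt; apply/negP => h; nra.
exists 1000; first exact: ler0n.
move=> x x0.
have bd f : cont f -> (forall t, `|f t| <= 1) -> `|oint f 0 x| <= x.
  move=> fc f1; have := @oint_bound R f 1 0 x fc; rewrite subr0 mul1r (gtr0_norm x0).
  by apply => t _; exact: f1.
have Cx : `|C x| <= x by apply: bd => // t; exact: cos_max.
have Sx : `|S x| <= x by apply: bd => // t; exact: sin_max.
have xi0 : 0 < x^-1 by rewrite invr_gt0.
have xi : x * x^-1 = 1 by rewrite divff // gt_eqF.
(* For small x the trivial bound C, S <= x <= 20 is enough, by the size of K; for large
   x the errors are small enough for 1/2 <= C + S. *)
have [x20|x20] := leP x 20.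
  have xi20 : 1 / 20 <= x^-1 by rewrite leNgt; apply/negP => h; nra.
  split; apply: le_trans (ler_normB _ _) _; rewrite (ger0_norm c0); lra.
have [] := fresnel_squares x.
have := oint_damped_phase (x ^+ 2 - pi / 2) x0; set u := oint _ _ _ => hu Eu.
have := oint_damped_phase (x ^+ 2) x0; set v := oint _ _ _ => hv Ev.
have CS0 : 0 <= C x + S x.
  apply: fresnel_sum_ge0; rewrite -(ger0_norm (ltW x0)) -sqrtr_sqr ler_wsqrtr //; nra.
have xi20 : x^-1 <= 1 / 20 by rewrite leNgt; apply/negP => h; nra.
move: CS0 hu Eu hv Ev; rewrite !ler_norml; move: (C x) (S x) (x^-1) xi0 xi20 => a b e e0 e20.
move=> ab0 /andP[u1 u2] Eu /andP[v1 v2] Ev.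
have s2 : (a + b) ^+ 2 = a ^+ 2 + b ^+ 2 + 2 * a * b by ring.
have d2 : (a - b) ^+ 2 = a ^+ 2 + b ^+ 2 - 2 * a * b by ring.
have ab1 : 1 / 2 <= a + b.
  have := sqr_ge0 (a - b) => ?; rewrite leNgt; apply/negP => h; nra.
have E1 : (a - b) * (a + b) = u by rewrite -Eu; ring.
have d1 : - (10 * e) <= a - b <= 10 * e.
  by apply/andP; split; rewrite leNgt; apply/negP => h; nra.
have d1' : (a - b) ^+ 2 <= 5 * e by move/andP: d1 => [? ?]; nra.
have E2 : (a + b - 2 * c) * (a + b + 2 * c) = (a - b) ^+ 2 - 2 * v.
  transitivity ((a + b) ^+ 2 - 4 * c ^+ 2); first ring.
  by rewrite c2 s2 d2; lra.
have d3 : - (15 * e) <= a + b - 2 * c <= 15 * e.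
  have := sqr_ge0 (a - b) => ?.
  by apply/andP; split; rewrite leNgt; apply/negP => h; nra.
move/andP: d1 => [? ?]; move/andP: d3 => [? ?].
by split; apply/andP; split; lra.
Qed.

End FresnelLimit.

(** * The Bessel integral: differential equation and leading term *)

Section Bessel.
Variable R : realType.
Implicit Types (a b d x y k t : R).

(** Poisson's integral for the Bessel function J_2: [bess k] = 3 pi J_2(k) / k^2. *)
Definition bess k : R := oint (fun t => cos t ^+ 4 * cos (k * sin t)) (- (pi / 2)) (pi / 2).
Definition bess1 k : R :=
  - oint (fun t => cos t ^+ 4 * sin t * sin (k * sin t)) (- (pi / 2)) (pi / 2).
Definition bess2 k : R :=
  - oint (fun t => cos t ^+ 4 * sin t * sin t * cos (k * sin t)) (- (pi / 2)) (pi / 2).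

Let pi_le : - (pi / 2) <= pi / 2 :> R.
Proof. by have := pi_gt0 R; lra. Qed.

Lemma der_bess k : is_der k bess (bess1 k).
Proof.
by apply: (@der_oint_cos R (fun t => cos t ^+ 4) (fun t => sin t) _ _ k pi_le); solve_cont.
Qed.

Lemma der_bess1 k : is_der k bess1 (bess2 k).
Proof.
apply: derN; apply: (@der_oint_sin R (fun t => cos t ^+ 4 * sin t) (fun t => sin t) _ _ k pi_le).
  by solve_cont.
by solve_cont.
Qed.

Let der_sin_sin k t : is_der t (fun t => sin (k * sin t)) (k * cos t * cos (k * sin t)).
Proof. by apply: der_eq; [solve_der|rewrite /=; ring]. Qed.

Let cosN_pihalf : cos (- (pi / 2)) = 0 :> R.
Proof. by rewrite cosN cos_pihalf. Qed.

(** cos^4 (1 - sin^2) = cos^5 cos, and k cos t cos(k sin t) is the derivative of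
sin(k sin t): one integration by parts. *)
Lemma bessel_ode k : k * bess2 k + 5 * bess1 k + k * bess k = 0.
Proof.
have H : k * (bess k + bess2 k) = - (5 * bess1 k); last by lra.
rewrite -ointB -?ointZ; [|solve_cont..].
rewrite (@eq_oint _ _ (fun t => cos t ^+ 5 * (k * cos t * cos (k * sin t)))) => [|t]; last first.
  rewrite (_ : cos t ^+ 4 * cos (k * sin t) - cos t ^+ 4 * sin t * sin t * cos (k * sin t) =
    cos t ^+ 4 * (1 - sin t ^+ 2) * cos (k * sin t)); last by ring.
  by rewrite -cos2sin2; ring.
rewrite (@oint_by_parts R _ _ (fun t => - 5 * (cos t ^+ 4 * sin t)) _ _ _ _ (der_sin_sin k)); last 3 first.
- by move=> t; apply: der_eq; [solve_der|rewrite /=; ring].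
- by solve_cont.
- by solve_cont.
rewrite cosN_pihalf cos_pihalf expr0n /= !mul0r subrr sub0r /bess1 mulrN opprK -ointN; last by solve_cont.
by rewrite -ointZ; [|solve_cont]; apply: eq_oint => t; ring.
Qed.

(** The phase sin t is stationary at the end points, where cos^4 vanishes to order
four; so two integrations by parts are possible, without boundary terms. *)
Lemma bess_by_parts k : k ^+ 2 * bess k =
  3 * oint (fun t => (cos t ^+ 2 - sin t ^+ 2) * cos (k * sin t)) (- (pi / 2)) (pi / 2).
Proof.
have E1 : k * bess k = 3 * oint (fun t => cos t ^+ 2 * sin t * sin (k * sin t)) (- (pi / 2)) (pi / 2).
  rewrite /bess -[LHS]ointZ; last by solve_cont.
  rewrite (@eq_oint _ _ (fun t => cos t ^+ 3 * (k * cos t * cos (k * sin t)))) => [|t]; last by ring.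
  rewrite (@oint_by_parts R _ _ (fun t => - 3 * (cos t ^+ 2 * sin t)) _ _ _ _ (der_sin_sin k)); last 3 first.
  - by move=> t; apply: der_eq; [solve_der|rewrite /=; ring].
  - by solve_cont.
  - by solve_cont.
  rewrite cosN_pihalf cos_pihalf expr0n /= !mul0r subrr sub0r -ointN; last by solve_cont.
  by rewrite -ointZ; [|solve_cont]; apply: eq_oint => t; ring.
rewrite expr2 -mulrA E1 mulrCA; congr (_ * _).
rewrite -ointZ; last by solve_cont.
rewrite (@eq_oint _ _ (fun t => (cos t * sin t) * (k * cos t * sin (k * sin t)))) => [|t]; last by ring.
rewrite (@oint_by_parts R _ (fun t => - cos (k * sin t)) (fun t => cos t ^+ 2 - sin t ^+ 2)).
- rewrite cosN_pihalf cos_pihalf !mul0r subrr sub0r -ointN; last by solve_cont.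
  by apply: eq_oint => t; ring.
- by move=> t; apply: der_eq; [solve_der|rewrite /=; ring].
- by move=> t; apply: der_eq; [solve_der|rewrite /=; ring].
- by solve_cont.
- by solve_cont.
Qed.

(** cos(k cos 2p), in terms of the functions that [solve_der] and [solve_cont] handle. *)
Local Notation ph k := (fun p : R => cos (k * (cos p ^+ 2 - sin p ^+ 2))).

(** The substitution t = 2p - pi/2 puts the stationary points at p = 0 and p = pi/2,
exchanged by p -> pi/2 - p.  Multiplying by cos^2 p + sin^2 p = 1 and using this symmetry
leaves an integrand whose amplitude vanishes at pi/2, hence one stationary point only. *)
Lemma bess_half_angle k : k ^+ 2 * bess k =
  12 * oint (fun p => (8 * sin p ^+ 2 * cos p ^+ 4 - cos p ^+ 2) * ph k p) 0 (pi / 2).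
Proof.
rewrite bess_by_parts.
have c1 : cont (fun t => (cos t ^+ 2 - sin t ^+ 2) * cos (k * sin t)) by solve_cont.
have := @oint_affine R _ 2 (- (pi / 2)) 0 (pi / 2) c1.
rewrite mulr0 add0r (_ : 2 * (pi / 2) - pi / 2 = pi / 2); last by field.
move=> /(_ ltac:(by []))/(congr1 (fun x => 2 * x)); rewrite mulrA divff // mul1r => <-.
pose h p := (8 * sin p ^+ 2 * cos p ^+ 2 - 1) * ph k p.
rewrite (@eq_oint _ _ h) => [|p]; last first.
  rewrite /h sinBpihalf cosBpihalf mulr_natl cos_mulr2n sin_mulr2n mulrN cosN.
  rewrite (_ : cos p ^+ 2 *+ 2 - 1 = cos p ^+ 2 - sin p ^+ 2); last by rewrite sin2cos2; ring.
  congr (_ * _); rewrite sqrrN.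
  transitivity (8 * sin p ^+ 2 * cos p ^+ 2 - (cos p ^+ 2 + sin p ^+ 2) ^+ 2); first ring.
  by rewrite cos2Dsin2 expr1n.
have hc : cont h by rewrite /h; solve_cont.
have E : oint h 0 (pi / 2) = 2 * oint (fun p => h p * cos p ^+ 2) 0 (pi / 2).
  have -> : oint h 0 (pi / 2) = oint (fun p => h p * cos p ^+ 2) 0 (pi / 2) +
      oint (fun p => h p * sin p ^+ 2) 0 (pi / 2).
    rewrite -ointD; [|solve_cont..].
    by apply: eq_oint => p; rewrite -mulrDr cos2Dsin2 mulr1.
  suff -> : oint (fun p => h p * sin p ^+ 2) 0 (pi / 2) =
      oint (fun p => h p * cos p ^+ 2) 0 (pi / 2) by ring.
  have c2 : cont (fun p => h p * cos p ^+ 2) by solve_cont.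
  have := @oint_affine R _ (- 1) (pi / 2) 0 (pi / 2) c2.
  rewrite mulr0 add0r (_ : - 1 * (pi / 2) + pi / 2 = 0); last by ring.
  rewrite invrN1 mulN1r -oint_swap => <- //.
  apply: eq_oint => p; rewrite mulN1r (addrC (- p)) -cosN opprB cosBpihalf; congr (_ * _).
  have sE : sin (pi / 2 - p) = cos p.
    by rewrite -[RHS]cosN -[RHS]sinDpihalf; congr sin; ring.
  have cE : cos (pi / 2 - p) = sin p.
    by rewrite -cosN opprB cosBpihalf.
  rewrite /h sE cE; congr (_ * _); first ring.
  by rewrite -cosN; congr cos; ring.
rewrite E (@eq_oint _ _ (fun p => (8 * sin p ^+ 2 * cos p ^+ 4 - cos p ^+ 2) * ph k p)) => [|p]; first ring.
by rewrite /h; ring.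
Qed.

(** In x = sin p the phase k cos 2p = k - 2 k x^2 is exactly quadratic. *)
Lemma oint_stationary_phase k : 0 < k -> oint (fun p => cos p * ph k p) 0 (pi / 2) =
  (Num.sqrt (2 * k))^-1 * (cos k * fresnelC (Num.sqrt (2 * k)) + sin k * fresnelS (Num.sqrt (2 * k))).
Proof.
move=> k0; set r := Num.sqrt (2 * k).
have r0 : 0 < r by rewrite sqrtr_gt0 mulr_gt0.
have r2 : r ^+ 2 = 2 * k by rewrite sqr_sqrtr // mulr_ge0 // ltW.
rewrite (@eq_oint _ _ (fun p => cos ((r * sin p) ^+ 2 - k) * cos p)) => [|p]; last first.
  rewrite mulrC; congr (_ * _); rewrite -cosN; congr cos.
  by rewrite exprMn r2 cos2sin2; ring.
have c1 : cont (fun x => cos ((r * x) ^+ 2 - k)) by solve_cont.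
rewrite (@oint_subst R (fun x => cos ((r * x) ^+ 2 - k)) (@sin R) (@cos R)) //; last first.
  by move=> x; apply: der_eq; [apply: (der_sin (derI x))|rewrite mulr1].
rewrite sin0 sin_pihalf.
have c2 : cont (fun x : R => cos (x ^+ 2 + - k)) by solve_cont.
rewrite (@eq_oint _ _ (fun x => cos ((r * x + 0) ^+ 2 + - k))); last by move=> x; rewrite addr0.
rewrite (@oint_affine R (fun x => cos (x ^+ 2 + - k))) ?gt_eqF //.
by rewrite mulr0 mulr1 !addr0 oint_phase_shift cosN sinN mulNr opprK.
Qed.

Let der_sin_phase k p : is_der p (fun p => sin (k * (cos p ^+ 2 - sin p ^+ 2)))
  (- 4 * k * (sin p * cos p * ph k p)).
Proof. by apply: der_eq; [solve_der|rewrite /=; ring]. Qed.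

(** The amplitude is divisible by sin p cos p, the derivative of the phase, so that
integration by parts gains 1/k. *)
Lemma oint_phase_flat_bound k : 0 < k ->
  `|oint (fun p => 8 * sin p ^+ 2 * cos p ^+ 4 * ph k p) 0 (pi / 2)| <= 16 / k.
Proof.
move=> k0; rewrite ler_pdivlMr // -{2}(gtr0_norm k0) -normrM.
rewrite -ointZr; last by solve_cont.
rewrite (@eq_oint _ _ (fun p => (- 2 * sin p * cos p ^+ 3) * (- 4 * k * (sin p * cos p * ph k p)))) => [|p]; last by ring.
rewrite (@oint_by_parts R _ _ (fun p => - 2 * (cos p ^+ 4 - 3 * sin p ^+ 2 * cos p ^+ 2)) _ _ _ _ (der_sin_phase k)).
- rewrite sin0 cos_pihalf expr0n /= !mulr0 !mul0r subrr sub0r normrN.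
  have := @oint_bound R (fun p => - 2 * (cos p ^+ 4 - 3 * sin p ^+ 2 * cos p ^+ 2) * sin (k * (cos p ^+ 2 - sin p ^+ 2))) 8 0 (pi / 2).
  have p4 : pi < 4 :> R by have := pihalf_lt2 R; lra.
  rewrite subr0 => H; apply: (@le_trans _ _ (8 * `|pi / 2|)).
    apply: H => [|t _]; first by solve_cont.
    rewrite normrM -[8]mulr1; apply: ler_pM; rewrite ?sin_max //.
    have := cos2Dsin2 t; have := sqr_ge0 (sin t); have := sqr_ge0 (cos t).
    rewrite (_ : cos t ^+ 4 = (cos t ^+ 2) ^+ 2); last by ring.
    move: (cos t ^+ 2) (sin t ^+ 2) => a b a0 b0 ab.
    by rewrite ler_norml; apply/andP; split; nra.
  rewrite ger0_norm; last by have := pi_gt0 R; lra.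
  lra.
- by move=> t; apply: der_eq; [solve_der|rewrite /=; ring].
- by solve_cont.
- by solve_cont.
Qed.

(** Here 1 - cos p = tan(p/2) sin p has to be divided by sin p.  In the variable
t = tan(p/2) the quotient is simply t, with no singularity on [0, 1]. *)
Lemma oint_phase_versine_bound k : 0 < k ->
  `|oint (fun p => cos p * (1 - cos p) * ph k p) 0 (pi / 2)| <= 1 / k.
Proof.
move=> k0; rewrite ler_pdivlMr // -{2}(gtr0_norm k0) -normrM.
rewrite -ointZr; last by solve_cont.
pose f p := cos p * (1 - cos p) * ph k p * k.
have fc : cont f by rewrite /f; solve_cont.
pose T t : R := 2 * atan t; pose dT t : R := 2 * (1 + t ^+ 2)^-1.
have dTP t : is_der t T (dT t).
  by rewrite /T /dT; apply: der_eq; [solve_der|rewrite /=; ring].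
have q0 t : 1 + t ^+ 2 != 0 :> R by rewrite gt_eqF // ltr_wpDr ?ltr01 ?sqr_ge0.
have dTc : cont dT.
  by apply: (@contM _ (fun=> 2)); [exact: contC|apply: cont_inv => //; solve_cont].
have Tc : cont T by exact: cont_der dTP.
have := @oint_subst R f T dT 0 1 fc dTP.
rewrite /T atan0 atan1 mulr0 (_ : 2 * (pi / 4) = pi / 2); last by field.
move=> <-.
have key t : 1 - cos (T t) = t * sin (T t).
  have ct : cos (atan t) != 0.
    by rewrite cos_atan invr_neq0 // gt_eqF // sqrtr_gt0 ltr_wpDr ?ltr01 ?sqr_ge0.
  have tt : t * cos (atan t) = sin (atan t).
    by rewrite -{1}(atanK t) /tan divfK.
  rewrite /T mulr_natl cos_mulr2n sin_mulr2n cos2sin2 -tt; ring.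
pose v t := sin (k * (cos (T t) ^+ 2 - sin (T t) ^+ 2)).
pose dv t := - 4 * k * (sin (T t) * cos (T t) * ph k (T t)) * dT t.
have dvP t : is_der t v (dv t).
  exact: (@der_comp R (fun p => sin (k * (cos p ^+ 2 - sin p ^+ 2))) T t _ _ (der_sin_phase k (T t)) (dTP t)).
rewrite (@eq_oint _ _ (fun t => (- (1 / 4) * t) * dv t)) => [|t]; last first.
  by rewrite /f -/(T t) key /dv; field.
rewrite (@oint_by_parts R (fun t => - (1 / 4) * t) v (fun=> - (1 / 4)) dv 0 1 _ dvP).
- have vc : cont v by exact: cont_der dvP.
  rewrite ointZ // mulr0 mul0r subr0 mulr1.
  have v1 t : `|v t| <= 1 by exact: sin_max.
  have := @oint_bound R v 1 0 1 vc (fun t _ => v1 t); rewrite subr0 normr1 mulr1.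
  have := v1 1; rewrite !ler_norml => /andP[? ?] /andP[? ?]; apply/andP; split; lra.
- by move=> t; apply: der_eq; [solve_der|rewrite /=; ring].
- exact: contC.
- by rewrite /dv; solve_cont.
Qed.

(** In [bess_half_angle] write - cos^2 = cos (1 - cos) - cos: the last term gives the
Fresnel integrals, and the others are O(1/k). *)
Lemma bess_leading : exists2 K, 0 <= K & forall k, 0 < k ->
  `|k ^+ 2 * Num.sqrt k * bess k + 3 * Num.sqrt pi * (cos k + sin k)| <= K / Num.sqrt k.
Proof.
have [K K0 HK] := fresnel_limit R.
exists (12 * (K + 17)); first by rewrite mulr_ge0 // addr_ge0.
move=> k k0; set s := Num.sqrt k; set w := Num.sqrt 2 : R.
have s0 : 0 < s by rewrite sqrtr_gt0.
have s2 : s ^+ 2 = k by rewrite sqr_sqrtr // ltW.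
have w0 : 0 < w by rewrite sqrtr_gt0.
have w2 : w ^+ 2 = 2 by rewrite sqr_sqrtr.
have wsE : Num.sqrt (2 * k) = w * s by rewrite sqrtrM.
have ws0 : 0 < w * s by exact: mulr_gt0.
have cE : 4 * w^-1 * Num.sqrt (pi / 8) = Num.sqrt pi :> R.
  have c0 : 0 <= Num.sqrt (pi / 8) :> R by exact: sqrtr_ge0.
  have c2 : (Num.sqrt (pi / 8) : R) ^+ 2 = pi / 8.
    by rewrite sqr_sqrtr // divr_ge0 ?pi_ge0 // ler0n.
  apply/eqP; rewrite -(@eqrXn2 _ 2) ?sqrtr_ge0 //; last first.
    by rewrite !mulr_ge0 // invr_ge0 ltW.
  by rewrite !exprMn exprVn w2 c2 sqr_sqrtr ?pi_ge0 //; apply/eqP; field.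
have := bess_half_angle k.
rewrite (@eq_oint _ _ (fun p => 8 * sin p ^+ 2 * cos p ^+ 4 * ph k p +
  (cos p * (1 - cos p) * ph k p - cos p * ph k p))) => [|p]; last by ring.
rewrite ointD; [|solve_cont..]; rewrite ointB; [|solve_cont..].
rewrite oint_stationary_phase // wsE.
have := oint_phase_flat_bound k0; have := oint_phase_versine_bound k0.
set u := oint _ _ _; set v := oint _ _ _ => hu hv E.
have [] := HK _ ws0; set c := Num.sqrt (pi / 8) in cE *.
set X := fresnelC _ in E *; set Y := fresnelS _ in E * => hX hY.
have -> : k ^+ 2 * s * bess k + 3 * Num.sqrt pi * (cos k + sin k) =
  12 * (s * (u + v)) - 12 * w^-1 * (cos k * (X - c) + sin k * (Y - c)).
  rewrite mulrAC E -cE; field; apply/andP; split; exact: lt0r_neq0.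
have h1 : `|s * (u + v)| <= 17 / s.
  rewrite normrM (gtr0_norm s0).
  have -> : 17 / s = s * (1 / k + 16 / k) by rewrite -s2; field; exact: lt0r_neq0.
  by rewrite ler_wpM2l ?(ltW s0) // (le_trans (ler_normD _ _)) // lerD.
have h2 : `|w^-1 * (cos k * (X - c) + sin k * (Y - c))| <= K / s.
  rewrite normrM normfV (gtr0_norm w0).
  have -> : K / s = w^-1 * (K / (w * s) + K / (w * s)).
    rewrite -[LHS](mulfK (lt0r_neq0 (exprn_gt0 2 w0))) {1}w2; field.
    apply/andP; split; exact: lt0r_neq0.
  rewrite ler_wpM2l ?invr_ge0 ?(ltW w0) // (le_trans (ler_normD _ _)) // lerD //.
    by rewrite normrM (le_trans _ hX) // ler_piMl ?cos_max.
  by rewrite normrM (le_trans _ hY) // ler_piMl ?sin_max.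
move: h1 h2; rewrite -!mulrA !ler_norml => /andP[? ?] /andP[? ?].
apply/andP; split; lra.
Qed.

End Bessel.

(** * The Bessel integral: complete asymptotic expansion *)

Section BesselExpansion.
Variable R : realType.
Implicit Types (f df : R -> R) (k t C : R).

(** A function that tends to 0 is minus the integral of its derivative up to infinity.
The slow rate 1/sqrt t in the hypothesis serves only to send the end point T to
infinity; it is replaced by the rate that the derivative dictates. *)
Lemma decay_of_der_decay f df C A i : 0 <= C ->
  (forall t, 1 <= t -> is_der t f (df t)) ->
  (forall t, 1 <= t -> `|df t| <= C * t^-1 ^+ i.+2) ->
  (forall t, 1 <= t -> `|f t| <= A / Num.sqrt t) ->
  forall t, 1 <= t -> `|f t| <= C * t^-1 ^+ i.+1.
Proof.
move=> C0 Hf Hdf HA t t1; have t0 : 0 < t by exact: lt_le_trans t1.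
have H T : t <= T -> `|f t| <= C * t^-1 ^+ i.+1 + A / Num.sqrt T.
  move=> tT; have T1 := le_trans t1 tT.
  have i0 : (0 : R) < i.+1%:R by rewrite ltr0n.
  have pos (z : R) : 1 <= z -> z != 0 by move=> z1; rewrite gt_eqF // (lt_le_trans ltr01).
  have := @norm_le_of_der_le R f (fun z => - (C / i.+1%:R) * z^-1 ^+ i.+1) df
    (fun z => C * z^-1 ^+ i.+2) t T tT.
  have h1 z : t <= z <= T -> is_der z f (df z).
    by move=> /andP[tz _]; apply: Hf; exact: le_trans tz.
  have h2 z : t <= z <= T ->
      is_der z (fun z => - (C / i.+1%:R) * z^-1 ^+ i.+1) (C * z^-1 ^+ i.+2).
    move=> /andP[tz _]; have z0 := pos z (le_trans t1 tz).
    apply: der_eq; first by solve_der.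
    have n0 := lt0r_neq0 i0; rewrite /= !exprS expr0.
    move: (i.+1%:R) (z^-1 ^+ i) n0 => n e n0; field; by rewrite n0 z0.
  have h3 z : t <= z <= T -> `|df z| <= C * z^-1 ^+ i.+2.
    by move=> /andP[tz _]; apply: Hdf; exact: le_trans tz.
  move=> /(_ h1 h2 h3) h4.
  have : f t = f T - (f T - f t) by ring.
  move=> ->; apply: le_trans (ler_normB _ _) _; rewrite addrC lerD ?HA //.
  apply: le_trans h4 _.
  rewrite (_ : _ - _ = C / i.+1%:R * t^-1 ^+ i.+1 - C / i.+1%:R * T^-1 ^+ i.+1); last by ring.
  have u0 : 0 <= C / i.+1%:R * T^-1 ^+ i.+1.
    by rewrite mulr_ge0 ?divr_ge0 ?exprn_ge0 ?invr_ge0 // ?(ltW i0) // (le_trans ler01).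
  have : C / i.+1%:R * t^-1 ^+ i.+1 <= C * t^-1 ^+ i.+1.
    rewrite ler_wpM2r ?exprn_ge0 ?invr_ge0 ?(ltW t0) // ler_pdivrMr //.
    by rewrite ler_peMr // ler1n.
  by apply: le_trans; rewrite lerBlDr lerDl.
rewrite leNgt; apply/negP => h.
set e := `|f t| - C * t^-1 ^+ i.+1 in h.
have e0 : 0 < e by rewrite /e subr_gt0.
have A0 : 0 <= A.
  by have := HA 1 (lexx _); rewrite sqrtr1 divr1; exact: le_trans.
pose T := t + ((A + 1) / e) ^+ 2.
have q0 : 0 < (A + 1) / e by rewrite divr_gt0 // ltr_wpDl.
have tT : t <= T by rewrite lerDl sqr_ge0.
have := H T tT; rewrite -lerBlDl -/e leNgt => /negP; apply.
have s0 : 0 < Num.sqrt T by rewrite sqrtr_gt0 (lt_le_trans t0).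
rewrite ltr_pdivrMr // mulrC -ltr_pdivrMr //.
apply: (@lt_le_trans _ _ ((A + 1) / e)); first by rewrite ltr_pM2r ?invr_gt0 // ltrDl.
rewrite -(ger0_norm (ltW q0)) -sqrtr_sqr ler_wsqrtr // lerDr ltW //.
Qed.

(** The coefficients of cos and sin in the j-th wave of the formal solution; the first
wave is the one found in [bess_leading], and the recursion is [besswave_rec]. *)
Fixpoint besscoef (j : nat) : R * R :=
  if j is i.+1 then
    let mu := i%:R * (i%:R + 1) - 15 / 4 in
    (- mu * (besscoef i).2 / (2 * (i%:R + 1)), mu * (besscoef i).1 / (2 * (i%:R + 1)))
  else (- 3 * Num.sqrt pi, - 3 * Num.sqrt pi).

Definition besswave j k : R := (besscoef j).1 * cos k + (besscoef j).2 * sin k.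
Definition besswave' j k : R := - (besscoef j).1 * sin k + (besscoef j).2 * cos k.

(** The vanishing of the coefficient of k^(-i-2) in y'' + (1 - 15/4 k^-2) y, for
y = sum_j k^(-j) w_j(k). *)
Lemma besswave_rec i k : 2 * (i%:R + 1) * besswave' i.+1 k =
  (i%:R * (i%:R + 1) - 15 / 4) * besswave i k.
Proof.
have i0 : i%:R + 1 != 0 :> R by rewrite natr1 pnatr_eq0.
by rewrite /besswave /besswave' /=; field.
Qed.

Lemma der_besswave j k : is_der k (besswave j) (besswave' j k).
Proof. by rewrite /besswave /besswave'; apply: der_eq; [solve_der|rewrite /=; ring]. Qed.

Lemma der_besswave' j k : is_der k (besswave' j) (- besswave j k).
Proof. by rewrite /besswave /besswave'; apply: der_eq; [solve_der|rewrite /=; ring]. Qed.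

Lemma besswave_bound j k : `|besswave j k| <= `|(besscoef j).1| + `|(besscoef j).2|.
Proof.
apply: le_trans (ler_normD _ _) _; rewrite !normrM.
by apply: lerD; rewrite ler_piMr // ?cos_max ?sin_max.
Qed.

Definition bessterm j k : R := k^-1 ^+ j * besswave j k.
Definition bessterm1 j k : R :=
  - j%:R * k^-1 ^+ j.+1 * besswave j k + k^-1 ^+ j * besswave' j k.
Definition bessterm2 j k : R :=
  j%:R * (j%:R + 1) * k^-1 ^+ j.+2 * besswave j k -
  2 * j%:R * k^-1 ^+ j.+1 * besswave' j k - k^-1 ^+ j * besswave j k.

Lemma der_invX j k : k != 0 -> is_der k (fun k => k^-1 ^+ j) (- j%:R * k^-1 ^+ j.+1).
Proof.
move=> k0; case: j => [|j].
  by rewrite oppr0 mul0r; exact: (@derC R 1).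
apply: der_eq; first by solve_der.
by rewrite /= !exprS expr0; move: (j.+1%:R) (k^-1 ^+ j) => n e; field.
Qed.

Lemma der_bessterm j k : k != 0 -> is_der k (bessterm j) (bessterm1 j k).
Proof.
move=> k0; apply: der_eq (derM (der_invX j k0) (der_besswave j k)) _.
by rewrite /bessterm1; ring.
Qed.

Lemma der_bessterm1 j k : k != 0 -> is_der k (bessterm1 j) (bessterm2 j k).
Proof.
move=> k0; apply: der_eq.
  exact: (derD (derM (derM (derC (- j%:R) k) (der_invX j.+1 k0)) (der_besswave j k))
     (derM (der_invX j k0) (der_besswave' j k))).
rewrite /bessterm2 -natr1 [k^-1 ^+ j.+2]exprS [k^-1 ^+ j.+1]exprS; ring.
Qed.

(** Each term leaves a residual that the next one cancels, up to one of higher order. *)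
Lemma bessterm_telescope m k :
  \sum_(j < m.+1) bessterm2 j k + (1 - 15 / 4 * k^-1 ^+ 2) * \sum_(j < m.+1) bessterm j k =
  (m%:R * (m%:R + 1) - 15 / 4) * k^-1 ^+ m.+2 * besswave m k.
Proof.
elim: m => [|m IH].
  by rewrite !big_ord_recr !big_ord0 /= /bessterm2 /bessterm expr0; ring.
rewrite [X in X + _]big_ord_recr [X in _ + _ * X]big_ord_recr /= mulrDr addrACA IH.
rewrite /bessterm2 /bessterm.
have E := besswave_rec m k.
have -> : (m%:R * (m%:R + 1) - 15 / 4) * k^-1 ^+ m.+2 * besswave m k =
  k^-1 ^+ m.+2 * (2 * (m%:R + 1) * besswave' m.+1 k) by rewrite E; ring.
rewrite -natr1 [k^-1 ^+ m.+3]exprS [k^-1 ^+ m.+2]exprS [k^-1 ^+ m.+1]exprS; ring.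
Qed.

(** k^(5/2) bess k, the normalisation that removes the first derivative from the
equation of [bess]. *)
Definition bess_scaled k : R := Num.sqrt k ^+ 5 * bess k.
Definition bess_scaled1 k : R :=
  5 / 2 * Num.sqrt k ^+ 3 * bess k + Num.sqrt k ^+ 5 * bess1 k.

Lemma der_sqrtX j k : 0 < k ->
  is_der k (fun k => Num.sqrt k ^+ j.+2) (j.+2%:R / 2 * Num.sqrt k ^+ j).
Proof.
move=> k0; apply: der_eq; first by solve_der.
have s0 : Num.sqrt k != 0 by rewrite gt_eqF // sqrtr_gt0.
by rewrite /= exprS; field.
Qed.

Lemma der_bess_scaled k : 0 < k -> is_der k bess_scaled (bess_scaled1 k).
Proof.
move=> k0; apply: der_eq (derM (der_sqrtX 3 k0) (der_bess k)) _.
by rewrite /bess_scaled1; ring.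
Qed.

Lemma der_bess_scaled1 k : 0 < k -> is_der k bess_scaled1 (- (1 - 15 / 4 * k^-1 ^+ 2) * bess_scaled k).
Proof.
move=> k0; apply: der_eq.
  exact: (derD (derM (derM (derC (5 / 2) k) (der_sqrtX 1 k0)) (der_bess k))
     (derM (der_sqrtX 3 k0) (der_bess1 k))).
have s0 : 0 < Num.sqrt k by rewrite sqrtr_gt0.
have sk : k = Num.sqrt k ^+ 2 by rewrite sqr_sqrtr // ltW.
have := bessel_ode k; rewrite /bess_scaled.
move: (bess k) (bess1 k) (bess2 k) => b b1 b2.
move: (Num.sqrt k) s0 sk => s s0 -> E.
have -> : s ^+ 5 * b2 = - s ^+ 3 * (5 * b1 + s ^+ 2 * b).
  have E' : s ^+ 2 * b2 = - (5 * b1 + s ^+ 2 * b) by lra.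
  by transitivity (s ^+ 3 * (s ^+ 2 * b2)); [ring|rewrite E'; ring].
by field; exact: lt0r_neq0.
Qed.

(** The remainder d solves d'' + d = 15/4 k^-2 d - r with r = O(k^(-m-2)).  In the
rotating frame a = d cos - d' sin, b = d sin + d' cos, the derivatives of a and b are
(d'' + d) times - sin and cos.  If d = O(k^-i), these are O(k^(-i-2)), so that a and b,
which tend to 0, are O(k^(-i-1)), and so is d.  To start, d and d' must tend to 0: for d
this is [bess_leading], and for d' it follows from the bounds of d and d''. *)
Lemma bess_scaled_expansion m : exists2 C, 0 <= C & forall k, 1 <= k ->
  `|bess_scaled k - \sum_(j < m.+1) bessterm j k| <= C * k^-1 ^+ m.+1.
Proof.
pose d k := bess_scaled k - \sum_(j < m.+1) bessterm j k.
pose d1 k := bess_scaled1 k - \sum_(j < m.+1) bessterm1 j k.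
pose r k := (m%:R * (m%:R + 1) - 15 / 4) * k^-1 ^+ m.+2 * besswave m k.
pose d2 k := - d k + 15 / 4 * k^-1 ^+ 2 * d k - r k.
have k0 (k : R) : 1 <= k -> 0 < k by exact: lt_le_trans.
have dd k : 1 <= k -> is_der k d (d1 k).
  move=> k1; apply: derD; first exact: der_bess_scaled (k0 k k1).
  by apply: derN; apply: der_sum => j; apply: der_bessterm; exact: lt0r_neq0 (k0 k k1).
have dd1 k : 1 <= k -> is_der k d1 (d2 k).
  move=> k1; apply: der_eq.
    apply: derD; first exact: der_bess_scaled1 (k0 k k1).
    apply: derN; apply: der_sum => j; apply: der_bessterm1; exact: lt0r_neq0 (k0 k k1).
  by rewrite /d2 /r -bessterm_telescope /d; ring.
set cm := `|m%:R * (m%:R + 1) - 15 / 4 : R| * (`|(besscoef m).1| + `|(besscoef m).2|).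
have cm0 : 0 <= cm by rewrite mulr_ge0 ?addr_ge0.
have inv01 (k : R) : 1 <= k -> 0 <= k^-1 <= 1.
  by move=> k1; rewrite invr_ge0 (ltW (k0 k k1)) invf_le1 ?(k0 k k1).
have rb k : 1 <= k -> `|r k| <= cm * k^-1 ^+ m.+2.
  move=> k1; rewrite /r mulrAC normrM normrM (@ger0_norm _ (_ ^+ _)).
    rewrite ler_wpM2r ?exprn_ge0 ?(andP (inv01 k k1)).1 //.
    by rewrite ler_wpM2l // besswave_bound.
  by rewrite exprn_ge0 ?(andP (inv01 k k1)).1.
have [K K0 HK] := bess_leading R.
have s01 (k : R) : 1 <= k -> 0 < (Num.sqrt k)^-1 <= 1 /\ k^-1 = (Num.sqrt k)^-1 ^+ 2.
  move=> k1; have s0 : 0 < Num.sqrt k by rewrite sqrtr_gt0 k0.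
  rewrite invr_gt0 s0 invf_le1 //; split.
    by rewrite -sqrtr1 ler_wsqrtr.
  by rewrite exprVn sqr_sqrtr // ltW // k0.
pose sm := \sum_(j < m) (`|(besscoef j.+1).1| + `|(besscoef j.+1).2|).
have sm0 : 0 <= sm by apply: sumr_ge0 => j _; rewrite addr_ge0.
have db k : 1 <= k -> `|d k| <= (K + sm) / Num.sqrt k.
  move=> k1; have [/andP[s0 s1] ks] := s01 k k1.
  rewrite /d big_ord_recl /= mulrDl.
  have -> : bess_scaled k - (bessterm 0 k + \sum_(i < m) bessterm (lift ord0 i) k) =
    (k ^+ 2 * Num.sqrt k * bess k + 3 * Num.sqrt pi * (cos k + sin k)) -
    \sum_(i < m) bessterm (lift ord0 i) k.
    rewrite /bessterm /besswave /= /bess_scaled expr0.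
    have s5 (s z b : R) : s ^+ 2 = z -> s ^+ 5 * b = z ^+ 2 * s * b by move=> <-; ring.
    by rewrite (s5 _ k) ?sqr_sqrtr ?(ltW (k0 k k1)) //; ring.
  apply: le_trans (ler_normB _ _) _; apply: lerD; first exact: HK (k0 k k1).
  apply: le_trans (ler_norm_sum _ _ _) _; rewrite mulr_suml; apply: ler_sum => j _.
  rewrite /bessterm normrM mulrC.
  have hk : `|k^-1 ^+ lift ord0 j| <= (Num.sqrt k)^-1.
    rewrite ger0_norm ?exprn_ge0 ?(andP (inv01 k k1)).1 // lift0 exprS.
    apply: (@le_trans _ _ (k^-1 * 1)).
      by rewrite ler_wpM2l ?exprn_ile1 ?(andP (inv01 k k1)).1 ?(andP (inv01 k k1)).2.
    by rewrite mulr1 ks expr2 ler_piMl // ltW.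
  by apply: ler_pM => //; rewrite lift0 besswave_bound.
set K1 := K + sm in db; have K10 : 0 <= K1 by rewrite addr_ge0.
have sdec (k z : R) : 1 <= k -> k <= z -> (Num.sqrt z)^-1 <= (Num.sqrt k)^-1.
  move=> k1 kz; rewrite lef_pV2 ?posrE ?sqrtr_gt0 ?k0 ?(le_trans k1) //.
  by rewrite ler_wsqrtr.
have d2b k : 1 <= k -> `|d2 k| <= (5 * K1 + cm) / Num.sqrt k.
  move=> k1; have [/andP[s0 s1] ks] := s01 k k1.
  rewrite /d2; have := rb k k1; have := db k k1.
  have /andP[i0 i1] := inv01 k k1.
  have iX : 0 <= k^-1 ^+ m.+2 <= (Num.sqrt k)^-1.
    rewrite exprn_ge0 // exprS; apply: (@le_trans _ _ (k^-1 * 1)).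
      by rewrite ler_wpM2l ?exprn_ile1.
    by rewrite mulr1 ks expr2 ler_piMl // ltW.
  have i2 : 0 <= k^-1 ^+ 2 <= 1 by rewrite exprn_ge0 ?exprn_ile1.
  move: iX i2; move: (k^-1 ^+ m.+2) (k^-1 ^+ 2) (d k) (r k) ((Num.sqrt k)^-1) s0.
  move=> u v a b s s0 /andP[u0 us] /andP[v0 v1] ha hb.
  have h1 : `|15 / 4 * v * a| <= 15 / 4 * (K1 * s).
    rewrite -mulrA normrM ger0_norm // ler_wpM2l // normrM (ger0_norm v0).
    by apply: le_trans ha; rewrite ler_piMl.
  have h2 : `|b| <= cm * s by apply: le_trans hb _; rewrite ler_wpM2l.
  have h3 : 0 <= K1 * s by rewrite mulr_ge0 // ltW.
  apply: le_trans (ler_normB _ _) _; rewrite (mulrDl (5 * K1)); apply: lerD => //.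
  apply: le_trans (ler_normD _ _) _; rewrite normrN -(mulrA 5); lra.
(* d(k+1) - d(k) = d'(c) and d'(c) - d'(k) = d''(c') (c - k) with c in [k, k+1]. *)
have d1b k : 1 <= k -> `|d1 k| <= (7 * K1 + cm) / Num.sqrt k.
  move=> k1; have kk : k <= k + 1 by rewrite lerDl.
  have [|c /andP[kc ck1] E] := @mean_value R d d1 k (k + 1) kk.
    by move=> x /andP[kx _]; apply: dd; exact: le_trans kx.
  have c1 := le_trans k1 kc.
  have [|c' /andP[kc' _] E'] := @mean_value R d1 d2 k c kc.
    by move=> x /andP[kx _]; apply: dd1; exact: le_trans kx.
  have c'1 := le_trans k1 kc'.
  have -> : d1 k = d (k + 1) - d k - d2 c' * (c - k).
    by rewrite E -E' [k + 1]addrC addrK mulr1; ring.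
  have /andP[s0 s1] := (s01 k k1).1.
  have h1 : `|d (k + 1)| <= K1 / Num.sqrt k.
    apply: le_trans (db _ (le_trans k1 kk)) _; rewrite ler_wpM2l //; exact: sdec.
  have h2 := db k k1.
  have h3 : `|d2 c' * (c - k)| <= (5 * K1 + cm) / Num.sqrt k.
    rewrite normrM (@ger0_norm _ (c - k)) ?subr_ge0 //.
    apply: (@le_trans _ _ (`|d2 c'| * 1)).
      rewrite ler_wpM2l //; lra.
    rewrite mulr1; apply: le_trans (d2b _ c'1) _.
    by rewrite ler_wpM2l ?sdec // addr_ge0 // mulr_ge0.
  have := ler_normB (d (k + 1) - d k) (d2 c' * (c - k)).
  have := ler_normB (d (k + 1)) (d k); lra.
pose a k := d k * cos k - d1 k * sin k; pose b k := d k * sin k + d1 k * cos k.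
have da k : 1 <= k -> is_der k a (- (d2 k + d k) * sin k).
  move=> k1; have ? := dd k k1; have ? := dd1 k k1.
  by rewrite /a; apply: der_eq; [solve_der|rewrite /=; ring].
have dbb k : 1 <= k -> is_der k b ((d2 k + d k) * cos k).
  move=> k1; have ? := dd k k1; have ? := dd1 k k1.
  by rewrite /b; apply: der_eq; [solve_der|rewrite /=; ring].
have dab k : d k = a k * cos k + b k * sin k.
  by rewrite -[LHS]mulr1 -(cos2Dsin2 k) /a /b; ring.
have trig (u v w z : R) : `|w| <= 1 -> `|z| <= 1 -> `|u * w + v * z| <= `|u| + `|v|.
  move=> w1 z1; apply: le_trans (ler_normD _ _) _; rewrite !normrM.
  by apply: lerD; rewrite ler_piMr.
set A := 7 * K1 + cm in d1b.
have A0 k : 1 <= k -> `|d k| + `|d1 k| <= (K1 + A) / Num.sqrt k.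
  by move=> k1; rewrite mulrDl lerD ?db ?d1b.
have ab k : 1 <= k -> `|a k| <= (K1 + A) / Num.sqrt k.
  move=> k1; apply: le_trans (A0 k k1); rewrite /a -mulrN.
  by apply: trig; rewrite ?normrN ?cos_max ?sin_max.
have bb k : 1 <= k -> `|b k| <= (K1 + A) / Num.sqrt k.
  by move=> k1; apply: le_trans (A0 k k1); apply: trig; rewrite ?cos_max ?sin_max.
suff: forall i, (i <= m.+1)%N -> exists2 C, 0 <= C & forall k, 1 <= k -> `|d k| <= C * k^-1 ^+ i.
  by apply.
elim=> [_|i IH im].
  exists K1 => // k k1; rewrite expr0 mulr1; apply: le_trans (db k k1) _.
  have /andP[? ?] := (s01 k k1).1; rewrite -[leRHS]mulr1 ler_wpM2l //.
have [C C0 HC] := IH (ltnW im).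
pose C' := 15 / 4 * C + cm.
have C'0 : 0 <= C' by rewrite addr_ge0 // mulr_ge0.
have e2 k : 1 <= k -> `|d2 k + d k| <= C' * k^-1 ^+ i.+2.
  move=> k1; have /andP[i0 i1] := inv01 k k1.
  rewrite /d2 (_ : _ + d k = 15 / 4 * k^-1 ^+ 2 * d k - r k); last by ring.
  apply: le_trans (ler_normB _ _) _; rewrite (mulrDl (15 / 4 * C)); apply: lerD.
    rewrite normrM (@ger0_norm _ (15 / 4 * _)) ?mulr_ge0 ?exprn_ge0 //.
    have -> : 15 / 4 * C * k^-1 ^+ i.+2 = 15 / 4 * k^-1 ^+ 2 * (C * k^-1 ^+ i).
      by rewrite [k^-1 ^+ i.+2]exprS [k^-1 ^+ i.+1]exprS; ring.
    by rewrite ler_wpM2l ?HC // mulr_ge0 ?exprn_ge0.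
  apply: le_trans (rb k k1) _; rewrite ler_wpM2l // ler_wiXn2l //.
exists (C' + C'); first by rewrite addr_ge0.
move=> k k1; rewrite dab (mulrDl C' C').
apply: le_trans (trig _ _ _ _ (cos_max k) (sin_max k)) _; apply: lerD.
  apply: (decay_of_der_decay C'0 da _ ab) => // t t1; rewrite normrM normrN.
  by apply: le_trans (e2 t t1); rewrite ler_piMr ?sin_max.
apply: (decay_of_der_decay C'0 dbb _ bb) => // t t1; rewrite normrM.
by apply: le_trans (e2 t t1); rewrite ler_piMr ?cos_max.
Qed.

(** For k >= 1 this is [bess_scaled_expansion].  For k < 1 each of the finitely many terms
is dominated by the error term, k^(-m-1) being the largest power present; covering all
k > 0 is what allows the expansion to be summed over the lattice. *)
Theorem bess_expansion m : exists2 C, 0 <= C & forall k, 0 < k ->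
  `|bess k - (Num.sqrt k)^-1 ^+ 5 * \sum_(j < m.+1) bessterm j k| <=
  C * (Num.sqrt k)^-1 ^+ 5 * k^-1 ^+ m.+1.
Proof.
have [C C0 HC] := bess_scaled_expansion m.
pose sm := \sum_(j < m.+1) (`|(besscoef j).1| + `|(besscoef j).2|).
have sm0 : 0 <= sm by apply: sumr_ge0 => j _; rewrite addr_ge0.
exists (C + (4 + sm)); first by rewrite !addr_ge0.
move=> k k0; have s0 : 0 < Num.sqrt k by rewrite sqrtr_gt0.
have si0 : 0 < (Num.sqrt k)^-1 ^+ 5 by rewrite exprn_gt0 ?invr_gt0.
have ki0 : 0 < k^-1 by rewrite invr_gt0.
have -> : bess k - (Num.sqrt k)^-1 ^+ 5 * \sum_(j < m.+1) bessterm j k =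
  (Num.sqrt k)^-1 ^+ 5 * (bess_scaled k - \sum_(j < m.+1) bessterm j k).
  by rewrite /bess_scaled; field; exact: lt0r_neq0.
rewrite normrM (gtr0_norm si0) [leRHS]mulrAC [leRHS]mulrC ler_wpM2l ?(ltW si0) //.
have [k1|k1] := leP 1 k.
  by apply: le_trans (HC k k1) _; rewrite ler_wpM2r ?exprn_ge0 ?(ltW ki0) // lerDl addr_ge0.
have ki1 : 1 <= k^-1 by rewrite invf_ge1 // ltW.
have kX j : (j <= m.+1)%N -> k^-1 ^+ j <= k^-1 ^+ m.+1 by move=> ?; rewrite ler_weXn2l.
rewrite (mulrDl C) ler_wpDl ?mulr_ge0 ?exprn_ge0 ?(ltW ki0) //.
apply: le_trans (ler_normB _ _) _; rewrite (mulrDl 4); apply: lerD.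
  have b4 : `|bess k| <= 4.
    have := @oint_bound R (fun t => cos t ^+ 4 * cos (k * sin t)) 1 (- (pi / 2)) (pi / 2).
    have pp : pi / 2 - - (pi / 2) = pi :> R by field.
    rewrite pp mul1r => H; apply: (@le_trans _ _ `|pi : R|).
      apply: H => [|t _]; first by solve_cont.
      rewrite normrM -[leRHS]mulr1; apply: ler_pM; rewrite ?cos_max //.
      by rewrite normrX exprn_ile1 ?cos_max.
    by rewrite ger0_norm ?pi_ge0 //; have := pihalf_lt2 R; lra.
  have s1 : Num.sqrt k <= 1 by rewrite -sqrtr1 ler_wsqrtr // ltW.
  rewrite /bess_scaled normrM ger0_norm ?exprn_ge0 ?sqrtr_ge0 //.
  apply: (@le_trans _ _ (1 * 4)); first by apply: ler_pM; rewrite ?exprn_ge0 ?exprn_ile1 ?sqrtr_ge0.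
  by rewrite mul1r ler_peMr // exprn_ege1.
rewrite mulr_suml; apply: le_trans (ler_norm_sum _ _ _) _; apply: ler_sum => j _.
rewrite /bessterm normrM mulrC; apply: ler_pM; rewrite ?normr_ge0 ?besswave_bound //.
by rewrite ger0_norm ?exprn_ge0 ?(ltW ki0) // kX // ltnW.
Qed.

End BesselExpansion.

(** * Fejer kernels *)

Section Fejer.
Variable R : realType.
Implicit Types (f : R -> R) (x y a c : R) (N : nat).

(** The Fejer kernel |sum_(j < N) exp(2 pi i j x)|^2 / N, expanded over pairs of
frequencies so that products of kernels are sums over differences of lattice points. *)
Definition fejer N x : R :=
  N%:R^-1 * \sum_(i < N) \sum_(j < N) cos (2 * pi * (i%:R - j%:R) * x).

Lemma sin_int_period x (p q : nat) : sin (x + 2 * pi * (p%:R - q%:R)) = sin x.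
Proof.
have -> : sin x = sin (x - 2 * pi * q%:R).
  rewrite -[RHS](periodicn (@sinD2pi R) q); congr sin.
  by ring.
rewrite -[RHS](periodicn (@sinD2pi R) p); congr sin.
by ring.
Qed.

Lemma cos_int_period x (p q : nat) : cos (x + 2 * pi * (p%:R - q%:R)) = cos x.
Proof. by rewrite -!sinDpihalf addrAC sin_int_period. Qed.

Lemma cont_fejer N : cont (fejer N).
Proof.
rewrite /fejer; apply: contM; first exact: contC.
by apply: cont_sum => i; apply: cont_sum => j; solve_cont.
Qed.

Lemma fejer_squares N x : fejer N x = N%:R^-1 *
  ((\sum_(i < N) cos (2 * pi * i%:R * x)) ^+ 2 + (\sum_(i < N) sin (2 * pi * i%:R * x)) ^+ 2).
Proof.
congr (_ * _); rewrite !expr2 !mulr_suml -big_split /=; apply: eq_bigr => i _.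
rewrite !mulr_sumr -big_split /=; apply: eq_bigr => j _.
by rewrite -cosB; congr cos; ring.
Qed.

Lemma fejer_ge0 N x : 0 <= fejer N x.
Proof. by rewrite fejer_squares mulr_ge0 ?invr_ge0 ?ler0n // addr_ge0 ?sqr_ge0. Qed.

Lemma fejer_period N x (p q : nat) : fejer N (x + (p%:R - q%:R)) = fejer N x.
Proof.
congr (_ * _); apply: eq_bigr => i _; apply: eq_bigr => j _.
rewrite -[RHS](cos_int_period _ (i * p + j * q) (i * q + j * p)); congr cos.
by rewrite !natrD !natrM; ring.
Qed.

(** 2 sin(pi x) times each of the two sums in [fejer_squares] telescopes to a difference of two
values of sin or cos. *)
Lemma sin_mul_fejer N x : N%:R * fejer N x * sin (pi * x) ^+ 2 <= 1.
Proof.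
case: N => [|N]; first by rewrite !mul0r ler01.
rewrite fejer_squares mulVKf ?pnatr_eq0 //.
set s := sin (pi * x); set c := cos (pi * x).
set n := (N.+1)%:R : R.
have E1 : 2 * s * (\sum_(i < N.+1) cos (2 * pi * i%:R * x)) =
    sin (pi * (2 * n - 1) * x) + s.
  rewrite /n; elim: N.+1 => [|m IH].
    by rewrite big_ord0 !mulr0 sub0r mulrN1 mulNr sinN addNr.
  rewrite big_ord_recr /= mulrDr IH.
  have -> : pi * (2 * m.+1%:R - 1) * x = 2 * pi * m%:R * x + pi * x by rewrite -natr1; ring.
  have -> : pi * (2 * m%:R - 1) * x = 2 * pi * m%:R * x - pi * x by ring.
  by rewrite sinB sinD /s; ring.
have E2 : 2 * s * (\sum_(i < N.+1) sin (2 * pi * i%:R * x)) =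
    c - cos (pi * (2 * n - 1) * x).
  rewrite /n; elim: N.+1 => [|m IH].
    by rewrite big_ord0 !mulr0 sub0r mulrN1 mulNr cosN subrr.
  rewrite big_ord_recr /= mulrDr IH.
  have -> : pi * (2 * m.+1%:R - 1) * x = 2 * pi * m%:R * x + pi * x by rewrite -natr1; ring.
  have -> : pi * (2 * m%:R - 1) * x = 2 * pi * m%:R * x - pi * x by ring.
  by rewrite cosB cosD /s /c; ring.
move: E1 E2; set X := \sum_(i < _) _; set Y := \sum_(i < _) _.
set u := sin (pi * (2 * n - 1) * x); set v := cos (pi * (2 * n - 1) * x) => E1 E2.
have uv : v ^+ 2 + u ^+ 2 = 1 by exact: cos2Dsin2.
have sc : c ^+ 2 + s ^+ 2 = 1 by exact: cos2Dsin2.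
have E : 4 * ((X ^+ 2 + Y ^+ 2) * s ^+ 2) = (u + s) ^+ 2 + (c - v) ^+ 2.
  by rewrite -E1 -E2; ring.
have : (u + s) ^+ 2 + (c - v) ^+ 2 <= 4.
  have := sqr_ge0 (u - s); have := sqr_ge0 (c + v); nra.
lra.
Qed.

(** From |sin y - y| <= y^2/2, with y = pi |x| <= pi/2. *)
Lemma sin_pi_lower : exists2 k : R, 0 < k & forall x, `|x| <= 1 / 2 -> k * `|x| <= `|sin (pi * x)|.
Proof.
have p0 := pi_gt0 R; have p4 : pi < 4 :> R by have := pihalf_lt2 R; lra.
exists (pi * (1 - pi / 4)); first by rewrite mulr_gt0 //; lra.
move=> x x2.
have := sinB_le (pi * `|x|); rewrite ler_norml => /andP[h _].
have -> : `|sin (pi * x)| = `|sin (pi * `|x|)|.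
  have [//|/ltW x0] := leP 0 x; first by move=> x0; rewrite (ger0_norm x0).
  by rewrite (ler0_norm x0) mulrN sinN normrN.
apply: le_trans (ler_norm _); move: h (normr_ge0 x) x2; move: `|x| => y h y0 y2.
have : (pi * y) ^+ 2 / 2 <= pi * y * (pi / 4).
  rewrite expr2 -!mulrA ler_wpM2l ?(ltW p0) // ler_wpM2l //; nra.
lra.
Qed.

(** For |x| > e the kernel is at most 1 / (N k^2 x^2), by [sin_mul_fejer] and
[sin_pi_lower].  The bound is in a form that can be multiplied by a Lipschitz constant
and integrated over a period, the kernel having integral 1. *)
Lemma fejer_concentrates e : 0 < e -> exists N0, forall N x, (N0 <= N)%N -> (0 < N)%N ->
  `|x| <= 1 / 2 -> `|x| * fejer N x <= e * fejer N x + e.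
Proof.
move=> e0; have [k k0 Hk] := sin_pi_lower.
have kk0 : 0 < k ^+ 2 * e ^+ 2 by rewrite mulr_gt0 ?exprn_gt0.
exists (Num.bound ((k ^+ 2 * e ^+ 2)^-1)) => N x N0N N0 x2.
have K0 := fejer_ge0 N x.
have [xe|xe] := leP `|x| e.
  by rewrite -[leLHS]addr0 lerD ?(ltW e0) // ler_wpM2r.
apply: ler_wpDl; first by rewrite mulr_ge0 // ltW.
have n0 : 0 < N%:R :> R by rewrite ltr0n.
have nb : (k ^+ 2 * e ^+ 2)^-1 <= N%:R.
  apply: le_trans (ltW (archi_boundP _)) _; first by rewrite invr_ge0 ltW.
  by rewrite ler_nat.
have h1 : 1 <= N%:R * (k ^+ 2 * e ^+ 2) by rewrite -ler_pdivrMr // mul1r.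
have h2 := sin_mul_fejer N x.
have h3 : (k * `|x|) ^+ 2 <= sin (pi * x) ^+ 2.
  by rewrite -[leRHS]real_normK ?num_real // lerXn2r ?nnegrE ?mulr_ge0 ?(ltW k0) ?Hk.
have h4 : N%:R * fejer N x * (k * `|x|) ^+ 2 <= 1.
  by apply: le_trans h2; rewrite ler_wpM2l // mulr_ge0 // ltW.
move: (normr_ge0 x) xe h4; move: `|x| => y y0 ye h4.
have yp : 0 < y by exact: lt_trans ye.
have h5 : fejer N x * y * (N%:R * (k ^+ 2 * y)) <= e * (N%:R * (k ^+ 2 * y)).
  apply: (@le_trans _ _ 1); first by apply: le_trans h4; rewrite le_eqVlt; apply/orP; left; apply/eqP; ring.
  apply: le_trans h1 _; rewrite [leRHS]mulrCA ler_wpM2l ?(ltW n0) //.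
  by rewrite [leRHS]mulrCA ler_wpM2l ?exprn_ge0 ?(ltW k0) // expr2 ler_wpM2l ?ltW.
have Z0 : 0 < N%:R * (k ^+ 2 * y) by rewrite !mulr_gt0 ?exprn_gt0.
by rewrite -(ler_pM2r Z0) (mulrC y).
Qed.

Lemma oint_cos_period c (i j : nat) :
  oint (fun x => cos (2 * pi * (i%:R - j%:R) * x)) (c - 1 / 2) (c + 1 / 2) = (i == j)%:R.
Proof.
have [->|ij] := eqVneq.
  rewrite (@eq_oint _ _ (fun=> 1)) => [|x]; last by rewrite subrr mulr0 mul0r cos0.
  by rewrite oint_cst /= mulr1n; field.
have d0 : 2 * pi * (i%:R - j%:R) != 0 :> R.
  by rewrite !mulf_neq0 ?(lt0r_neq0 (pi_gt0 R)) // subr_eq0 eqr_nat.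
rewrite (@oint_primitive _ _ (fun x => sin (2 * pi * (i%:R - j%:R) * x) / (2 * pi * (i%:R - j%:R)))).
  rewrite -mulrBl (_ : sin _ - sin _ = 0) ?mul0r //.
  rewrite -(sin_int_period (_ * (c - 1 / 2)) i j); apply/eqP; rewrite subr_eq0; apply/eqP.
  by congr sin; field.
move=> x; apply: der_eq; first by solve_der.
rewrite /=; move: (2 * pi * (i%:R - j%:R)) d0 => d d0; field; exact: d0.
Qed.

Lemma oint_fejer N c : (0 < N)%N -> oint (fejer N) (c - 1 / 2) (c + 1 / 2) = 1.
Proof.
move=> N0; rewrite /fejer ointZ; last first.
  by apply: cont_sum => i; apply: cont_sum => j; solve_cont.
rewrite oint_sum => [|i]; last by apply: cont_sum => j; solve_cont.
rewrite (eq_bigr (fun=> 1)) => [|i _].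
  by rewrite sumr_const card_ord -mulr_natl mulr1 mulVf // pnatr_eq0 -lt0n.
rewrite oint_sum => [|j]; last by solve_cont.
rewrite (bigD1 i) //= oint_cos_period eqxx big1 ?addr0 // => j ji.
by rewrite oint_cos_period (_ : (_ == _) = false) //; apply/negbTE; rewrite eq_sym.
Qed.

(** As the kernel has integral 1 over the cell, the difference is the integral of
fejer (f x - f c), at most L times the integral of |x - c| fejer. *)
Lemma fejer_cell e L f N (p q : nat) : 0 <= L -> cont f -> (0 < N)%N ->
  (forall x, `|x| <= 1 / 2 -> `|x| * fejer N x <= e * fejer N x + e) ->
  (forall x, `|x - (p%:R - q%:R)| <= 1 / 2 ->
     `|f x - f (p%:R - q%:R)| <= L * `|x - (p%:R - q%:R)|) ->
  `|oint (fun x => fejer N x * f x) (p%:R - q%:R - 1 / 2) (p%:R - q%:R + 1 / 2)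
    - f (p%:R - q%:R)| <= 2 * L * e.
Proof.
move=> L0 fc N0 HN; set c := p%:R - q%:R => Hf; have kc := @cont_fejer N.
have -> : f c = oint (fun x => fejer N x * f c) (c - 1 / 2) (c + 1 / 2).
  by rewrite ointZr // oint_fejer // mul1r.
rewrite -ointB; [|solve_cont..].
have -> : 2 * L * e = oint (fun x => L * e * fejer N x + L * e) (c - 1 / 2) (c + 1 / 2).
  rewrite ointD; [|solve_cont..].
  by rewrite ointZ // oint_fejer // oint_cst; field.
apply: oint_norm_le => [|||x /andP[x1 x2]]; [lra|solve_cont|solve_cont|].
have xc : `|x - c| <= 1 / 2 by rewrite ler_norml; apply/andP; split; lra.
rewrite -mulrBr normrM (ger0_norm (fejer_ge0 _ _)).
have := HN _ xc; have -> : fejer N (x - c) = fejer N x.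
  by rewrite -[RHS](fejer_period _ _ q p) /c opprB.
move=> h; apply: (@le_trans _ _ (L * (`|x - c| * fejer N x))).
  by rewrite mulrA [leRHS]mulrC ler_wpM2l ?fejer_ge0 // Hf.
by rewrite -mulrA -mulrDr ler_wpM2l.
Qed.

(** The interval is cut into the M.*2.+1 unit cells centred at its integers. *)
Lemma fejer_line e L f N (M : nat) : 0 <= L -> cont f -> (0 < N)%N ->
  (forall x, `|x| <= 1 / 2 -> `|x| * fejer N x <= e * fejer N x + e) ->
  (forall x y, `|x| <= M%:R + 1 -> `|y| <= M%:R + 1 -> `|f x - f y| <= L * `|x - y|) ->
  `|oint (fun x => fejer N x * f x) (- (M%:R + 1 / 2)) (M%:R + 1 / 2)
    - \sum_(i < M.*2.+1) f (i%:R - M%:R)| <= M.*2.+1%:R * (2 * L * e).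
Proof.
move=> L0 fc N0 HN Hf; have kc := @cont_fejer N.
have E : M%:R + 1 / 2 = - (M%:R + 1 / 2) + M.*2.+1%:R :> R.
  have -> : M.*2.+1%:R = 2 * M%:R + 1 :> R by rewrite -natr1 -mul2n natrM.
  by field.
rewrite [X in oint _ _ X]E.
suff H n : (n <= M.*2.+1)%N ->
  `|oint (fun x => fejer N x * f x) (- (M%:R + 1 / 2)) (- (M%:R + 1 / 2) + n%:R)
    - \sum_(i < n) f (i%:R - M%:R)| <= n%:R * (2 * L * e) by exact: H.
elim: n => [_|n IH nM].
  by rewrite big_ord0 addr0 oint_refl subr0 normr0 mul0r.
rewrite big_ord_recr /= (oint_cat _ (- (M%:R + 1 / 2) + n%:R)).
have nM1 : n%:R <= 2 * M%:R :> R by rewrite -natrM ler_nat mul2n.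
have n0 : 0 <= n%:R :> R by rewrite ler0n.
have M0 : 0 <= M%:R :> R by rewrite ler0n.
have := @fejer_cell e L f N n M L0 fc N0 HN.
have -> : n%:R - M%:R - 1 / 2 = - (M%:R + 1 / 2) + n%:R :> R by field.
have -> : n%:R - M%:R + 1 / 2 = - (M%:R + 1 / 2) + n.+1%:R :> R by rewrite -natr1; field.
have {}IH := IH (ltnW nM).
move=> H; have -> : n.+1%:R * (2 * L * e) = n%:R * (2 * L * e) + 2 * L * e.
  by rewrite -natr1; ring.
have aux (a b c d : R) : a + b - (c + d) = (a - c) + (b - d) by ring.
rewrite aux.
apply: le_trans (ler_normD _ _) _; apply: lerD => //; apply: H => x.
rewrite ler_norml => /andP[? ?]; apply: Hf; rewrite ler_norml; apply/andP; split; lra.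
Qed.

End Fejer.

(** * Lipschitz functions of two variables *)

Section Lipschitz.
Variable R : realType.
Implicit Types (f g : R -> R -> R) (h : R -> R) (x y M : R).

Lemma lip2C (c : R) : lip2 (fun _ _ : R => c).
Proof. by move=> M; exists 0 => // *; rewrite subrr normr0 mul0r. Qed.

Lemma lip2x : lip2 (fun x _ : R => x).
Proof. by move=> M; exists 1 => // *; rewrite mul1r lerDl. Qed.

Lemma lip2y : lip2 (fun _ y : R => y).
Proof. by move=> M; exists 1 => // *; rewrite mul1r lerDr. Qed.

Lemma lip2D f g : lip2 f -> lip2 g -> lip2 (fun x y => f x y + g x y).
Proof.
move=> Hf Hg M; have [L L0 HL] := Hf M; have [K K0 HK] := Hg M.
exists (L + K) => [|x x' y y' ? ? ? ?]; first exact: addr_ge0.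
rewrite (_ : _ - _ = (f x y - f x' y') + (g x y - g x' y')); last by ring.
by rewrite (mulrDl L) (le_trans (ler_normD _ _)) // lerD ?HL ?HK.
Qed.

(** Covers negation, the cosine and the positive part at once. *)
Lemma lip2_contraction h f : (forall x y, `|h x - h y| <= `|x - y|) -> lip2 f ->
  lip2 (fun x y => h (f x y)).
Proof.
by move=> Hh Hf M; have [L L0 HL] := Hf M; exists L => // *; rewrite (le_trans (Hh _ _)) ?HL.
Qed.

Lemma lip2N f : lip2 f -> lip2 (fun x y => - f x y).
Proof. by apply: lip2_contraction => x y; rewrite -opprD normrN. Qed.

Lemma lip2M f g : lip2 f -> lip2 g -> lip2 (fun x y => f x y * g x y).
Proof.
move=> Hf Hg M; have [L L0 HL] := Hf `|M|; have [K K0 HK] := Hg `|M|.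
have bd (u : R -> R -> R) (B x y : R) : 0 <= B -> (forall x x' y y',
  `|x| <= `|M| -> `|x'| <= `|M| -> `|y| <= `|M| -> `|y'| <= `|M| ->
  `|u x y - u x' y'| <= B * (`|x - x'| + `|y - y'|)) ->
  `|x| <= `|M| -> `|y| <= `|M| -> `|u x y| <= `|u 0 0| + B * (`|M| + `|M|).
  move=> B0 HB xM yM; have -> : u x y = u 0 0 + (u x y - u 0 0) by ring.
  apply: le_trans (ler_normD _ _) _; rewrite lerD2l.
  apply: le_trans (HB x 0 y 0 xM _ yM _) _; rewrite ?normr0 // !subr0.
  by rewrite ler_wpM2l // lerD.
set F := `|f 0 0| + L * (`|M| + `|M|); set G := `|g 0 0| + K * (`|M| + `|M|).
have F0 : 0 <= F by rewrite addr_ge0 ?mulr_ge0 ?addr_ge0.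
have G0 : 0 <= G by rewrite addr_ge0 ?mulr_ge0 ?addr_ge0.
exists (F * K + L * G) => [|x x' y y' xM x'M yM y'M]; first by rewrite addr_ge0 ?mulr_ge0.
have MM := ler_norm M.
have {}xM := le_trans xM MM; have {}x'M := le_trans x'M MM.
have {}yM := le_trans yM MM; have {}y'M := le_trans y'M MM.
rewrite (_ : _ - _ = f x y * (g x y - g x' y') + (f x y - f x' y') * g x' y'); last by ring.
apply: le_trans (ler_normD _ _) _; rewrite !normrM (mulrDl (F * K)).
by apply: lerD; [rewrite -(mulrA F)|rewrite (mulrAC L)]; apply: ler_pM => //;
  rewrite ?HK ?HL ?(bd f L) ?(bd g K).
Qed.

Lemma lip2X f n : lip2 f -> lip2 (fun x y => f x y ^+ n).
Proof.
move=> Hf; elim: n => [|n IH]; first exact: lip2C.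
rewrite (_ : (fun _ _ => _) = fun x y => f x y * f x y ^+ n); first exact: lip2M.
by apply/funext => x; apply/funext => y; rewrite exprS.
Qed.

Lemma cos_contraction x y : `|cos x - cos y| <= `|x - y|.
Proof.
wlog xy : x y / y <= x => [W|].
  by have [/W//|/ltW /W] := leP y x; rewrite distrC (distrC y).
rewrite (@ger0_norm _ (x - y)) ?subr_ge0 //.
apply: (@norm_le_of_der_le R (@cos R) id (fun x => - sin x) (fun=> 1) y x xy) => [t _|t _|t _].
- by apply: der_eq (der_cos (derI t)) _; rewrite mulr1.
- exact: derI.
- by rewrite normrN sin_max.
Qed.

Lemma max0_contraction x y : `|Num.max 0 x - Num.max 0 y| <= `|x - y|.
Proof.
wlog xy : x y / y <= x => [W|].
  by have [/W//|/ltW /W] := leP y x; rewrite distrC (distrC y).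
rewrite (@ger0_norm _ (x - y)) ?subr_ge0 //.
have [x0|x0] := leP x 0; have [y0|y0] := leP y 0; rewrite ?(subrr, subr0) ?normr0 ?subr_ge0 //.
- lra.
- rewrite gtr0_norm //; lra.
- rewrite ger0_norm //; lra.
Qed.

Lemma lip2_cos f : lip2 f -> lip2 (fun x y => cos (f x y)).
Proof. exact: lip2_contraction cos_contraction. Qed.

Lemma lip2_max0 f : lip2 f -> lip2 (fun x y => Num.max 0 (f x y)).
Proof. exact: lip2_contraction max0_contraction. Qed.

Lemma lip2_sum n (h : 'I_n -> R -> R -> R) : (forall i, lip2 (h i)) ->
  lip2 (fun x y => \sum_(i < n) h i x y).
Proof.
elim: n h => [|n IH] h H.
  rewrite (_ : (fun _ _ => _) = fun _ _ => 0); first exact: lip2C.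
  by apply/funext => x; apply/funext => y; rewrite big_ord0.
rewrite (_ : (fun _ _ => _) = fun x y => \sum_(i < n) h (widen_ord (leqnSn n) i) x y +
  h ord_max x y); first by apply: lip2D; [exact: IH|exact: H].
by apply/funext => x; apply/funext => y; rewrite big_ord_recr.
Qed.

End Lipschitz.

Ltac solve_lip := lazymatch goal with
  | |- forall _, _ => move=> ?; solve_lip
  | |- lip2 ?f => lazymatch f with
    | (fun x _ => x) => exact: lip2x
    | (fun _ y => y) => exact: lip2y
    | (fun _ _ => ?c) => exact: lip2C
    | (fun x y => @Algebra.add _ (@?g x y) (@?h x y)) => apply: (@lip2D _ g h); solve_lip
    | (fun x y => @Algebra.opp _ (@?g x y)) => apply: (@lip2N _ g); solve_lip
    | (fun x y => @GRing.mul _ (@?g x y) (@?h x y)) => apply: (@lip2M _ g h); solve_lip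
    | (fun x y => @GRing.exp _ (@?g x y) ?n) => apply: (@lip2X _ g n); solve_lip
    | (fun x y => cos (@?g x y)) => apply: (@lip2_cos _ g); solve_lip
    | (fun x y => Num.max 0 (@?g x y)) => apply: (@lip2_max0 _ g); solve_lip
    | (fun x y => ?g x y) => change (lip2 g); solve_lip
    | _ => try eassumption
    end
  end.

(** * Products of Fejer kernels in the plane *)

Section FejerPlane.
Variable R : realType.
Implicit Types (F : R -> R -> R) (x y : R).

Lemma cont_bigsum (I : Type) (s : seq I) (h : I -> R -> R) :
  (forall i, cont (h i)) -> cont (fun x => \sum_(i <- s) h i x).
Proof.
move=> H; elim: s => [|i s IH].
  rewrite (_ : (fun _ => _) = fun=> 0); first exact: contC.
  by apply/funext => x; rewrite big_nil.
rewrite (_ : (fun _ => _) = fun x => h i x + \sum_(j <- s) h j x); first by apply: contD.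
by apply/funext => x; rewrite big_cons.
Qed.

Lemma oint_bigsum (I : Type) (s : seq I) (h : I -> R -> R) a b :
  (forall i, cont (h i)) ->
  oint (fun x => \sum_(i <- s) h i x) a b = \sum_(i <- s) oint (h i) a b.
Proof.
move=> H; elim: s => [|i s IH].
  by rewrite big_nil (@eq_oint _ _ (fun=> 0)) ?oint_cst ?mul0r // => x; rewrite big_nil.
rewrite big_cons -IH -ointD //; last exact: cont_bigsum.
by apply: eq_oint => x; rewrite big_cons.
Qed.

Lemma sum_prod_pair (I : finType) (g h : I -> I -> R) :
  \sum_(u : I * I) \sum_(v : I * I) g u.1 v.1 * h u.2 v.2 =
  (\sum_i \sum_j g i j) * (\sum_i \sum_j h i j).
Proof.
rewrite -(pair_bigA _ (fun i i' => \sum_(v : I * I) g i v.1 * h i' v.2)) /= mulr_suml.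
apply: eq_bigr => i _; rewrite mulr_sumr; apply: eq_bigr => i' _.
rewrite -(pair_bigA _ (fun j j' => g i j * h i' j')) /= mulr_suml.
by apply: eq_bigr => j _; rewrite mulr_sumr.
Qed.

(** cos (a + b) = cos a cos b - sin a sin b, and the double sums of sines vanish because
exchanging i and j changes their sign. *)
Lemma fejer_mul N x y : fejer N x * fejer N y = N%:R^-1 ^+ 2 *
  \sum_(u : 'I_N * 'I_N) \sum_(v : 'I_N * 'I_N)
    cos (2 * pi * ((u.1%:R - v.1%:R) * x + (u.2%:R - v.2%:R) * y)).
Proof.
have E : \sum_(u : 'I_N * 'I_N) \sum_(v : 'I_N * 'I_N)
    cos (2 * pi * ((u.1%:R - v.1%:R) * x + (u.2%:R - v.2%:R) * y)) =
    (\sum_(i < N) \sum_(j < N) cos (2 * pi * (i%:R - j%:R) * x)) *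
    (\sum_(i < N) \sum_(j < N) cos (2 * pi * (i%:R - j%:R) * y)) -
    (\sum_(i < N) \sum_(j < N) sin (2 * pi * (i%:R - j%:R) * x)) *
    (\sum_(i < N) \sum_(j < N) sin (2 * pi * (i%:R - j%:R) * y)).
  rewrite -!sum_prod_pair -sumrB; apply: eq_bigr => u _; rewrite -sumrB.
  by apply: eq_bigr => v _; rewrite -cosD; congr cos; ring.
have Z (z : R) : \sum_(i < N) \sum_(j < N) sin (2 * pi * (i%:R - j%:R) * z) = 0.
  set S := LHS; have : S = - S; last by lra.
  rewrite {1}/S exchange_big /= -sumrN; apply: eq_bigr => i _; rewrite -sumrN.
  by apply: eq_bigr => j _; rewrite -sinN; congr sin; ring.
by rewrite E !Z mul0r subr0 /fejer; ring.
Qed.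

Lemma lip2_fejerl N : lip2 (fun x _ : R => fejer N x).
Proof.
apply: lip2M; first exact: lip2C.
by apply: lip2_sum => i; apply: lip2_sum => j; solve_lip.
Qed.

Lemma lip2_fejerr N : lip2 (fun _ y : R => fejer N y).
Proof. exact: lip2_swap (lip2_fejerl N). Qed.

Definition fourier2 F (B k1 k2 : R) : R :=
  oint (fun x => oint (fun y => F x y * cos (2 * pi * (k1 * x + k2 * y))) (- B) B) (- B) B.

Lemma cont_oint_r F a b : lip2 F -> cont (fun x => oint (F x) a b).
Proof. by move=> /lip2_swap /cont_oint; apply. Qed.

Lemma fejer_plane_expand F B N : lip2 F ->
  oint (fun x => fejer N x * oint (fun y => fejer N y * F x y) (- B) B) (- B) B =
  N%:R^-1 ^+ 2 * \sum_(u : 'I_N * 'I_N) \sum_(v : 'I_N * 'I_N)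
    fourier2 F B (u.1%:R - v.1%:R) (u.2%:R - v.2%:R).
Proof.
move=> Fl; have Fr x : cont (F x) by exact: lip2_contr.
have kc : cont (@fejer R N) by exact: cont_fejer.
have hl u v : lip2 (fun x y => F x y * cos (2 * pi * (u * x + v * y))) by solve_lip.
have hc u v x : cont (fun y => F x y * cos (2 * pi * (u * x + v * y))).
  exact: lip2_contr (hl u v).
rewrite (@eq_oint _ _ (fun x => N%:R^-1 ^+ 2 * \sum_(u : 'I_N * 'I_N) \sum_(v : 'I_N * 'I_N)
   oint (fun y => F x y * cos (2 * pi * ((u.1%:R - v.1%:R) * x + (u.2%:R - v.2%:R) * y))) (- B) B)).
  rewrite ointZ; last first.
    apply: cont_bigsum => u; apply: cont_bigsum => v.
    exact: cont_oint_r (hl _ _).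
  rewrite oint_bigsum => [|u]; last first.
    by apply: cont_bigsum => v; exact: cont_oint_r (hl _ _).
  congr (_ * _); apply: eq_bigr => u _.
  by rewrite oint_bigsum => [//|v]; exact: cont_oint_r (hl _ _).
move=> x; rewrite -ointZ; last by solve_cont.
rewrite (@eq_oint _ _ (fun y => N%:R^-1 ^+ 2 * \sum_(u : 'I_N * 'I_N) \sum_(v : 'I_N * 'I_N)
   F x y * cos (2 * pi * ((u.1%:R - v.1%:R) * x + (u.2%:R - v.2%:R) * y)))) => [|y].
  rewrite ointZ; last by apply: cont_bigsum => u; apply: cont_bigsum => v; exact: hc.
  rewrite oint_bigsum => [|u]; last by apply: cont_bigsum => v; exact: hc.
  congr (_ * _); apply: eq_bigr => u _.
  by rewrite oint_bigsum.
rewrite mulrA fejer_mul -mulrA; congr (_ * _); rewrite mulr_suml.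
by apply: eq_bigr => u _; rewrite mulr_suml; apply: eq_bigr => v _; rewrite mulrC.
Qed.

(** [fejer_line] in y, uniformly in x, then again in x; e' is chosen so that the two
errors add up to at most e. *)
Lemma fejer_plane F (M : nat) e : lip2 F -> 0 < e ->
  exists N0, forall N, (N0 <= N)%N -> (0 < N)%N ->
  `|oint (fun x => fejer N x * oint (fun y => fejer N y * F x y) (- (M%:R + 1 / 2)) (M%:R + 1 / 2))
      (- (M%:R + 1 / 2)) (M%:R + 1 / 2)
    - \sum_(i < M.*2.+1) \sum_(j < M.*2.+1) F (i%:R - M%:R) (j%:R - M%:R)| <= e.
Proof.
move=> Fl e0; have M0 : 0 <= M%:R :> R by rewrite ler0n.
have [L L0 HL] := Fl (M%:R + 1).
set n := M.*2.+1; have n0 : 0 <= n%:R :> R by rewrite ler0n.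
set B := M%:R + 1 / 2 : R; have BB : - B <= B by rewrite /B; lra.
set C := 4 * n%:R ^+ 2 * L; have C0 : 0 <= C by rewrite !mulr_ge0 ?exprn_ge0.
pose e' := e / (C + 1); have e'0 : 0 < e' by rewrite divr_gt0 // ltr_wpDl.
have [N0 HN0] := fejer_concentrates e'0.
exists N0 => N N0N Np; have HN x := HN0 N x N0N Np.
have kc : cont (@fejer R N) by exact: cont_fejer.
have Kn : oint (fun x => fejer N x * 1) (- B) B = n%:R.
  have := @fejer_line R e' 0 (fun=> 1) N M (lexx _) (@contC R 1) Np HN.
  rewrite !mulr0 mul0r mulr0 sumr_const card_ord normr_le0 subr_eq0 => H; apply/eqP/H.
  by move=> x y _ _; rewrite subrr normr0 mul0r.
pose u x := oint (fun y => fejer N y * F x y) (- B) B.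
pose U x := \sum_(j < n) F x (j%:R - M%:R).
have uc : cont u.
  apply: cont_oint_r; apply: lip2M => //; exact: lip2_fejerr.
have Uc : cont U by apply: cont_sum => j; exact: lip2_contl.
have uU x : `|x| <= M%:R + 1 -> `|u x - U x| <= n%:R * (2 * L * e').
  move=> xM; apply: fejer_line => //; first exact: lip2_contr.
  by move=> y z yM zM; have := HL x x y z xM xM yM zM; rewrite subrr normr0 add0r.
have jM (j : 'I_n) : `|j%:R - M%:R| <= M%:R + 1 :> R.
  have j0 : 0 <= j%:R :> R by rewrite ler0n.
  have : j%:R <= 2 * M%:R :> R by rewrite -natrM ler_nat mul2n -ltnS.
  by move=> ?; rewrite ler_norml; apply/andP; split; lra.
have step2 : `|oint (fun x => fejer N x * U x) (- B) B - \sum_(i < n) U (i%:R - M%:R)| <=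
    n%:R * (2 * (n%:R * L) * e').
  apply: fejer_line => //; first exact: mulr_ge0.
  move=> x y xM yM; rewrite /U -sumrB; apply: le_trans (ler_norm_sum _ _ _) _.
  rewrite -mulrA mulr_natl -[n in leRHS]card_ord -sumr_const; apply: ler_sum => j _.
  have := HL x y (j%:R - M%:R) (j%:R - M%:R) xM yM (jM j) (jM j).
  by rewrite [_ - _ - _ in X in _ <= X]subrr normr0 addr0.
have step1 : `|oint (fun x => fejer N x * u x) (- B) B - oint (fun x => fejer N x * U x) (- B) B| <=
    n%:R * (n%:R * (2 * L * e')).
  rewrite -ointB; [|solve_cont..].
  rewrite -{1}Kn -ointZr; last by solve_cont.
  apply: oint_norm_le => // [||x /andP[x1 x2]]; [solve_cont|solve_cont|].
  rewrite -mulrBr normrM (ger0_norm (fejer_ge0 _ _)) mulr1 ler_wpM2l ?fejer_ge0 //.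
  by apply: uU; rewrite ler_norml /B in x1 x2 *; apply/andP; split; lra.
apply: (@le_trans _ _ (n%:R * (n%:R * (2 * L * e')) + n%:R * (2 * (n%:R * L) * e'))).
  set X := oint _ _ _ in step1 step2 *; set Y := oint _ _ _ in step1 step2.
  rewrite -/(U _) (_ : X - _ = (X - Y) + (Y - \sum_(i < n) U (i%:R - M%:R))); last by rewrite addrA subrK.
  by apply: le_trans (ler_normD _ _) _; apply: lerD.
rewrite (_ : _ + _ = C * e'); last by rewrite /C; ring.
rewrite /e' mulrCA ler_piMr ?(ltW e0) // ler_pdivrMr ?mul1r ?lerDl // ltr_wpDl //.
Qed.

End FejerPlane.

(** * The Fourier transform of a truncated quadratic form *)

Section Ellipse.
Variable R : realType.
Implicit Types (f : R -> R) (x y s : R).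

Lemma oint_extend f a b a' b' : cont f -> a' <= a -> b <= b' ->
  (forall x, x <= a -> f x = 0) -> (forall x, b <= x -> f x = 0) ->
  oint f a b = oint f a' b'.
Proof.
move=> fc aa bb fa fb.
rewrite (oint_cat f a a' b') (oint_cat f b a b').
have z c d : c <= d -> (forall x, c <= x <= d -> f x = 0) -> oint f c d = 0.
  move=> cd H; rewrite (eq_oint_on cd fc (@contC R 0) H) oint_cst mul0r //.
rewrite (z a' a aa) => [|x /andP[_ /fa] //].
by rewrite (z b b' bb) => [|x /andP[/fb] //]; rewrite add0r addr0.
Qed.

Lemma oint_parabola_cap (A h x0 : R) :
  oint (fun x => A * (h ^+ 2 - (x - x0) ^+ 2)) (x0 - h) (x0 + h) = 4 / 3 * A * h ^+ 3.
Proof.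
rewrite (@oint_primitive _ _ (fun x => A * (h ^+ 2 * x - (x - x0) ^+ 3 / 3))); first by field.
by move=> x; apply: der_eq; [solve_der|rewrite /=; field].
Qed.

(** In this part p r - q^2 is the discriminant of the form, and its dual form at (l1, l2)
is, up to that factor, [qform p q r l2 (- l1)]. *)
Definition qform (p q r x y : R) : R := p * x ^+ 2 + 2 * q * x * y + r * y ^+ 2.
Definition qcap (p q r T x y : R) : R := Num.max 0 (T - qform p q r x y).

Lemma lip2_qcap p q r T : lip2 (qcap p q r T).
Proof.
by rewrite /qcap /qform; solve_lip.
Qed.

Lemma qcap_swap p q r T x y : qcap p q r T x y = qcap r q p T y x.
Proof. by rewrite /qcap /qform; congr (Num.max 0 _); ring. Qed.

Variables (p q r T B l1 l2 : R).
Hypotheses (p0 : 0 < p) (D0 : 0 < p * r - q ^+ 2) (T0 : 0 < T) (B0 : 0 <= B).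
Hypothesis HB : forall x y, B <= `|x| \/ B <= `|y| -> T <= qform p q r x y.
Hypothesis l20 : 0 < l2.

Let D := p * r - q ^+ 2.
Let Q' := qform p q r l2 (- l1).
Let A := Q' / l2 ^+ 2.
Let s0 := Num.sqrt (T * Q' / D).
Let F := qcap p q r T.
Let Fl : lip2 F := @lip2_qcap p q r T.

Let Q'0 : 0 < Q'.
Proof.
rewrite -(pmulr_rgt0 _ p0).
have -> : p * Q' = (p * l2 - q * l1) ^+ 2 + D * l1 ^+ 2.
  by rewrite /Q' /qform /D; ring.
have [->|l1n] := eqVneq l1 0.
  by rewrite mulr0 subr0 expr0n mulr0 addr0 exprn_gt0 // mulr_gt0.
by rewrite ltr_wpDl ?sqr_ge0 // mulr_gt0 // exprn_even_gt0.
Qed.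

Let A0 : 0 < A. Proof. by rewrite divr_gt0 // exprn_gt0. Qed.

Let s02 : s0 ^+ 2 = T * Q' / D.
Proof. by rewrite sqr_sqrtr // divr_ge0 ?mulr_ge0 ?ltW. Qed.

Let s00 : 0 < s0. Proof. by rewrite sqrtr_gt0 divr_gt0 ?mulr_gt0. Qed.

Let slice x s := F x ((s - l1 * x) / l2).
Let x0 s := - (q * l2 - r * l1) * s / Q'.

(** Completing the square: on the line l1 x + l2 y = s the form is a constant multiple of
s^2, its minimum, plus A (x - x0)^2. *)
Let sliceE x s :
  slice x s = Num.max 0 (T - D / Q' * s ^+ 2 - A * (x - x0 s) ^+ 2).
Proof.
rewrite /slice /F /qcap; congr (Num.max 0 _).
have Qn := lt0r_neq0 Q'0; have ln := lt0r_neq0 l20.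
have QE : Q' = p * l2 ^+ 2 - 2 * q * l1 * l2 + r * l1 ^+ 2 by rewrite /Q' /qform; ring.
rewrite /A /x0 /qform; move: Q' QE Qn => Q QE Qn.
transitivity (T - (D * s ^+ 2 + (Q * x + (q * l2 - r * l1) * s) ^+ 2 / l2 ^+ 2) / Q); last first.
  by field; rewrite Qn ln.
congr (T - _); apply: (mulfI Qn); rewrite [RHS]mulrC divfK //.
by rewrite {1}QE /D QE; field.
Qed.

Let lip2_slice : lip2 slice.
Proof.
by rewrite /slice /F /qcap /qform; solve_lip.
Qed.

Let slice_out x s : B <= `|x| -> slice x s = 0.
Proof.
by move=> h; rewrite /slice /F /qcap; apply/max_idPl; rewrite subr_le0; apply: HB; left.
Qed.

Let V s := oint (fun x => slice x s) (- B) B.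

(** Below the boundary of the ellipse a slice is a parabolic cap of half-width h. *)
Let V_cap s h : 0 <= h -> A * h ^+ 2 = T - D / Q' * s ^+ 2 -> V s = 4 / 3 * A * h ^+ 3.
Proof.
move=> h0 hE; have gc : cont (fun x => slice x s) by exact: lip2_contl.
have gE x : slice x s = Num.max 0 (A * (h ^+ 2 - (x - x0 s) ^+ 2)).
  by rewrite sliceE -hE mulrBr.
pose B' := B + (`|x0 s| + h).
have BB' : B <= B' by rewrite lerDl addr_ge0.
rewrite /V (@oint_extend _ _ _ (- B') B' gc) ?lerN2 //; last 2 first.
- by move=> x xB; apply: slice_out; rewrite -normrN (le_trans _ (ler_norm _)) // lerNr.
- by move=> x xB; apply: slice_out; rewrite (le_trans xB) // ler_norm.
have zout x : h <= `|x - x0 s| -> slice x s = 0.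
  move=> hx; rewrite gE; apply/max_idPl; rewrite pmulr_rle0 // subr_le0.
  by rewrite -(real_normK (num_real (x - x0 s))) lerXn2r ?nnegrE.
rewrite -(@oint_extend _ (x0 s - h) (x0 s + h) _ _ gc).
- rewrite -(oint_parabola_cap A h (x0 s)); apply: eq_oint_on => //; [lra|solve_cont|].
  move=> x /andP[x1 x2]; rewrite gE; apply/max_idPr; rewrite mulr_ge0 ?(ltW A0) //.
  rewrite subr_ge0 -(real_normK (num_real (x - x0 s))) lerXn2r ?nnegrE //.
  by rewrite ler_norml; apply/andP; split; lra.
- by have := ler_norm (- x0 s); rewrite normrN /B'; have := B0; move: (x0 s) => z ? ?; lra.
- by have := ler_norm (x0 s); rewrite /B'; have := B0; move: (x0 s) => z ? ?; lra.
- by move=> x xh; apply: zout; rewrite -normrN (le_trans _ (ler_norm _)) //; lra.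
- by move=> x xh; apply: zout; rewrite (le_trans _ (ler_norm _)) //; lra.
Qed.

Let V_out s : s0 <= `|s| -> V s = 0.
Proof.
move=> ss; rewrite /V (@eq_oint _ _ (fun=> 0)) ?oint_cst ?mul0r // => x.
rewrite sliceE; apply/max_idPl.
have h1 : 0 <= A * (x - x0 s) ^+ 2 by rewrite mulr_ge0 ?sqr_ge0 // ltW.
have h2 : T <= D / Q' * s ^+ 2.
  apply: (@le_trans _ _ (D / Q' * s0 ^+ 2)).
    rewrite s02 (_ : _ * _ = T) //; field; apply/andP; split; exact: lt0r_neq0.
  rewrite ler_wpM2l ?divr_ge0 ?(ltW D0) ?(ltW Q'0) //.
  by rewrite -(real_normK (num_real s)) lerXn2r ?nnegrE // ltW.
lra.
Qed.

(** The shear y -> s = l1 x + l2 y makes the wave depend on s alone; after exchanging the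
integrals the inner one is [V s].  With s = s0 sin t the half-width of the slice is
sqrt(T/A) cos t, whose cube, times the Jacobian s0 cos t, gives the cos^4 of [bess]. *)
Lemma oint_qcap_wave w :
  oint (fun x => oint (fun y => F x y * cos (w * (l1 * x + l2 * y))) (- B) B) (- B) B =
  4 / 3 * T ^+ 2 / Num.sqrt D * bess (w * s0).
Proof.
pose phi s := cos (w * s).
have phil : lip2 (fun _ s : R => phi s) by rewrite /phi; solve_lip.
have phic : cont phi by rewrite /phi; solve_cont.
rewrite /bess [X in _ = _ * X](@eq_oint _ _ (fun t => cos t ^+ 4 * phi (s0 * sin t))) => [|t]; last by rewrite /phi; rewrite mulrA.
pose S := (`|l1| + l2) * B + s0.
have l1B0 : 0 <= (`|l1| + l2) * B by rewrite mulr_ge0 // addr_ge0 // ltW.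
have ln := lt0r_neq0 l20.
have Hl : lip2 (fun x s => slice x s * phi s) by exact: lip2M.
have inner x : - B <= x <= B -> oint (fun y => F x y * phi (l1 * x + l2 * y)) (- B) B =
    l2^-1 * oint (fun s => slice x s * phi s) (- S) S.
  move=> xB; have xB' : `|x| <= B by rewrite ler_norml.
  pose G y := F x y * phi (l1 * x + l2 * y).
  have Gc : cont G.
    apply: contM; first exact: lip2_contr Fl.
    by apply: (@cont_comp R phi) => //; solve_cont.
  have G0 y : B <= `|y| -> G y = 0.
    move=> yB; rewrite /G /F /qcap (_ : Num.max _ _ = 0) ?mul0r //.
    by apply/max_idPl; rewrite subr_le0; apply: HB; right.
  have l1x : `|l1 * x| <= `|l1| * B by rewrite normrM ler_wpM2l.
  have lim1 : B <= l2^-1 * S + - (l1 * x) / l2.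
    rewrite (mulrC l2^-1) -mulrDl ler_pdivlMr // /S.
    have := s00; move: s0 => z z0; have := ler_norm (l1 * x); lra.
  have lim2 : l2^-1 * (- S) + - (l1 * x) / l2 <= - B.
    rewrite (mulrC l2^-1) -mulrDl ler_pdivrMr // /S.
    have := s00; move: s0 => z z0; have := ler_norm (- (l1 * x)); rewrite normrN; lra.
  rewrite -/G (oint_extend Gc lim2 lim1); last 2 first.
  - by move=> y yB; apply: G0; rewrite -normrN (le_trans _ (ler_norm _)) // lerNr.
  - by move=> y yB; apply: G0; rewrite (le_trans yB) // ler_norm.
  rewrite -[LHS](mulKf ln); congr (_ * _).
  have := @oint_affine R G l2^-1 (- (l1 * x) / l2) (- S) S Gc; rewrite invrK => <-; last by rewrite invr_eq0.
  apply: eq_oint => s; rewrite /G /slice; congr (F x _ * phi _); by field.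
have -> : oint (fun x => oint (fun y => F x y * phi (l1 * x + l2 * y)) (- B) B) (- B) B =
    oint (fun x => l2^-1 * oint (fun s => slice x s * phi s) (- S) S) (- B) B.
  apply: eq_oint_on => //; first by have := B0; lra.
    by apply: cont_oint_r; apply: lip2M => //; rewrite /phi; solve_lip.
  by apply: contM; [exact: contC|exact: cont_oint_r].
rewrite ointZ; last exact: cont_oint_r.
rewrite -(fubini _ _ _ _ Hl).
have E1 s : oint (fun x => slice x s * phi s) (- B) B = V s * phi s.
  by rewrite ointZr //; exact: lip2_contl.
rewrite (eq_oint _ _ E1).
have Vc : cont V by exact: cont_oint.
have Vpc : cont (fun s => V s * phi s) by solve_cont.
have sS : s0 <= S by rewrite lerDr.
rewrite -(@oint_extend _ (- s0) s0 _ _ Vpc) ?lerN2 //; last 2 first.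
- by move=> s ss; rewrite V_out ?mul0r // -normrN (le_trans _ (ler_norm _)) // lerNr.
- by move=> s ss; rewrite V_out ?mul0r // (le_trans ss) // ler_norm.
have -> : oint (fun s => V s * phi s) (- s0) s0 =
   oint (fun s => V s * phi s) (s0 * sin (- (pi / 2))) (s0 * sin (pi / 2)).
  by rewrite sinN sin_pihalf mulrN mulr1.
rewrite -(@oint_subst R _ (fun t => s0 * sin t) (fun t => s0 * cos t)) //; last first.
  by move=> t; apply: der_eq; [solve_der|rewrite /=; ring].
rewrite -[LHS]ointZ; last first.
  apply: contM; last by solve_cont.
  by apply: contM; [apply: (@cont_comp R V)|apply: (@cont_comp R phi)] => //; solve_cont.
have phsc : cont (fun t => phi (s0 * sin t)) by apply: (@cont_comp R phi) => //; solve_cont.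
have Vsc : cont (fun t => V (s0 * sin t)) by apply: (@cont_comp R V) => //; solve_cont.
rewrite -[RHS]ointZ; last by solve_cont.
have pp := pi_gt0 R.
apply: eq_oint_on => [|||t tpi]; [lra|solve_cont|solve_cont|].
have ct : 0 <= cos t by exact: cos_ge0_pihalf.
set h := Num.sqrt (T / A) * cos t.
have TA : Num.sqrt (T / A) ^+ 2 = T / A by apply/sqr_sqrtr/divr_ge0; apply: ltW.
rewrite (@V_cap _ h) ?mulr_ge0 ?sqrtr_ge0 //; last first.
  rewrite /h !exprMn TA s02 cos2sin2; field.
  by rewrite !lt0r_neq0 //.
(* In the constant the direction of the frequency cancels. *)
have key : l2^-1 * A * Num.sqrt (T / A) ^+ 3 * s0 = T ^+ 2 / Num.sqrt D.
  have sD : 0 < Num.sqrt D by rewrite sqrtr_gt0.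
  rewrite exprS TA.
  have -> : l2^-1 * A * (Num.sqrt (T / A) * (T / A)) * s0 = T / l2 * (Num.sqrt (T / A) * s0).
    by field; rewrite ln lt0r_neq0.
  rewrite /s0 -(sqrtrM _ (divr_ge0 (ltW T0) (ltW A0))).
  have -> : T / A * (T * Q' / D) = (T * l2) ^+ 2 / D.
    by rewrite /A; field; rewrite ln !lt0r_neq0.
  rewrite sqrtrM ?sqr_ge0 // sqrtr_sqr ger0_norm ?mulr_ge0 ?(ltW T0) ?(ltW l20) // sqrtrV ?(ltW D0) //.
  by field; rewrite ln lt0r_neq0.
rewrite /h exprMn.
transitivity (4 / 3 * (l2^-1 * A * Num.sqrt (T / A) ^+ 3 * s0) * (cos t ^+ 4 * phi (s0 * sin t))).
  by ring.
by rewrite key; ring.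
Qed.

End Ellipse.

Section EllipseFourier.
Variable R : realType.
Implicit Types (p q r T B k : R).

(** r Q = D x^2 + (q x + r y)^2 and p Q = D y^2 + (p x + q y)^2. *)
Lemma qform_coercive p q r T : 0 < p -> 0 < p * r - q ^+ 2 -> 0 < T ->
  exists2 B0, 0 <= B0 & forall B, B0 <= B ->
  forall x y, B <= `|x| \/ B <= `|y| -> T <= qform p q r x y.
Proof.
move=> p0 D0 T0; set D := p * r - q ^+ 2 in D0.
have r0 : 0 < r by rewrite -(pmulr_rgt0 _ p0); have := sqr_ge0 q; rewrite /D in D0; lra.
pose B0 := 1 + (p + r) * T / D.
have c0 : 0 < (p + r) * T / D by rewrite divr_gt0 // mulr_gt0 // addr_gt0.
exists B0 => [|B BB]; first by rewrite addr_ge0 // ltW.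
have B1 : 1 <= B by apply: le_trans BB; rewrite lerDl ltW.
have BT : (p + r) * T <= D * B ^+ 2.
  rewrite (mulrC D) -ler_pdivrMr //; apply: (@le_trans _ _ B).
    by apply: le_trans BB; rewrite lerDr.
  by rewrite expr2 ler_peMr // (le_trans ler01).
have sq z : B <= `|z| -> D * B ^+ 2 <= D * z ^+ 2.
  move=> h; rewrite ler_wpM2l ?(ltW D0) // -(real_normK (num_real z)).
  by rewrite lerXn2r ?nnegrE // (le_trans ler01).
move=> x y [/sq h|/sq h].
  rewrite -(ler_pM2l r0); have E : r * qform p q r x y = D * x ^+ 2 + (q * x + r * y) ^+ 2.
    by rewrite /qform /D; ring.
  rewrite E; have := sqr_ge0 (q * x + r * y); have : 0 < p * T by rewrite mulr_gt0.
  lra.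
rewrite -(ler_pM2l p0); have E : p * qform p q r x y = D * y ^+ 2 + (p * x + q * y) ^+ 2.
  by rewrite /qform /D; ring.
rewrite E; have := sqr_ge0 (p * x + q * y); have : 0 < r * T by rewrite mulr_gt0.
lra.
Qed.

Let fourier2_qcap_k2 p q r T B k1 k2 w : 0 < p -> 0 < p * r - q ^+ 2 -> 0 < T -> 0 <= B ->
  (forall x y, B <= `|x| \/ B <= `|y| -> T <= qform p q r x y) -> k2 != 0 ->
  oint (fun x => oint (fun y => qcap p q r T x y * cos (w * (k1 * x + k2 * y))) (- B) B) (- B) B =
  4 / 3 * T ^+ 2 / Num.sqrt (p * r - q ^+ 2) *
    bess (w * Num.sqrt (T * qform p q r k2 (- k1) / (p * r - q ^+ 2))).
Proof.
move=> p0 D0 T0 B0 HB k20; have [kp|kn] := ltP 0 k2; first exact: oint_qcap_wave.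
have kn' : 0 < - k2 by rewrite oppr_gt0 lt_neqAle k20.
have -> : qform p q r k2 (- k1) = qform p q r (- k2) (- - k1) by rewrite /qform; ring.
rewrite -(@oint_qcap_wave _ p q r T B (- k1) (- k2)) //; apply: eq_oint => x; apply: eq_oint => y.
by rewrite -cosN; congr (_ * cos _); ring.
Qed.

(** [oint_qcap_wave] needs a positive second component.  A negative one is reduced to it
by the parity of the cosine, and a zero one by exchanging the coordinates; the zero
frequency is a wave of pulsation 0 in the direction (0, 1). *)
Lemma fourier2_qcap p q r T B k1 k2 : 0 < p -> 0 < p * r - q ^+ 2 -> 0 < T -> 0 <= B ->
  (forall x y, B <= `|x| \/ B <= `|y| -> T <= qform p q r x y) ->
  fourier2 (qcap p q r T) B k1 k2 =
  4 / 3 * T ^+ 2 / Num.sqrt (p * r - q ^+ 2) *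
    bess (2 * pi * Num.sqrt (T * qform p q r k2 (- k1) / (p * r - q ^+ 2))).
Proof.
move=> p0 D0 T0 B0 HB; rewrite /fourier2.
have [k20|k20] := eqVneq k2 0; last exact: fourier2_qcap_k2.
have [k10|k10] := eqVneq k1 0.
  have -> : 2 * pi * Num.sqrt (T * qform p q r k2 (- k1) / (p * r - q ^+ 2)) =
    0 * Num.sqrt (T * qform p q r 1 (- 0) / (p * r - q ^+ 2)).
    by rewrite k10 k20 /qform !(mulr0, oppr0, expr0n, addr0, mul0r) sqrtr0 mulr0.
  rewrite -(@fourier2_qcap_k2 p q r T B 0 1 0) ?oner_eq0 //; apply: eq_oint => x; apply: eq_oint => y.
  by rewrite k10 k20 !(mul0r, addr0, mulr0).
have r0 : 0 < r by rewrite -(pmulr_rgt0 _ p0); have := sqr_ge0 q; lra.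
have -> : qform p q r k2 (- k1) = qform r q p k1 (- k2) by rewrite /qform; ring.
rewrite (mulrC p) in D0 *; rewrite -(@fourier2_qcap_k2 r q p T B k2 k1) //; last first.
  move=> x y H; have -> : qform r q p x y = qform p q r y x by rewrite /qform; ring.
  by apply: HB; case: H; [right|left].
rewrite -fubini; last by apply: lip2M; [exact: lip2_qcap|solve_lip].
apply: eq_oint => x; apply: eq_oint => y.
by rewrite qcap_swap; congr (_ * cos (_ * _)); ring.
Qed.

End EllipseFourier.

(** * Unordered sums *)

Section UnorderedSums.
Local Open Scope fset_scope.
Local Open Scope ring_scope.
Variables (R : realType) (T : choiceType).
Implicit Types (S : set T) (f g : T -> R) (X Y Z : {fset T}) (l e C : R).

Definition inside S X := forall x, x \in X -> S x.

Definition abs_summable S f :=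
  exists C, forall Y, inside S Y -> \sum_(y <- Y) `|f y| <= C.

(** Convergence along the net of finite subsets.  An absolutely summable family
converges to its [rsum] in this sense, in which linear operations and bounds are
immediate. *)
Definition is_sum S f l := forall e, 0 < e -> exists2 X, inside S X &
  forall Y, X `<=` Y -> inside S Y -> `|\sum_(y <- Y) f y - l| <= e.

Lemma inside0 S : inside S fset0.
Proof. by move=> x; rewrite inE. Qed.

Lemma insideU S X Y : inside S X -> inside S Y -> inside S (X `|` Y).
Proof. by move=> HX HY x; rewrite inE => /orP[/HX|/HY]. Qed.

Lemma sum_fsetD X Y f : X `<=` Y ->
  \sum_(y <- Y) f y = \sum_(y <- X) f y + \sum_(y <- Y `\` X) f y.
Proof.
move=> XY; rewrite -big_cat; apply: perm_big; apply: uniq_perm.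
- exact: fset_uniq.
- rewrite cat_uniq !fset_uniq /= andbT; apply/hasPn => x.
  by rewrite inE => /andP[].
move=> x; rewrite mem_cat inE; have [xX|] := boolP (x \in X) => //=.
by rewrite (fsubsetP XY).
Qed.

Lemma le_sum_fset X Y f : (forall x, 0 <= f x) -> X `<=` Y ->
  \sum_(y <- X) f y <= \sum_(y <- Y) f y.
Proof. by move=> f0 XY; rewrite (sum_fsetD f XY) lerDl sumr_ge0. Qed.

Lemma abs_summable_le S f g K : 0 <= K -> (forall x, S x -> `|f x| <= K * `|g x|) ->
  abs_summable S g -> abs_summable S f.
Proof.
move=> K0 H [C HC]; exists (K * C) => Y YS.
apply: (@le_trans _ _ (K * \sum_(y <- Y) `|g y|)); last by rewrite ler_wpM2l // HC.
by rewrite mulr_sumr big_seq [leRHS]big_seq; apply: ler_sum => y /YS /H.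
Qed.

(** The extended sum is the supremum of the finite partial sums, and these increase. *)
Lemma is_sum_ge0 S f : (forall x, 0 <= f x) -> abs_summable S f ->
  is_sum S f (fine (\esum_(n in S) (f n)%:E)%E) /\ (0 <= \esum_(n in S) (f n)%:E)%E /\
  (\esum_(n in S) (f n)%:E)%E \is a fin_num.
Proof.
move=> f0 [C HC]; set E := (\esum_(n in S) _)%E.
have sumE X : \sum_(i \in [set` X]) (f i)%:E = (\sum_(i <- X) f i)%:E.
  by rewrite fsbig_finite //= set_fsetK sumEFin.
have ub X : inside S X -> ((\sum_(i <- X) f i)%:E <= E)%E.
  move=> XS; apply: esum_ge; exists [set` X]; last by rewrite sumE.
  by split => // x /= /XS.
have E0 : (0 <= E)%E by have := ub fset0 (@inside0 S); rewrite big_nil.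
have EC : (E <= C%:E)%E.
  apply: ge_ereal_sup => _ [A [Af AS] <-].
  rewrite fsbig_finite //= sumEFin lee_fin.
  rewrite (eq_bigr (fun i => `|f i|)) => [|i _]; last by rewrite ger0_norm.
  apply: HC => x; rewrite in_fset_set // => /set_mem; exact: AS.
have Efin : E \is a fin_num.
  by rewrite ge0_fin_numE // (le_lt_trans EC) // ltry.
split; last by split.
move=> e e0; have [_ [A [Af AS] <-]] := ub_ereal_sup_adherent e0 Efin.
rewrite fsbig_finite //= sumEFin -/(esum _ _) -/E => h.
have Xin : inside S (fset_set A) by move=> x; rewrite in_fset_set // => /set_mem; exact: AS.
exists (fset_set A) => // Y XY YS.
have := ub Y YS; have := le_sum_fset f0 XY; move: h.
rewrite -(fineK Efin) -EFinB lte_fin lee_fin => h1 h2 h3.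
rewrite ler_norml; apply/andP; split; lra.
Qed.

Lemma is_sumB S f g l k : is_sum S f l -> is_sum S g k ->
  is_sum S (fun x => f x - g x) (l - k).
Proof.
move=> Hf Hg e e0; have [|X XS HX] := Hf (e / 2); first lra.
have [|Z ZS HZ] := Hg (e / 2); first lra.
exists (X `|` Z) => [|Y XZY YS]; first exact: insideU.
have := HX Y (fsubset_trans (fsubsetUl _ _) XZY) YS.
have := HZ Y (fsubset_trans (fsubsetUr _ _) XZY) YS.
rewrite sumrB !ler_norml => /andP[? ?] /andP[? ?]; apply/andP; split; lra.
Qed.

Lemma is_sumZ S f l k : is_sum S f l -> is_sum S (fun x => k * f x) (k * l).
Proof.
move=> Hf e e0; have k0 : 0 < `|k| + 1 by rewrite ltr_wpDl.
have [|X XS HX] := Hf (e / (`|k| + 1)); first by rewrite divr_gt0.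
exists X => // Y XY YS; rewrite -mulr_sumr -mulrBr normrM.
apply: (@le_trans _ _ (`|k| * (e / (`|k| + 1)))); first by rewrite ler_wpM2l // HX.
by rewrite mulrCA ler_piMr ?(ltW e0) // ler_pdivrMr // mul1r lerDl.
Qed.

Lemma is_sum0 S : is_sum S (fun=> 0) 0.
Proof. by move=> e e0; exists fset0 => // Y _ _; rewrite big1 // subrr normr0 ltW. Qed.

Lemma is_sumN S f l : is_sum S f l -> is_sum S (fun x => - f x) (- l).
Proof.
move=> /(is_sumB (@is_sum0 S)); rewrite sub0r.
by rewrite (_ : (fun _ => _) = fun x => - f x) //; apply/funext => x; rewrite sub0r.
Qed.

Lemma is_sumD S f g l k : is_sum S f l -> is_sum S g k ->
  is_sum S (fun x => f x + g x) (l + k).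
Proof.
move=> Hf /is_sumN /(is_sumB Hf); rewrite opprK.
by rewrite (_ : (fun _ => _) = fun x => f x + g x) //; apply/funext => x; rewrite opprK.
Qed.

Lemma is_sum_sum S n (f : 'I_n -> T -> R) (l : 'I_n -> R) :
  (forall i, is_sum S (f i) (l i)) -> is_sum S (fun x => \sum_i f i x) (\sum_i l i).
Proof.
elim: n f l => [|n IH] f l H.
  rewrite big_ord0 (_ : (fun _ => _) = fun=> 0); first exact: is_sum0.
  by apply/funext => x; rewrite big_ord0.
rewrite big_ord_recr (_ : (fun _ => _) =
  fun x => \sum_(i < n) f (widen_ord (leqnSn n) i) x + f ord_max x).
  by apply: is_sumD; [exact: IH|exact: H].
by apply/funext => x; rewrite big_ord_recr.
Qed.

Lemma eq_is_sum S f g l : (forall x, S x -> f x = g x) -> is_sum S f l -> is_sum S g l.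
Proof.
move=> fg Hf e /Hf[X XS HX]; exists X => // Y XY YS.
have -> : \sum_(y <- Y) g y = \sum_(y <- Y) f y.
  by rewrite big_seq [RHS]big_seq; apply: eq_bigr => y /YS /fg.
exact: HX.
Qed.

Lemma is_sum_bound S f l C : is_sum S f l ->
  (forall Y, inside S Y -> `|\sum_(y <- Y) f y| <= C) -> `|l| <= C.
Proof.
move=> Hf HC; apply/ler_addgt0Pr => e e0; have [X XS HX] := Hf e e0.
have := HX X (fsubset_refl _) XS; have := HC X XS.
move: (\sum_(y <- X) f y) => s; rewrite !ler_norml => /andP[? ?] /andP[? ?].
apply/andP; split; lra.
Qed.

Lemma is_sum_unique S f l k : is_sum S f l -> is_sum S f k -> l = k.
Proof.
move=> Hl Hk; apply/eqP; rewrite -subr_eq0 -normr_le0.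
apply: (is_sum_bound (is_sumB Hl Hk)) => Y _.
by rewrite big1 ?normr0 // => y _; rewrite subrr.
Qed.

(** The bridge between the sum by positive and negative parts and the net of finite
sums. *)
Lemma rsum_is_sum S f : abs_summable S f -> is_sum S f (rsum S f).
Proof.
move=> Hf; pose fp x := Num.max (f x) 0; pose fn x := Num.max (- f x) 0.
have p0 x : 0 <= fp x by rewrite le_max lexx orbT.
have n0 x : 0 <= fn x by rewrite le_max lexx orbT.
have pf x : `|fp x| <= 1 * `|f x|.
  by rewrite mul1r ger0_norm // ge_max ler_norm normr_ge0.
have nf x : `|fn x| <= 1 * `|f x|.
  by rewrite mul1r ger0_norm // ge_max -normrN ler_norm normr_ge0.
have [Hp [Ep0 Epf]] := is_sum_ge0 p0 (abs_summable_le ler01 (fun x _ => pf x) Hf).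
have [Hn [En0 Enf]] := is_sum_ge0 n0 (abs_summable_le ler01 (fun x _ => nf x) Hf).
have -> : rsum S f = fine (\esum_(n in S) (fp n)%:E)%E - fine (\esum_(n in S) (fn n)%:E)%E.
  rewrite /rsum -fineB //; congr (fine (_ - _)%E); apply: eq_esum => x _.
    by rewrite funeposE /= /fp EFin_max.
  by rewrite funenegE /= /fn EFin_max.
apply: eq_is_sum (is_sumB Hp Hn) => x _; rewrite /fp /fn.
by have [|] := leP (f x) 0 => h; rewrite ?(max_l _ _) ?(max_r _ _); try lra;
  have [?|?] := leP (- f x) 0; lra.
Qed.

Lemma abs_summable_tail S f e : abs_summable S f -> 0 < e ->
  exists2 X, inside S X & forall Y, inside S Y -> Y `&` X = fset0 ->
  \sum_(y <- Y) `|f y| <= e.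
Proof.
move=> Hf e0; pose g x := `|f x|.
have Hg : abs_summable S g.
  by apply: (@abs_summable_le S g f 1) => // x _; rewrite mul1r /g normr_id.
have [H _] := is_sum_ge0 (fun x => normr_ge0 (f x)) Hg.
have [|X XS HX] := H (e / 2); first lra.
exists X => // Y YS YX; have h1 := HX X (fsubset_refl _) XS.
have := HX (X `|` Y) (fsubsetUl _ _) (insideU XS YS).
rewrite (sum_fsetD _ (fsubsetUl X Y)).
have -> : (X `|` Y) `\` X = Y.
  by rewrite fsetDUl fsetDv fset0U; apply/fsetDidPl; rewrite -fsetI_eq0 YX.
move: h1; rewrite !ler_norml => /andP[? ?] /andP[? ?]; lra.
Qed.

End UnorderedSums.

(** * Poisson summation in the plane *)

Section BoxAverages.
Local Open Scope fset_scope.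
Local Open Scope ring_scope.
Variable R : realType.
Implicit Types (f : 'rV[int]_2 -> R) (l e : R).

Definition latvec (a b : int) : 'rV[int]_2 := \row_i (if i == 0 then a else b).

Lemma latvec0 a b : latvec a b 0 0 = a. Proof. by rewrite mxE. Qed.
Lemma latvec1 a b : latvec a b 0 1 = b. Proof. by rewrite mxE. Qed.

Lemma rV2P (x y : 'rV[int]_2) : x 0 0 = y 0 0 -> x 0 1 = y 0 1 -> x = y.
Proof.
move=> h0 h1; apply/rowP => -[[|[|//]] hi].
  by rewrite (_ : Ordinal hi = 0) //; apply/val_inj.
by rewrite (_ : Ordinal hi = 1) //; apply/val_inj.
Qed.

Lemma sum_fset_seq (T : choiceType) (s : seq T) (g : T -> R) : uniq s ->
  \sum_(y <- [fset x in s]) g y = \sum_(y <- s) g y.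
Proof.
move=> us; apply: perm_big; apply: uniq_perm; [exact: fset_uniq|exact: us|].
by move=> x; rewrite !inE.
Qed.

Lemma card_initial N rho : (\sum_(i < N) (i < rho) = minn N rho)%N.
Proof.
elim: N => [|N IH]; first by rewrite big_ord0 min0n.
by rewrite big_ord_recr /= IH; case: ltnP; lia.
Qed.

Lemma card_final N rho : (\sum_(i < N) (N <= i + rho) = minn N rho)%N.
Proof.
rewrite -card_initial (reindex_inj rev_ord_inj); apply: eq_bigr => i _ /=.
by have := ltn_ord i; case: (ltnP i rho) => h1 h2; congr nat_of_bool; lia.
Qed.

(** The indices of a row or column of a box of size N that lie within rho of its ends. *)
Let edge N rho i := ((i < rho) || (N <= i + rho))%N.

Let sum_edge N rho : \sum_(i < N) (edge N rho i)%:R <= 2 * rho%:R :> R.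
Proof.
rewrite -natr_sum -natrM ler_nat.
apply: (@leq_trans (\sum_(i < N) ((i < rho) + (N <= i + rho)))%N).
  by apply: leq_sum => i _; rewrite /edge; case: (i < rho)%N; case: (N <= i + rho)%N.
by rewrite big_split /= card_initial card_final; lia.
Qed.

(** For each u the inner sum is a partial sum of f over a box.  Unless u lies within rho
of the boundary of its own box, that partial sum contains the finite set beyond which
the partial sums are within e/2 of l.  The exceptional u are O(N) in number out of N^2,
and each costs at most 2C. *)
Lemma box_average_cvg f l e : abs_summable setT f -> is_sum setT f l -> 0 < e ->
  exists N0, forall N, (N0 <= N)%N -> (0 < N)%N ->
  `|N%:R^-1 ^+ 2 * (\sum_(u : 'I_N * 'I_N) \sum_(v : 'I_N * 'I_N)
     f (latvec (Posz u.1 - Posz v.1) (Posz u.2 - Posz v.2))) - l| <= e.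
Proof.
move=> [C HC] fl e0.
have C0 : 0 <= C by have := HC fset0; rewrite big_nil; apply.
have HC' (Y : {fset 'rV[int]_2}) : `|\sum_(y <- Y) f y| <= C.
  by apply: le_trans (ler_norm_sum _ _ _) _; apply: HC.
have lC : `|l| <= C by apply: is_sum_bound fl _ => Y _.
have [|X _ HX] := fl (e / 2); first lra.
pose rho := (\sum_(x <- X) (`|x 0%R 0%R| + `|x 0%R 1%R|)).+1%N.
have rhoP x : x \in X -> (`|x 0%R 0%R| < rho)%N /\ (`|x 0%R 1%R| < rho)%N.
  move=> xX; rewrite /rho (big_fsetD1 x) //=.
  by move: (\sum_(y <- X `\ x) _)%N => s; lia.
exists (Num.bound (16 * C * rho%:R / e)) => N NN N0.
have n0 : 0 < N%:R :> R by rewrite ltr0n.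
have nN : 16 * C * rho%:R / e <= N%:R.
  apply: le_trans (ltW (archi_boundP _)) _; last by rewrite ler_nat.
  by rewrite divr_ge0 ?mulr_ge0 // ltW.
pose S (u : 'I_N * 'I_N) := \sum_(v : 'I_N * 'I_N)
  f (latvec (Posz u.1 - Posz v.1) (Posz u.2 - Posz v.2)).
have HS u : `|S u - l| <= e / 2 + 2 * C * ((edge N rho u.1)%:R + (edge N rho u.2)%:R).
  pose h (v : 'I_N * 'I_N) := latvec (Posz u.1 - Posz v.1) (Posz u.2 - Posz v.2).
  have hinj : injective h.
    move=> [v1 v2] [w1 w2] hvw.
    have := congr1 (fun x : 'rV[int]_2 => x 0 0) hvw.
    have := congr1 (fun x : 'rV[int]_2 => x 0 1) hvw.
    rewrite !latvec0 !latvec1 /= => h1 h2.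
    by congr (_, _); apply: val_inj => /=; lia.
  pose Y := [fset x in [seq h v | v <- index_enum ('I_N * 'I_N)%type]].
  have SE : S u = \sum_(y <- Y) f y.
    rewrite sum_fset_seq ?big_map // map_inj_uniq //; exact: index_enum_uniq.
  rewrite SE; have [good|bad] := boolP (~~ edge N rho u.1 && ~~ edge N rho u.2).
    move: good => /andP[/negbTE g1 /negbTE g2]; rewrite g1 g2 addr0 mulr0 addr0.
    apply: HX => //; apply/fsubsetP => x /rhoP[x0 x1]; rewrite inE /=.
    have v1 : (`|Posz u.1 - x 0%R 0%R| < N)%N.
      by move: g1; rewrite /edge; have := ltn_ord u.1; lia.
    have v2 : (`|Posz u.2 - x 0%R 1%R| < N)%N.
      by move: g2; rewrite /edge; have := ltn_ord u.2; lia.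
    apply/mapP; exists (Ordinal v1, Ordinal v2); first exact: mem_index_enum.
    move: g1 g2; rewrite /edge => g1 g2.
    have ge0 (a : nat) (b : int) : (`|b| < rho)%N -> ((a < rho) || (N <= a + rho))%N = false ->
        0 <= Posz a - b.
      by move=> b0 a0; rewrite subr_ge0 (le_trans (lez_abs b)) // lez_nat; lia.
    by apply: rV2P; rewrite ?latvec0 ?latvec1 /= gez0_abs ?subKr // ge0.
  apply: (@le_trans _ _ (2 * C)).
    by apply: le_trans (ler_normB _ _) _; have := HC' Y; lra.
  have : 1 <= (edge N rho u.1)%:R + (edge N rho u.2)%:R :> R.
    by move: bad; rewrite negb_and !negbK -natrD ler1n; case: edge; case: edge.
  move: (_ + _ : R) => z z1; have : 2 * C * 1 <= 2 * C * z by rewrite ler_wpM2l ?mulr_ge0.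
  lra.
have cardN : \sum_(u : 'I_N * 'I_N) l = N%:R ^+ 2 * l.
  by rewrite sumr_const card_prod card_ord -(mulr_natl l) natrM expr2.
have edges : \sum_(u : 'I_N * 'I_N) ((edge N rho u.1)%:R + (edge N rho u.2)%:R) <=
    4 * rho%:R * N%:R :> R.
  rewrite -(pair_bigA _ (fun i j : 'I_N => (edge N rho i)%:R + (edge N rho j)%:R : R)) /=.
  set s := \sum_(i < N) (edge N rho i)%:R : R.
  have s2 : s <= 2 * rho%:R by exact: sum_edge.
  have -> : \sum_(i < N) \sum_(j < N) ((edge N rho i)%:R + (edge N rho j)%:R) =
      2 * N%:R * s :> R.
    under eq_bigr => i _ do rewrite big_split /= sumr_const card_ord -/s.
    rewrite big_split /= sumr_const card_ord -(mulr_natl s).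
    rewrite (eq_bigr (fun i : 'I_N => N%:R * (edge N rho i)%:R)) => [|i _]; last by rewrite mulr_natl.
    by rewrite -mulr_sumr -/s; ring.
  rewrite (_ : 4 * _ * _ = 2 * N%:R * (2 * rho%:R)); last by ring.
  by rewrite ler_wpM2l ?mulr_ge0 // ltW.
have -> : N%:R^-1 ^+ 2 * (\sum_u S u) - l = N%:R^-1 ^+ 2 * \sum_u (S u - l).
  by rewrite sumrB cardN mulrBr mulrA -exprMn mulVf ?expr1n ?mul1r // gt_eqF.
rewrite normrM ger0_norm ?exprn_ge0 ?invr_ge0 ?(ltW n0) //.
rewrite exprVn ler_pdivrMl ?exprn_gt0 //.
apply: le_trans (ler_norm_sum _ _ _) _.
apply: le_trans (ler_sum _ (fun u _ => HS u)) _.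
rewrite big_split /= sumr_const card_prod card_ord -(mulr_natl (e / 2)) natrM -mulr_sumr.
move: nN; rewrite ler_pdivrMr // => nN.
have : 2 * C * \sum_(u : 'I_N * 'I_N) ((edge N rho u.1)%:R + (edge N rho u.2)%:R) <=
    2 * C * (4 * rho%:R * N%:R) :> R by rewrite ler_wpM2l // mulr_ge0.
have : N%:R * (16 * C * rho%:R) <= N%:R * (N%:R * e) by rewrite ler_wpM2l // ltW.
rewrite expr2; lra.
Qed.

(** The integral of F against the product of Fejer kernels is close to the left-hand side
by [fejer_plane], and to l by [fejer_plane_expand] and [box_average_cvg]. *)
Theorem poisson_plane (F : R -> R -> R) (M : nat) l : lip2 F ->
  let W (n : 'rV[int]_2) := fourier2 F (M%:R + 1 / 2) (n 0 0)%:~R (n 0 1)%:~R in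
  abs_summable setT W -> is_sum setT W l ->
  \sum_(i < M.*2.+1) \sum_(j < M.*2.+1) F (i%:R - M%:R) (j%:R - M%:R) = l.
Proof.
move=> Fl W Wa Wl; apply/eqP; rewrite -subr_eq0 -normr_le0.
apply/ler_addgt0Pr => e e0; rewrite add0r.
have e2 : 0 < e / 2 by lra.
have [N1 H1] := fejer_plane M Fl e2.
have [N2 H2] := box_average_cvg Wa Wl e2.
pose N := (N1 + N2).+1.
have {H1} := H1 N _ _; have {H2} := H2 N _ _.
rewrite fejer_plane_expand //.
have -> : \sum_(u : 'I_N * 'I_N) \sum_(v : 'I_N * 'I_N)
     W (latvec (Posz u.1 - Posz v.1) (Posz u.2 - Posz v.2)) =
   \sum_(u : 'I_N * 'I_N) \sum_(v : 'I_N * 'I_N)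
     fourier2 F (M%:R + 1 / 2) (u.1%:R - v.1%:R) (u.2%:R - v.2%:R).
  by apply: eq_bigr => u _; apply: eq_bigr => v _; rewrite /W latvec0 latvec1 !rmorphB.
move: (_ * _) => z h1 h2.
have {}h1 := h1 (leqW (leq_addl _ _)) isT; have {}h2 := h2 (leqW (leq_addr _ _)) isT.
move: h1 h2; rewrite !ler_norml => /andP[? ?] /andP[? ?]; apply/andP; split; lra.
Qed.

End BoxAverages.

(** * The averaged lattice point count *)

Section StepIntegrals.
Local Open Scope fset_scope.
Local Open Scope ring_scope.
Variable R : realType.
Local Notation mu := (@lebesgue_measure R).

Lemma Rintegral_step (T c : R) : 0 < T -> 0 <= c ->
  mu.-integrable `[0, T] (EFin \o (fun t => ((c <= t)%R : nat)%:R)) /\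
  \int[mu]_(t in `[0, T]) ((c <= t)%R : nat)%:R = Num.max 0 (T - c).
Proof.
move=> T0 c0; pose g : R -> R := \1_`[c, T].
have gE t : t \in `[0, T] -> ((c <= t)%R : nat)%:R = g t :> R.
  by rewrite /g indicE mem_setE !in_itv /= => /andP[_ ->]; rewrite andbT.
split.
  apply: (@eq_integrable _ (measurableTypeR R) R lebesgue_measure _ _ (EFin \o g)) => //.
    by move=> t; rewrite mem_setE => tT; rewrite /= gE.
  apply: (@integrableS _ _ _ mu setT) => //.
  exact: (@integrable_indic_itv R c T true false).
rewrite (@eq_Rintegral _ (measurableTypeR R) R lebesgue_measure _ g); last by move=> t; rewrite mem_setE => /gE.
rewrite /Rintegral integral_indic //.
rewrite (_ : setI _ _ = `[c, T]%classic).
  transitivity (fine (lebesgue_measure ([set` `[c, T]] : set R))); first by [].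
  rewrite lebesgue_measure_itv /= lte_fin; case: ltP => h.
    by rewrite -EFinB /=; apply/esym/max_idPr; rewrite subr_ge0 ltW.
  by rewrite /=; apply/esym/max_idPl; rewrite subr_le0.
apply/seteqP; split => t /=; first by case.
rewrite !in_itv /= => /andP[ct tT]; split; rewrite ?ct //.
by rewrite tT (le_trans c0 ct).
Qed.

Lemma Rintegral_linear (T k : R) : 0 < T ->
  mu.-integrable `[0, T] (EFin \o (fun t => k * t)) /\
  \int[mu]_(t in `[0, T]) (k * t) = k * T ^+ 2 / 2.
Proof.
move=> T0; have kc : cont (fun t => k * t) by solve_cont.
have dF (t : R) : is_der t (fun t => k * t ^+ 2 / 2) (k * t).
  by apply: der_eq; [solve_der|rewrite /=; field].
have Fc := cont_der dF; split.
  apply: continuous_compact_integrable; first exact: segment_compact.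
  by apply: continuous_subspaceT; exact: kc.
rewrite /Rintegral (@continuous_FTC2 R (fun t => k * t) (fun t => k * t ^+ 2 / 2) 0 T T0).
- by rewrite -EFinB /=; field.
- by apply: continuous_subspaceT; exact: kc.
- split => [t _||]; first by have [] := dF t.
    by apply: cvg_at_right_filter; exact: Fc.
  by apply: cvg_at_left_filter; exact: Fc.
- by move=> t _; rewrite derive1E; have [_ ->] := dF t.
Qed.

End StepIntegrals.

Section LatticeCount.
Local Open Scope fset_scope.
Local Open Scope ring_scope.
Variables (R : realType) (v1 v2 : 'rV[R]_2) (a1 a2 : R).
Hypotheses (hv : orthonormal_basis v1 v2) (ha1 : 0 < a1) (ha2 : 0 < a2).
Implicit Types (n : 'rV[int]_2).

Lemma dotE (u w : 'rV[R]_2) : dot u w = u 0 0 * w 0 0 + u 0 1 * w 0 1.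
Proof.
rewrite /dot mxE big_ord_recl big_ord1 !mxE.
by rewrite (_ : lift ord0 ord0 = 1) //; apply/val_inj.
Qed.

Lemma latdotE n (w : 'rV[R]_2) : latdot n w = (n 0 0)%:~R * w 0 0 + (n 0 1)%:~R * w 0 1.
Proof. by rewrite /latdot dotE !mxE. Qed.

(** The coefficients of the form Q(x) = 4 pi^2 ((x.v1/a1)^2 + (x.v2/a2)^2). *)
Definition ellp : R := (2 * pi) ^+ 2 * ((v1 0 0 / a1) ^+ 2 + (v2 0 0 / a2) ^+ 2).
Definition ellq : R :=
  (2 * pi) ^+ 2 * (v1 0 0 * v1 0 1 / a1 ^+ 2 + v2 0 0 * v2 0 1 / a2 ^+ 2).
Definition ellr : R := (2 * pi) ^+ 2 * ((v1 0 1 / a1) ^+ 2 + (v2 0 1 / a2) ^+ 2).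

(** The form dual to Q, normalised as in the definition of g. *)
Definition dualsq n : R := (a1 * latdot n v1) ^+ 2 + (a2 * latdot n v2) ^+ 2.

(** In the plane v2 is v1 turned by a right angle, up to the sign d of the basis. *)
Lemma orthonormal_coords : exists2 d, d ^+ 2 = 1 &
  [/\ v2 0 0 = - d * v1 0 1, v2 0 1 = d * v1 0 0 & v1 0 0 ^+ 2 + v1 0 1 ^+ 2 = 1].
Proof.
case: hv; rewrite !dotE; set a := v1 0 0; set b := v1 0 1; set c := v2 0 0; set e := v2 0 1.
move=> h1 h2 h3; exists (a * e - b * c).
  transitivity ((a * a + b * b) * (c * c + e * e) - (a * c + b * e) ^+ 2); first ring.
  by rewrite h1 h2 h3; ring.
split; last by rewrite -h1; ring.
  transitivity (c * (a * a + b * b) - a * (a * c + b * e)); last by ring.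
  by rewrite h1 h3; ring.
transitivity (e * (a * a + b * b) - b * (a * c + b * e)); last by ring.
by rewrite h1 h3; ring.
Qed.

Let an1 : a1 != 0. Proof. exact: lt0r_neq0. Qed.
Let an2 : a2 != 0. Proof. exact: lt0r_neq0. Qed.
Let pi0 : 0 < pi :> R := pi_gt0 R.

Lemma ell_disc : ellp * ellr - ellq ^+ 2 = ((2 * pi) ^+ 2 / (a1 * a2)) ^+ 2.
Proof.
have [d d2 [e1 e2 u1]] := orthonormal_coords.
rewrite /ellp /ellq /ellr e1 e2.
transitivity (d ^+ 2 * (v1 0 0 ^+ 2 + v1 0 1 ^+ 2) ^+ 2 * ((2 * pi) ^+ 2 / (a1 * a2)) ^+ 2).
  by field; rewrite an1 an2.
by rewrite d2 u1; ring.
Qed.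

Lemma sqrt_ell_disc : Num.sqrt (ellp * ellr - ellq ^+ 2) = (2 * pi) ^+ 2 / (a1 * a2).
Proof. by rewrite ell_disc sqrtr_sqr ger0_norm // divr_ge0 ?sqr_ge0 // mulr_ge0 // ltW. Qed.

Lemma ell_disc_gt0 : 0 < ellp * ellr - ellq ^+ 2.
Proof. by rewrite ell_disc !(exprn_gt0, divr_gt0, mulr_gt0). Qed.

Lemma ellp_gt0 : 0 < ellp.
Proof.
have [d d2 [e1 _ u1]] := orthonormal_coords.
rewrite mulr_gt0 ?exprn_gt0 ?mulr_gt0 // lt_neqAle addr_ge0 ?sqr_ge0 // andbT eq_sym.
rewrite paddr_eq0 ?sqr_ge0 // !sqrf_eq0 !mulf_eq0 !invr_eq0 (negbTE an1) (negbTE an2) !orbF.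
apply/negP => /andP[/eqP z1]; rewrite e1 mulNr oppr_eq0 mulf_eq0 => /orP[] /eqP z2.
  by move: d2; rewrite z2 expr0n /= => /eqP; rewrite eq_sym oner_eq0.
by move: u1; rewrite z1 z2 expr0n /= addr0 => /eqP; rewrite eq_sym oner_eq0.
Qed.

Lemma qform_ell_ge0 x y : 0 <= qform ellp ellq ellr x y.
Proof.
rewrite -(pmulr_rge0 _ ellp_gt0).
have -> : ellp * qform ellp ellq ellr x y =
  (ellp * ellr - ellq ^+ 2) * y ^+ 2 + (ellp * x + ellq * y) ^+ 2 by rewrite /qform; ring.
by rewrite addr_ge0 ?sqr_ge0 // mulr_ge0 ?sqr_ge0 // ltW // ell_disc_gt0.
Qed.

Lemma qform_dual n : qform ellp ellq ellr (n 0 1)%:~R (- (n 0 0)%:~R) =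
  ((2 * pi) / (a1 * a2)) ^+ 2 * dualsq n.
Proof.
have [d d2 [e1 e2 _]] := orthonormal_coords.
rewrite /qform /ellp /ellq /ellr /dualsq !latdotE e1 e2.
move: (v1 0 0) (v1 0 1) ((n 0 0)%:~R) ((n 0 1)%:~R) => a b k l.
transitivity ((2 * pi) ^+ 2 * (((l * a - k * b) / a1) ^+ 2 + d ^+ 2 * ((k * a + l * b) / a2) ^+ 2)).
  by field; rewrite an1 an2.
rewrite d2.
transitivity ((2 * pi / (a1 * a2)) ^+ 2 * ((a1 * (k * a + l * b)) ^+ 2 + d ^+ 2 * (a2 * (l * a - k * b)) ^+ 2)).
  by rewrite d2; field; rewrite an1 an2.
by ring.
Qed.

Lemma qform_lattice n : qform ellp ellq ellr (n 0 0)%:~R (n 0 1)%:~R =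
  (2 * pi) ^+ 2 * ((latdot n v1 / a1) ^+ 2 + (latdot n v2 / a2) ^+ 2).
Proof.
by rewrite /qform /ellp /ellq /ellr !latdotE; field; rewrite an1 an2.
Qed.

Lemma lattice_pointsE t n : 0 <= t ->
  lattice_points v1 v2 a1 a2 t n = (qform ellp ellq ellr (n 0 0)%:~R (n 0 1)%:~R <= t) :> Prop.
Proof.
move=> t0; rewrite qform_lattice /lattice_points /=.
set z := _ + _; have z0 : 0 <= z by rewrite addr_ge0 ?sqr_ge0.
have p2 : 0 < 2 * pi :> R by rewrite mulr_gt0.
congr is_true; rewrite ler_pdivlMr // -{1}(ger0_norm (ltW p2)) -sqrtr_sqr -sqrtrM //.
by rewrite ler_sqrt // mulrC.
Qed.

Lemma dualsq_lower : exists2 m, 0 < m & forall n,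
  m * ((n 0 0)%:~R ^+ 2 + (n 0 1)%:~R ^+ 2) <= dualsq n.
Proof.
exists (Num.min (a1 ^+ 2) (a2 ^+ 2)) => [|n].
  by rewrite lt_min !exprn_gt0.
have [d d2 [e1 e2 u1]] := orthonormal_coords.
have E : (n 0 0)%:~R ^+ 2 + (n 0 1)%:~R ^+ 2 = latdot n v1 ^+ 2 + latdot n v2 ^+ 2.
  rewrite !latdotE e1 e2; move: ((n 0 0)%:~R) ((n 0 1)%:~R) => k l.
  transitivity ((v1 0 0 ^+ 2 + v1 0 1 ^+ 2) * (k ^+ 2 + l ^+ 2)); first by rewrite u1 mul1r.
  transitivity ((k * v1 0 0 + l * v1 0 1) ^+ 2 + d ^+ 2 * (l * v1 0 0 - k * v1 0 1) ^+ 2).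
    by rewrite d2; ring.
  by ring.
rewrite E /dualsq !exprMn mulrDr; apply: lerD; rewrite ler_wpM2r ?sqr_ge0 //.
  by rewrite ge_min lexx.
by rewrite ge_min lexx orbT.
Qed.

(** For t <= T all the points counted lie in one box that does not depend on t, so that
N(t) is a finite sum of step functions of t. *)
Lemma count_box (M : nat) (T t : R) : 0 <= t <= T ->
  (forall x y : R, M%:R <= `|x| \/ M%:R <= `|y| -> T + 1 <= qform ellp ellq ellr x y) ->
  (Ncount v1 v2 a1 a2 t)%:R = \sum_(u : 'I_(M.*2.+1) * 'I_(M.*2.+1))
    ((qform ellp ellq ellr (u.1%:R - M%:R) (u.2%:R - M%:R) <= t)%R : nat)%:R :> R.
Proof.
move=> /andP[t0 tT] HM.
pose h (u : 'I_(M.*2.+1) * 'I_(M.*2.+1)) := latvec (Posz u.1 - Posz M) (Posz u.2 - Posz M).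
pose P (u : 'I_(M.*2.+1) * 'I_(M.*2.+1)) := qform ellp ellq ellr (u.1%:R - M%:R) (u.2%:R - M%:R) <= t.
have hinj : injective h.
  move=> [i1 i2] [j1 j2] hij.
  have := congr1 (fun x : 'rV[int]_2 => x 0 0) hij.
  have := congr1 (fun x : 'rV[int]_2 => x 0 1) hij.
  rewrite !latvec0 !latvec1 /= => h1 h2.
  by congr (_, _); apply: val_inj => /=; lia.
have PE u : P u = (qform ellp ellq ellr (h u 0 0)%:~R (h u 0 1)%:~R <= t).
  by rewrite /P latvec0 latvec1 !rmorphB.
pose s := [seq h u | u <- index_enum ('I_(M.*2.+1) * 'I_(M.*2.+1))%type & P u].
have us : uniq s by rewrite map_inj_uniq // filter_uniq // index_enum_uniq.
have LE : lattice_points v1 v2 a1 a2 t = [set` [fset x in s]].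
  apply/seteqP; split => n /=; rewrite lattice_pointsE //; last first.
    by rewrite inE => /mapP[u]; rewrite mem_filter => /andP[Pu _] ->; rewrite -PE.
  move=> qn.
  have bd : (`|n 0%R 0%R| < M)%N /\ (`|n 0%R 1%R| < M)%N.
    have lt1 : t < T + 1 by lra.
    split; rewrite ltnNge; apply/negP => h1.
      have : T + 1 <= t.
        by apply: le_trans qn; apply: HM; left; rewrite -intr_norm -abszE (pmulrn 1 M) ler_int lez_nat.
      lra.
    have : T + 1 <= t.
      by apply: le_trans qn; apply: HM; right; rewrite -intr_norm -abszE (pmulrn 1 M) ler_int lez_nat.
    lra.
  have coord (b : int) : (`|b| < M)%N ->
      exists2 i : 'I_(M.*2.+1), True & Posz i - Posz M = b.
    move=> bM; have hi : (`|(b + Posz M)%R| < M.*2.+1)%N by lia.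
    by exists (Ordinal hi) => //=; rewrite gez0_abs ?addrK //; lia.
  have [[i _ hi] [j _ hj]] := (coord _ bd.1, coord _ bd.2).
  have nE : n = h (i, j) by apply: rV2P; rewrite ?latvec0 ?latvec1.
  rewrite inE nE; apply: map_f; rewrite mem_filter mem_index_enum andbT PE -nE //.
rewrite /Ncount LE set_fsetK.
have -> : #|` [fset x in s]| = size s.
  by rewrite card_fseq undup_id.
by rewrite size_map size_filter -sum1_count natr_sum big_mkcond /=; apply: eq_bigr => u _; rewrite -/(P u); case: (P u).
Qed.

(** The integral over [0, T] of the step at Q(n) is max(0, T - Q(n)). *)
Lemma Aavg_sum (M : nat) (T : R) : 0 < T ->
  (forall x y : R, M%:R <= `|x| \/ M%:R <= `|y| -> T + 1 <= qform ellp ellq ellr x y) ->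
  Aavg v1 v2 a1 a2 T = T^-1 * (\sum_(i < M.*2.+1) \sum_(j < M.*2.+1)
     qcap ellp ellq ellr T (i%:R - M%:R) (j%:R - M%:R) - a1 * a2 * T ^+ 2 / (8 * pi)).
Proof.
move=> T0 HM; rewrite /Aavg; congr (_ * _).
pose Q (u : 'I_(M.*2.+1) * 'I_(M.*2.+1)) :=
  qform ellp ellq ellr (u.1%:R - M%:R) (u.2%:R - M%:R).
have Q0 u : 0 <= Q u by exact: qform_ell_ge0.
rewrite (@eq_Rintegral _ (measurableTypeR R) R lebesgue_measure _ (fun t => \sum_u ((Q u <= t)%R : nat)%:R -
   a1 * a2 / (4 * pi) * t)); last first.
  move=> t; rewrite mem_setE in_itv /= => tT.
  by rewrite /Derr (count_box tT HM); congr (_ - _); ring.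
have [I1 E1] := Rintegral_linear (a1 * a2 / (4 * pi)) T0.
have I2 : (@lebesgue_measure R).-integrable `[0, T]
    (EFin \o (fun t => \sum_u ((Q u <= t)%R : nat)%:R)).
  apply: (@eq_integrable _ (measurableTypeR R) R lebesgue_measure _ _
    (fun t => \sum_u (((Q u <= t)%R : nat)%:R)%:E)) => //.
    by move=> t _; rewrite /= sumEFin.
  apply: integrable_sum => // u _; exact: (Rintegral_step T0 (Q0 u)).1.
rewrite RintegralB // E1; congr (_ - _); last first.
  by move: (pi : R) (lt0r_neq0 pi0) => z z0; field.
rewrite /Rintegral (@eq_integral _ (measurableTypeR R) R lebesgue_measure _ (fun t => \sum_u (((Q u <= t)%R : nat)%:R)%:E)); last first.
  by move=> t _; rewrite sumEFin.
rewrite integral_sum //; last by move=> u; exact: (Rintegral_step T0 (Q0 u)).1.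
rewrite (pair_bigA _ (fun i j : 'I_(M.*2.+1) => qcap ellp ellq ellr T (i%:R - M%:R) (j%:R - M%:R))) /=.
rewrite (eq_bigr (fun u => (Num.max 0 (T - Q u))%:E)) => [|u _]; first by rewrite sumEFin.
rewrite -(Rintegral_step T0 (Q0 u)).2 /Rintegral fineK //.
by apply: integrable_fin_num => //; exact: (Rintegral_step T0 (Q0 u)).1.
Qed.

End LatticeCount.

(** * Summability over the lattice *)

Section FourthRootWeights.
Local Open Scope fset_scope.
Local Open Scope ring_scope.
Variable R : realType.

(** (k + 1)^(1/4). *)
Definition root4 (k : nat) : R := Num.sqrt (Num.sqrt k.+1%:R).
Definition wt (k : nat) : R := (root4 k)^-1 ^+ 5.

Lemma root4X k : root4 k ^+ 4 = k.+1%:R.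
Proof.
rewrite (_ : root4 k ^+ 4 = (root4 k ^+ 2) ^+ 2); last by ring.
by rewrite !sqr_sqrtr ?sqrtr_ge0 ?ler0n.
Qed.

Lemma root4_gt0 k : 0 < root4 k.
Proof. by rewrite !sqrtr_gt0 ltr0n. Qed.

Lemma wt_ge0 k : 0 <= wt k.
Proof. by rewrite exprn_ge0 // invr_ge0 ltW // root4_gt0. Qed.

(** A discrete form of the integral test for (1 + k)^(-5/4), whose primitive is
-4 (1 + k)^(-1/4). *)
Lemma wt_telescope k : wt k.+1 <= 4 * ((root4 k)^-1 - (root4 k.+1)^-1).
Proof.
rewrite /wt; have := root4_gt0 k; have := root4_gt0 k.+1.
have := root4X k; have := root4X k.+1; move: (root4 k) (root4 k.+1) => a b Eb Ea b0 a0.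
have E : b ^+ 4 - a ^+ 4 = 1 by rewrite Ea Eb -natr1; ring.
have ab : a <= b.
  rewrite leNgt; apply/negP => h; have : b ^+ 4 <= a ^+ 4 by rewrite lerXn2r ?nnegrE ?ltW.
  by rewrite -subr_ge0 -opprB E oppr_ge0 ler10.
have h1 : 1 <= 4 * b ^+ 3 * (b - a).
  apply: (@le_trans _ _ (b ^+ 4 - a ^+ 4)); first by rewrite E.
  rewrite (_ : b ^+ 4 - a ^+ 4 = (b ^+ 3 + b ^+ 2 * a + b * a ^+ 2 + a ^+ 3) * (b - a)); last by ring.
  rewrite ler_wpM2r ?subr_ge0 //.
  have b2 : b ^+ 2 * a <= b ^+ 3 by rewrite [leRHS]exprSr ler_wpM2l ?sqr_ge0.
  have b1 : b * a ^+ 2 <= b ^+ 3.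
    by rewrite [leRHS]exprS ler_wpM2l ?(ltW b0) // lerXn2r ?nnegrE ?(ltW a0) ?(ltW b0).
  have b3 : a ^+ 3 <= b ^+ 3 by rewrite lerXn2r ?nnegrE ?(ltW a0) ?(ltW b0).
  lra.
have -> : 4 * (a^-1 - b^-1) = 4 * b ^+ 3 * (b - a) * (a^-1 * b^-1 ^+ 4).
  by field; rewrite !lt0r_neq0.
apply: (@le_trans _ _ (1 * (a^-1 * b^-1 ^+ 4))).
  by rewrite mul1r exprS ler_wpM2r ?exprn_ge0 ?invr_ge0 ?(ltW b0) // lef_pV2 ?posrE.
by rewrite ler_wpM2r // mulr_ge0 ?exprn_ge0 ?invr_ge0 ?ltW.
Qed.

Lemma sum_wt K : \sum_(k < K.+1) wt k <= 5 - 4 * (root4 K)^-1.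
Proof.
elim: K => [|K IH].
  by rewrite big_ord_recl big_ord0 addr0 /wt /root4 !sqrtr1 invr1 expr1n; lra.
by rewrite big_ord_recr /=; have := wt_telescope K; lra.
Qed.

Lemma sum_wt5 K : \sum_(k < K) wt k <= 5.
Proof.
case: K => [|K]; first by rewrite big_ord0.
have := sum_wt K; have : 0 < (root4 K)^-1 by rewrite invr_gt0 root4_gt0.
lra.
Qed.

Lemma sum_wt_centered K : \sum_(i < K + K.+1) wt `|Posz i - Posz K| <= 10.
Proof.
rewrite big_split_ord /=.
have -> : \sum_(i < K) wt `|Posz i - Posz K| = \sum_(i < K) wt i.+1.
  rewrite (reindex_inj rev_ord_inj); apply: eq_bigr => i _ /=; congr wt.
  by have := ltn_ord i; lia.
have -> : \sum_(i < K.+1) wt `|Posz (K + i)%N - Posz K| = \sum_(i < K.+1) wt i.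
  by apply: eq_bigr => i _; congr wt; lia.
have h1 : \sum_(i < K) wt i.+1 <= 5.
  apply: le_trans (sum_wt5 K.+1); rewrite big_ord_recl /= lerDr wt_ge0 //.
have := sum_wt5 K.+1; lra.
Qed.

(** A product of two summable weights: any finite set is contained in a square. *)
Lemma abs_summable_wt (S : set 'rV[int]_2) :
  abs_summable S (fun n : 'rV[int]_2 => wt `|n 0%R 0%R| * wt `|n 0%R 1%R|).
Proof.
exists (10 * 10) => Y _; pose f (n : 'rV[int]_2) := wt `|n 0%R 0%R| * wt `|n 0%R 1%R|.
have f0 n : 0 <= f n by rewrite mulr_ge0 ?wt_ge0.
rewrite (eq_bigr f) => [|n _]; last exact: (ger0_norm (f0 n)).
pose K := (\sum_(x <- Y) (`|x 0%R 0%R| + `|x 0%R 1%R|))%N.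
have KP x : x \in Y -> (`|x 0%R 0%R| <= K)%N /\ (`|x 0%R 1%R| <= K)%N.
  move=> xX; rewrite /K (big_fsetD1 x) //=.
  by move: (\sum_(y <- Y `\ x) _)%N => s; lia.
pose h (u : 'I_(K + K.+1) * 'I_(K + K.+1)) := latvec (Posz u.1 - Posz K) (Posz u.2 - Posz K).
have hinj : injective h.
  move=> [i1 i2] [j1 j2] hij.
  have := congr1 (fun x : 'rV[int]_2 => x 0 0) hij.
  have := congr1 (fun x : 'rV[int]_2 => x 0 1) hij.
  rewrite !latvec0 !latvec1 /= => h1 h2.
  by congr (_, _); apply: val_inj => /=; lia.
pose Z := [fset x in [seq h u | u <- index_enum ('I_(K + K.+1) * 'I_(K + K.+1))%type]].
apply: (@le_trans _ _ (\sum_(n <- Z) f n)).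
  apply: le_sum_fset => //; apply/fsubsetP => x /KP[x0 x1]; rewrite inE /=.
  have coord (b : int) : (`|b| <= K)%N ->
      exists2 i : 'I_(K + K.+1), True & Posz i - Posz K = b.
    move=> bM; have hi : (`|(b + Posz K)%R| < K + K.+1)%N by lia.
    by exists (Ordinal hi) => //=; rewrite gez0_abs ?addrK //; lia.
  have [[i _ hi] [j _ hj]] := (coord _ x0, coord _ x1).
  have nE : x = h (i, j) by apply: rV2P; rewrite ?latvec0 ?latvec1.
  by rewrite nE; apply: map_f; exact: mem_index_enum.
rewrite sum_fset_seq ?big_map; last by rewrite map_inj_uniq // index_enum_uniq.
rewrite -(pair_bigA _ (fun i j : 'I_(K + K.+1) => f (h (i, j)))) /=.
rewrite (eq_bigr (fun i : 'I_(K + K.+1) => wt `|Posz i - Posz K| *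
  \sum_(j < K + K.+1) wt `|Posz j - Posz K|)) => [|i _]; last first.
  by rewrite mulr_sumr; apply: eq_bigr => j _; rewrite /f latvec0 latvec1.
rewrite -mulr_suml; apply: ler_pM; rewrite ?sum_wt_centered //;
  by apply: sumr_ge0 => i _; exact: wt_ge0.
Qed.

End FourthRootWeights.

Section DualNorm.
Local Open Scope fset_scope.
Local Open Scope ring_scope.
Variables (R : realType) (v1 v2 : 'rV[R]_2) (a1 a2 : R).
Hypotheses (hv : orthonormal_basis v1 v2) (ha1 : 0 < a1) (ha2 : 0 < a2).
Implicit Types (n : 'rV[int]_2).

Definition eta n : R := Num.sqrt (dualsq v1 v2 a1 a2 n).

Lemma int_sqr_le (b : int) : `|b%:~R : R| <= b%:~R ^+ 2.
Proof.
rewrite -intr_norm -rmorphXn /= ler_int -(real_normK (num_real b)) expr2.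
have [->|b0] := eqVneq b 0; first by rewrite normr0 mulr0.
by rewrite ler_peMr // -gtz0_ge1 normr_gt0.
Qed.

Lemma sqr_sum_ge1 n : n != 0 -> 1 <= (n 0 0)%:~R ^+ 2 + (n 0 1)%:~R ^+ 2 :> R.
Proof.
move=> n0; have h (b : int) : b != 0 -> 1 <= b%:~R ^+ 2 :> R.
  move=> b0; apply: le_trans (int_sqr_le b); rewrite -intr_norm -[1]/(1%:~R) ler_int.
  by rewrite -gtz0_ge1 normr_gt0.
have [z0|/h z0] := eqVneq (n 0 0) 0; last by have := sqr_ge0 ((n 0 1)%:~R : R); lra.
have [z1|/h z1] := eqVneq (n 0 1) 0; last by have := sqr_ge0 ((n 0 0)%:~R : R); lra.
by case/eqP: n0; apply: rV2P; rewrite mxE.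
Qed.

Lemma eta_lower : exists2 c, 0 < c & forall n, n != 0 -> c <= eta n.
Proof.
have [m m0 Hm] := dualsq_lower hv ha1 ha2; exists (Num.sqrt m) => [|n n0].
  by rewrite sqrtr_gt0.
rewrite ler_wsqrtr // (le_trans _ (Hm n)) // ler_peMr ?(ltW m0) //.
exact: sqr_sum_ge1.
Qed.

Lemma eta_gt0 n : n != 0 -> 0 < eta n.
Proof. by have [c c0 H] := eta_lower => /H; exact: lt_le_trans. Qed.

(** For n = (k, l) != 0 one has eta(n)^2 >= m (k^2 + l^2) >= m/4 (1 + |k|)(1 + |l|), and
eta^(-5/2) is the -5/4th power of the left-hand side. *)
Lemma eta_wt : exists2 C, 0 <= C & forall n, n != 0 ->
  (Num.sqrt (eta n))^-1 ^+ 5 <= C * (wt R `|n 0%R 0%R| * wt R `|n 0%R 1%R|).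
Proof.
have [m m0 Hm] := dualsq_lower hv ha1 ha2.
pose k := Num.sqrt (Num.sqrt (m / 4)).
have k0 : 0 < k by rewrite !sqrtr_gt0 divr_gt0.
have k4 : k ^+ 4 = m / 4.
  rewrite (_ : k ^+ 4 = (k ^+ 2) ^+ 2); last by ring.
  by rewrite !sqr_sqrtr ?sqrtr_ge0 // divr_ge0 // ltW.
exists (k^-1 ^+ 5) => [|n n0]; first by rewrite exprn_ge0 // invr_ge0 ltW.
have e0 := eta_gt0 n0; set s := Num.sqrt (eta n).
have s0 : 0 < s by rewrite sqrtr_gt0.
have d0 : 0 <= dualsq v1 v2 a1 a2 n by rewrite addr_ge0 ?sqr_ge0.
have s4 : s ^+ 4 = dualsq v1 v2 a1 a2 n.
  rewrite (_ : s ^+ 4 = (s ^+ 2) ^+ 2); last by ring.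
  by rewrite !sqr_sqrtr // ltW.
have r0 i := root4_gt0 R i; have r4 i := root4X R i.
rewrite /wt; set x := root4 R `|n 0%R 0%R|; set y := root4 R `|n 0%R 1%R|.
have x0 : 0 < x by exact: r0. have y0 : 0 < y by exact: r0.
have kxy0 : 0 < k * x * y by rewrite !mulr_gt0.
have le1 : k * x * y <= s.
  rewrite leNgt; apply/negP => h.
  have : s ^+ 4 < (k * x * y) ^+ 4 by rewrite ltrXn2r ?nnegrE ?ltW.
  rewrite !exprMn k4 s4 !r4 ltNge => /negP; apply; apply: le_trans (Hm n).
  rewrite -mulrA -mulrA ler_wpM2l ?(ltW m0) //.
  have := sqr_sum_ge1 n0.
  have absE (b : int) : (`|b|%N).+1%:R = `|b%:~R| + 1 :> R.
    by rewrite -natr1 (pmulrn 1 `|b|%N) abszE intr_norm.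
  rewrite !absE; have := int_sqr_le (n 0 0); have := int_sqr_le (n 0 1).
  rewrite -(real_normK (num_real (n 0 0)%:~R)) -(real_normK (num_real (n 0 1)%:~R)).
  move: (normr_ge0 ((n 0 0)%:~R : R)) (normr_ge0 ((n 0 1)%:~R : R)).
  move: `|(n 0 0)%:~R| `|(n 0 1)%:~R| => a b a0 b0 h1 h2 h3.
  have := sqr_ge0 (a - b); nra.
rewrite -!exprMn; apply: lerXn2r; rewrite ?nnegrE ?invr_ge0 ?(ltW s0) //.
  by rewrite !mulr_ge0 ?invr_ge0 ?ltW.
rewrite (_ : k^-1 * _ = (k * x * y)^-1); last by rewrite !invfM mulrA.
by rewrite lef_pV2 ?posrE.
Qed.

Lemma abs_summable_eta j (S := [set n : 'rV[int]_2 | n != 0]) :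
  abs_summable S (fun n => (Num.sqrt (eta n))^-1 ^+ 5 * (eta n)^-1 ^+ j).
Proof.
have [C C0 HC] := eta_wt; have [c c0 Hc] := eta_lower.
apply: (@abs_summable_le _ _ S _ _ (C * c^-1 ^+ j) _ _ (@abs_summable_wt R S)).
  by rewrite mulr_ge0 // exprn_ge0 // invr_ge0 ltW.
move=> n n0; have e0 := eta_gt0 n0.
rewrite !ger0_norm ?mulr_ge0 ?wt_ge0 ?exprn_ge0 ?invr_ge0 ?sqrtr_ge0 ?(ltW e0) //.
rewrite [leRHS]mulrAC; apply: ler_pM; rewrite ?exprn_ge0 ?invr_ge0 ?sqrtr_ge0 ?(ltW e0) ?HC //.
by rewrite lerXn2r ?nnegrE ?invr_ge0 ?(ltW e0) ?(ltW c0) // lef_pV2 ?posrE // Hc.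
Qed.

End DualNorm.

Section SumsWithOrigin.
Local Open Scope fset_scope.
Local Open Scope ring_scope.
Variable R : realType.
Local Notation S := [set n : 'rV[int]_2 | n != 0].

Lemma abs_summable_origin (f : 'rV[int]_2 -> R) : abs_summable S f -> abs_summable setT f.
Proof.
move=> [C HC]; exists (`|f 0| + C) => Y _.
have C0 : 0 <= C by have := HC fset0; rewrite big_nil; apply => x; rewrite inE.
have H : \sum_(y <- Y `\ 0) `|f y| <= C.
  by apply: HC => x; rewrite !inE => /andP[].
have [Y0|Y0] := boolP (0 \in Y); first by rewrite (big_fsetD1 0) //= lerD2l.
have -> : Y = Y `\ 0 by apply/esym/fsetDidPl; rewrite fdisjointX1.
by rewrite (le_trans H) // lerDr.
Qed.

Lemma is_sum_origin (f : 'rV[int]_2 -> R) l : is_sum S f l -> is_sum setT f (f 0 + l).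
Proof.
move=> Hf e /Hf[X XS HX]; exists (0 |` X) => [//|Y XY _].
have Y0 : 0 \in Y by apply: (fsubsetP XY); rewrite !inE eqxx.
rewrite (big_fsetD1 0) //= opprD addrACA subrr add0r.
apply: HX => [|x]; last by rewrite !inE => /andP[].
apply/fsubsetP => x xX; rewrite !inE (fsubsetP XY) ?inE ?xX ?orbT // andbT.
exact: XS.
Qed.

End SumsWithOrigin.

(** * Almost periodicity of series of waves *)

Section AlmostPeriodic.
Local Open Scope fset_scope.
Local Open Scope ring_scope.
Variable R : realType.

Lemma trig_polyD (p q : R -> R[i]) : trig_poly p -> trig_poly q ->
  trig_poly (fun x => p x + q x).
Proof.
move=> [d [c [lam Hp]]] [d' [c' [lam' Hq]]].
exists (d + d')%N, (fun k : 'I_(d + d') => match fintype.split k with inl i => c i | inr i => c' i end),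
  (fun k : 'I_(d + d') => match fintype.split k with inl i => lam i | inr i => lam' i end) => x.
rewrite Hp Hq big_split_ord /=; congr (_ + _); apply: eq_bigr => i _.
  by rewrite (unsplitK (inl i)).
by rewrite (unsplitK (inr i)).
Qed.

Lemma trig_poly0 : trig_poly (fun _ : R => 0).
Proof.
by exists 0%N, (fun=> 0), (fun=> 0) => x; rewrite big_ord0.
Qed.

Lemma trig_poly_sum (I : Type) (s : seq I) (p : I -> R -> R[i]) :
  (forall i, trig_poly (p i)) -> trig_poly (fun x => \sum_(i <- s) p i x).
Proof.
move=> H; elim: s => [|i s IH].
  rewrite (_ : (fun _ => _) = fun=> 0); first exact: trig_poly0.
  by apply/funext => x; rewrite big_nil.
rewrite (_ : (fun _ => _) = fun x => p i x + \sum_(j <- s) p j x).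
  exact: trig_polyD.
by apply/funext => x; rewrite big_cons.
Qed.

(** Euler's formula: the coefficients of exp(i l x) and exp(- i l x) are (a - ib)/2 and
(a + ib)/2. *)
Lemma trig_poly_wave (a b l : R) :
  trig_poly (fun x : R => ((a * cos (l * x) + b * sin (l * x))%:C)%C).
Proof.
exists 2, (fun k : 'I_2 => if k == ord0 then ((a / 2) -i* (b / 2))%C else ((a / 2) +i* (b / 2))%C),
  (fun k : 'I_2 => if k == ord0 then l else - l) => x.
rewrite big_ord_recl big_ord1 /= /expi mulNr cosN sinN.
by apply/eqP; rewrite eq_complex /=; apply/andP; split; apply/eqP; field.
Qed.

(** Weierstrass's test: the finite partial sums are trigonometric polynomials, and the
tails are bounded by those of the coefficients, uniformly in x. *)
Lemma almost_periodic_waves (T : choiceType) (S : set T) (c a b : R) (u w : T -> R)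
    (F : R -> R) :
  abs_summable S u ->
  (forall x, is_sum S (fun n => u n * (a * cos (w n * x) + b * sin (w n * x))) (F x)) ->
  uniformly_almost_periodic (fun x => ((c * F x)%:C)%C).
Proof.
move=> Hu HF; pose f n x := u n * (a * cos (w n * x) + b * sin (w n * x)).
set K := `|a| + `|b|; have K0 : 0 <= K by rewrite addr_ge0.
have fK n x : `|f n x| <= K * `|u n|.
  rewrite /f normrM mulrC ler_wpM2r // (le_trans (ler_normD _ _)) // !normrM.
  by apply: lerD; rewrite ler_piMr // ?cos_max ?sin_max.
have c0 : 0 < `|c| * K + 1 by rewrite ltr_wpDl // mulr_ge0.
have tail k : exists2 X : {fset T}, inside S X &
    forall Y, inside S Y -> Y `&` X = fset0 ->
    \sum_(y <- Y) `|u y| <= k.+1%:R^-1 / (`|c| * K + 1).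
  by apply: abs_summable_tail => //; rewrite divr_gt0 // invr_gt0 ltr0n.
pose X k := sval (cid2 (tail k)).
have XS k : inside S (X k) by rewrite /X; case: cid2.
have XT k Y : inside S Y -> Y `&` X k = fset0 ->
    \sum_(y <- Y) `|u y| <= k.+1%:R^-1 / (`|c| * K + 1).
  by rewrite /X; case: cid2 => Z /= _; apply.
exists (fun k x => \sum_(n <- X k) ((c * f n x)%:C)%C); split.
  move=> k; apply: trig_poly_sum => n.
  rewrite (_ : (fun _ => _) = fun x => (((c * u n * a) * cos (w n * x) +
    (c * u n * b) * sin (w n * x))%:C)%C); first exact: trig_poly_wave.
  by apply/funext => x; rewrite /f; congr (_ %:C)%C; ring.
have approx k x : `|F x - \sum_(n <- X k) f n x| <= K * (k.+1%:R^-1 / (`|c| * K + 1)).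
  apply/ler_addgt0Pr => e e0; have [Z ZS HZ] := HF x e e0.
  have Sub := fsubsetUl (X k) Z.
  have := HZ (X k `|` Z) (fsubsetUr _ _) (insideU (XS k) ZS).
  rewrite (sum_fsetD _ Sub).
  have Din : inside S ((X k `|` Z) `\` X k).
    by move=> y; rewrite !inE => /andP[/negbTE -> /= /ZS].
  have Dout : ((X k `|` Z) `\` X k) `&` X k = fset0.
    by apply/fsetP => y; rewrite !inE; case: (y \in X k); rewrite /= ?andbF.
  have : `|\sum_(y <- (X k `|` Z) `\` X k) f y x| <= K * (k.+1%:R^-1 / (`|c| * K + 1)).
    apply: le_trans (ler_norm_sum _ _ _) _.
    apply: (@le_trans _ _ (\sum_(y <- (X k `|` Z) `\` X k) K * `|u y|)).
      by apply: ler_sum => y _.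
    by rewrite -mulr_sumr ler_wpM2l // XT.
  rewrite -/(f _ x).
  move: (K * _) (\sum_(y <- X k) _) (\sum_(y <- _ `\` _) _) => B s t.
  rewrite !ler_norml => /andP[? ?] /andP[? ?]; apply/andP; split; lra.
move=> e e0; near=> k => x.
rewrite -(rmorph_sum (real_complex R)) -rmorphB /= normc_def /= expr0n addr0 sqrtr_sqr ltcR.
rewrite -mulr_sumr -mulrBr normrM distrC.
apply: (@le_lt_trans _ _ (`|c| * (K * (k.+1%:R^-1 / (`|c| * K + 1))))).
  by rewrite ler_wpM2l ?approx.
apply: (@le_lt_trans _ _ (k.+1%:R^-1)).
  rewrite mulrA mulrCA ler_piMr ?invr_ge0 ?ler0n // ler_pdivrMr // mul1r; lra.
by near: k; exact: near_infty_natSinv_lt (PosNum e0).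
Unshelve. all: by end_near.
Qed.

End AlmostPeriodic.

(** * The expansion of the averaged error term *)

Section MainExpansion.
Variable R : realType.

Lemma bess_at0 : bess 0 = 3 * pi / 8 :> R.
Proof.
rewrite /bess (@oint_primitive _ _ (fun t => 3 / 8 * t + 3 / 8 * (sin t * cos t) + 1 / 4 * (sin t * cos t ^+ 3))).
  rewrite sinN sin_pihalf cosN cos_pihalf expr0n /= !mulr0.
  by move: (pi : R) => z; field.
move=> t; apply: der_eq; first by solve_der.
rewrite /= mul0r cos0 mulr1.
have -> : cos t ^+ 4 = (cos t ^+ 2) ^+ 2 by ring.
have := cos2Dsin2 t; set c := cos t; set s := sin t => h.
have s2 : s ^+ 2 = 1 - c ^+ 2 by rewrite -h; ring.
transitivity (3 / 8 + 3 / 8 * (c ^+ 2 - s ^+ 2) + 1 / 4 * ((c ^+ 2) ^+ 2 - 3 * s ^+ 2 * c ^+ 2)).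
  by field.
by rewrite s2; field.
Qed.

Lemma sqrt_powR (T : R) : 0 < T -> Num.sqrt T = T `^ (1 / 2).
Proof. by move=> T0; rewrite div1r powR12_sqrt // ltW. Qed.

(** T times sqrt T^(-5/2-j), the factor produced by the j-th term of [bess_expansion] at
k = sqrt T eta(n). *)
Lemma scale_powR (T : R) j : 0 < T ->
  T * ((Num.sqrt (Num.sqrt T))^-1 ^+ 5 * (Num.sqrt T)^-1 ^+ j) = T `^ (1 / 4 - j.+1%:R / 2).
Proof.
move=> T0; have s0 : 0 < Num.sqrt T by rewrite sqrtr_gt0.
have Tn : T != 0 by exact: lt0r_neq0.
rewrite (sqrt_powR s0) (sqrt_powR T0) -powRrM -!powRN -!powR_mulrn ?powR_ge0 // -!powRrM.
rewrite -{1}(powRr1 (ltW T0)) -!powRD; [|by rewrite Tn implybT..].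
by congr (_ `^ _); rewrite -natr1; field.
Qed.

Variables (v1 v2 : 'rV[R]_2) (a1 a2 : R).
Hypotheses (hv : orthonormal_basis v1 v2) (ha1 : 0 < a1) (ha2 : 0 < a2).
Local Notation S := [set n : 'rV[int]_2 | n != 0].
Local Notation et := (eta v1 v2 a1 a2).

Definition kappa : R := a1 * a2 / (3 * pi ^+ 2).
Let pi0 : 0 < pi :> R := pi_gt0 R.
Let kappa0 : 0 < kappa.
Proof. by rewrite divr_gt0 ?mulr_gt0 ?exprn_gt0. Qed.

(** Up to the factor [kappa], the almost periodic coefficient of order j + 1. *)
Definition wavesum j x : R := rsum S (fun n =>
  ((Num.sqrt (et n))^-1 ^+ 5 * (et n)^-1 ^+ j) * besswave j (et n * x)).

Lemma wavesum_is_sum j x : is_sum S (fun n =>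
  ((Num.sqrt (et n))^-1 ^+ 5 * (et n)^-1 ^+ j) * besswave j (et n * x)) (wavesum j x).
Proof.
apply: rsum_is_sum; set b := `|(besscoef R j).1| + `|(besscoef R j).2|.
apply: (@abs_summable_le _ _ _ _ _ b _ _ (abs_summable_eta hv ha1 ha2 j)); first by rewrite addr_ge0.
by move=> n _; rewrite normrM mulrC ler_wpM2r // besswave_bound.
Qed.

(** By the expansion of order 0, bess k = O(k^(-5/2)) on k >= c > 0, where c is a lower bound
of eta; T >= 1 makes the arguments at least eta(n). *)
Lemma abs_summable_bess T : 1 <= T -> abs_summable S (fun n => bess (Num.sqrt T * et n)).
Proof.
move=> T1; have [C C0 HC] := bess_expansion R 0.
have [c c0 Hc] := eta_lower hv ha1 ha2.
set b := `|(besscoef R 0).1| + `|(besscoef R 0).2|; have b0 : 0 <= b by rewrite addr_ge0.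
apply: (@abs_summable_le _ _ _ _ _ (b + C * c^-1) _ _ (abs_summable_eta hv ha1 ha2 0)).
  by rewrite addr_ge0 // mulr_ge0 // invr_ge0 ltW.
move=> n n0; have e0 := eta_gt0 hv ha1 ha2 n0.
have s1 : 1 <= Num.sqrt T by rewrite -sqrtr1 ler_wsqrtr.
set k := Num.sqrt T * et n.
have ek : et n <= k by rewrite /k ler_peMl // ltW.
have k0 : 0 < k by exact: lt_le_trans ek.
have := HC k k0; rewrite big_ord_recl big_ord0 addr0 /bessterm /= expr0 mul1r expr1 => h.
rewrite expr0 mulr1 (ger0_norm (exprn_ge0 _ _)) ?invr_ge0 ?sqrtr_ge0 //.
have -> : bess k = (Num.sqrt k)^-1 ^+ 5 * besswave 0 k +
  (bess k - (Num.sqrt k)^-1 ^+ 5 * besswave 0 k) by ring.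
have sk : (Num.sqrt k)^-1 ^+ 5 <= (Num.sqrt (et n))^-1 ^+ 5.
  have se : 0 < Num.sqrt (et n) by rewrite sqrtr_gt0.
  have sk0 : 0 < Num.sqrt k by rewrite sqrtr_gt0.
  rewrite lerXn2r ?nnegrE ?invr_ge0 ?(ltW se) ?(ltW sk0) // lef_pV2 ?posrE //.
  by rewrite ler_wsqrtr.
have s50 : 0 <= (Num.sqrt k)^-1 ^+ 5 by rewrite exprn_ge0 // invr_ge0 sqrtr_ge0.
have ck : k^-1 <= c^-1 by rewrite lef_pV2 ?posrE // (le_trans (Hc n n0)).
apply: le_trans (ler_normD _ _) _; rewrite (mulrDl b); apply: lerD.
  by rewrite normrM (ger0_norm s50) mulrC; apply: ler_pM => //; exact: besswave_bound.
apply: le_trans h _; rewrite -(mulrA C) -(mulrA C) ler_wpM2l // mulrC.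
by apply: ler_pM => //; rewrite invr_ge0 ltW.
Qed.

(** Poisson summation in [Aavg_sum]; the area term cancels the frequency 0, because
bess 0 = 3 pi / 8. *)
Lemma Aavg_bess T : 1 <= T ->
  Aavg v1 v2 a1 a2 T = kappa * T * rsum S (fun n => bess (Num.sqrt T * et n)).
Proof.
move=> T1; have T0 : 0 < T by exact: lt_le_trans T1.
have p0 := ellp_gt0 hv ha1 ha2; have D0 := ell_disc_gt0 hv ha1 ha2.
have [|B0 B00 HB] := @qform_coercive R _ _ _ (T + 1) p0 D0; first by rewrite addr_gt0.
pose M := Num.bound B0.
have BM : B0 <= M%:R by exact/ltW/archi_boundP.
rewrite (Aavg_sum hv ha1 ha2 T0 (HB _ BM)).
set W := fun n : 'rV[int]_2 => kappa * T ^+ 2 * bess (Num.sqrt T * et n).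
have WE n : W n = fourier2 (qcap (ellp v1 v2 a1 a2) (ellq v1 v2 a1 a2) (ellr v1 v2 a1 a2) T)
    (M%:R + 1 / 2) (n 0 0)%:~R (n 0 1)%:~R.
  have B1 : 0 <= M%:R + 1 / 2 :> R by rewrite addr_ge0 // divr_ge0.
  have HB1 x y : M%:R + 1 / 2 <= `|x| \/ M%:R + 1 / 2 <= `|y| ->
      T <= qform (ellp v1 v2 a1 a2) (ellq v1 v2 a1 a2) (ellr v1 v2 a1 a2) x y.
    move=> Hxy; apply: (@le_trans _ _ (T + 1)); first by rewrite lerDl.
    by apply: HB Hxy; rewrite (le_trans BM) // lerDl divr_ge0.
  rewrite (fourier2_qcap _ _ p0 D0 T0 B1 HB1).
  rewrite (sqrt_ell_disc hv ha1 ha2) (qform_dual hv ha1 ha2) (ell_disc hv ha1 ha2) /W.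
  have pn := lt0r_neq0 pi0; have n1 := lt0r_neq0 ha1; have n2 := lt0r_neq0 ha2.
  congr (_ * bess _).
    by rewrite /kappa; move: (pi : R) pn => z zn; field; rewrite zn n1 n2.
  have -> : T * ((2 * pi / (a1 * a2)) ^+ 2 * dualsq v1 v2 a1 a2 n) / ((2 * pi) ^+ 2 / (a1 * a2)) ^+ 2 =
    (2 * pi)^-1 ^+ 2 * (T * dualsq v1 v2 a1 a2 n).
    by move: (pi : R) pn => z zn; field; rewrite zn n1 n2.
  rewrite sqrtrM ?sqr_ge0 // sqrtr_sqr ger0_norm ?invr_ge0 ?mulr_ge0 ?(ltW pi0) //.
  by rewrite sqrtrM ?(ltW T0) // mulVKf // mulf_neq0.
have bs := rsum_is_sum (abs_summable_bess T1).
have Wl := is_sum_origin (is_sumZ (kappa * T ^+ 2) bs).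
have Wa : abs_summable setT W.
  apply: abs_summable_origin.
  apply: (@abs_summable_le _ _ _ _ _ (kappa * T ^+ 2) _ _ (abs_summable_bess T1)).
    by rewrite mulr_ge0 ?exprn_ge0 ?(ltW kappa0) ?(ltW T0).
  by move=> n _; rewrite /W normrM ger0_norm // mulr_ge0 ?exprn_ge0 ?(ltW kappa0) ?(ltW T0).
have WF : W = fun n => fourier2 (qcap (ellp v1 v2 a1 a2) (ellq v1 v2 a1 a2) (ellr v1 v2 a1 a2) T)
    (M%:R + 1 / 2) (n 0 0)%:~R (n 0 1)%:~R by apply/funext => n; exact: WE.
rewrite -/(W 0) -/W in Wl; rewrite WF in Wl Wa.
rewrite (poisson_plane (lip2_qcap _ _ _ _) Wa Wl) -WE /W.
have -> : et 0 = 0.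
  by rewrite /eta /dualsq !latdotE !mxE !mul0r addr0 !mulr0 expr0n addr0 sqrtr0.
rewrite mulr0 bess_at0 /kappa.
move: (rsum _ _) => b; have pn := lt0r_neq0 pi0; have Tn := lt0r_neq0 T0.
by move: (pi : R) pn => z zn; field; rewrite zn Tn.
Qed.

(** [bess_expansion] is summed over the lattice: the errors add up to the finite sum of
eta(n)^(-5/2-m-1). *)
Lemma Aavg_expansion m : exists K, forall T, 1 <= T ->
  `|Aavg v1 v2 a1 a2 T - \sum_(j < m.+1) kappa * wavesum j (Num.sqrt T) * T `^ (1 / 4 - j.+1%:R / 2)|
  <= K * T `^ (1 / 4 - m.+2%:R / 2).
Proof.
have [C C0 HC] := bess_expansion R m.
have [E HE] := abs_summable_eta hv ha1 ha2 m.+1.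
have E0 : 0 <= E by have := HE fset0; rewrite big_nil; apply => x; rewrite inE.
exists (kappa * (C * E)) => T T1; have T0 : 0 < T by exact: lt_le_trans T1.
set s := Num.sqrt T; have s0 : 0 < s by rewrite sqrtr_gt0.
set q := (Num.sqrt s)^-1 ^+ 5.
have q0 : 0 <= q by rewrite exprn_ge0 // invr_ge0 sqrtr_ge0.
pose u j n := (Num.sqrt (et n))^-1 ^+ 5 * (et n)^-1 ^+ j.
have bs := rsum_is_sum (abs_summable_bess T1).
have ws : is_sum S (fun n => \sum_(j < m.+1) (q * s^-1 ^+ j) * (u j n * besswave j (et n * s)))
   (\sum_(j < m.+1) (q * s^-1 ^+ j) * wavesum j s).
  by apply: is_sum_sum => j; apply: is_sumZ; exact: wavesum_is_sum.
have main : `|rsum S (fun n => bess (s * et n)) - \sum_(j < m.+1) (q * s^-1 ^+ j) * wavesum j s|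
   <= q * s^-1 ^+ m.+1 * (C * E).
  apply: is_sum_bound (is_sumB bs ws) _ => Y YS.
  apply: le_trans (ler_norm_sum _ _ _) _.
  apply: (@le_trans _ _ (\sum_(y <- Y) q * s^-1 ^+ m.+1 * C * `|u m.+1 y|)); last first.
    rewrite -mulr_sumr mulrA ler_wpM2l // ?HE //.
    by rewrite !mulr_ge0 // exprn_ge0 // invr_ge0 ltW.
  rewrite big_seq [leRHS]big_seq; apply: ler_sum => n /YS n0.
  have e0 := eta_gt0 hv ha1 ha2 n0.
  have k0 : 0 < s * et n by exact: mulr_gt0.
  have sqE : (Num.sqrt (s * et n))^-1 ^+ 5 = q * (Num.sqrt (et n))^-1 ^+ 5.
    by rewrite sqrtrM ?(ltW s0) // invfM exprMn.
  have := HC _ k0; rewrite sqE invfM => h.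
  have -> : \sum_(j < m.+1) q * s^-1 ^+ j * (u j n * besswave j (et n * s)) =
    q * (Num.sqrt (et n))^-1 ^+ 5 * \sum_(j < m.+1) bessterm j (s * et n).
    rewrite mulr_sumr; apply: eq_bigr => j _.
    by rewrite /bessterm /u invfM exprMn (mulrC (et n)); ring.
  apply: le_trans h _; rewrite ger0_norm; last first.
    by rewrite mulr_ge0 // exprn_ge0 // invr_ge0 ?sqrtr_ge0 // ltW.
  by rewrite /u exprMn le_eqVlt; apply/orP; left; apply/eqP; ring.
rewrite (Aavg_bess T1) -(scale_powR m.+1 T0) -/s -/q.
have -> : \sum_(j < m.+1) kappa * wavesum j s * T `^ (1 / 4 - j.+1%:R / 2) =
  kappa * T * \sum_(j < m.+1) (q * s^-1 ^+ j) * wavesum j s.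
  rewrite mulr_sumr; apply: eq_bigr => j _.
  by rewrite -(scale_powR j T0) -/s -/q; ring.
rewrite -mulrBr normrM (@ger0_norm _ (kappa * T)); last by rewrite mulr_ge0 ?(ltW kappa0) ?(ltW T0).
rewrite [leRHS](_ : _ = kappa * T * (q * s^-1 ^+ m.+1 * (C * E))); last by ring.
by rewrite ler_wpM2l // mulr_ge0 ?(ltW kappa0) ?(ltW T0).
Qed.

(** cos t + sin t = sqrt 2 cos (t - pi/4). *)
Lemma gfun_wavesum x : gfun v1 v2 a1 a2 x = kappa * wavesum 0 x.
Proof.
pose f n := (dualsq v1 v2 a1 a2 n) `^ (- (5 / 4)) * cos (Num.sqrt (dualsq v1 v2 a1 a2 n) * x - pi / 4).
set c := - 3 * Num.sqrt pi * Num.sqrt 2 : R.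
have sp : 0 < Num.sqrt pi :> R by rewrite sqrtr_gt0.
have sp2 : Num.sqrt pi ^+ 2 = pi :> R by rewrite sqr_sqrtr // ltW.
have s2 : 0 < Num.sqrt 2 :> R by rewrite sqrtr_gt0.
have s22 : Num.sqrt 2 ^+ 2 = 2 :> R by rewrite sqr_sqrtr.
have cn : c != 0 by rewrite /c !mulf_neq0 ?oppr_eq0 ?pnatr_eq0 ?lt0r_neq0.
have fE n : S n -> f n = c^-1 * (((Num.sqrt (et n))^-1 ^+ 5 * (et n)^-1 ^+ 0) * besswave 0 (et n * x)).
  move=> n0; have e0 := eta_gt0 hv ha1 ha2 n0.
  have d0 : 0 < dualsq v1 v2 a1 a2 n by rewrite -sqrtr_gt0.
  rewrite /f -/(et n) cosB cos_pi4 sin_pi4 /besswave /=.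
  have -> : dualsq v1 v2 a1 a2 n `^ (- (5 / 4)) = (Num.sqrt (et n))^-1 ^+ 5.
    rewrite (sqrt_powR e0) /eta (sqrt_powR d0) -powRrM -powRN -powR_mulrn ?powR_ge0 // -powRrM.
    by congr (_ `^ _); field.
  apply: (mulfI cn); rewrite mulVKf // expr0 mulr1 /c.
  transitivity (- 3 * Num.sqrt pi * ((Num.sqrt (et n))^-1 ^+ 5 * (cos (et n * x) + sin (et n * x)))).
    by move: ((Num.sqrt (et n))^-1 ^+ 5) (Num.sqrt 2 : R) (lt0r_neq0 s2) => e w wn; field; exact: wn.
  by ring.
have fsum : is_sum S f (c^-1 * wavesum 0 x).
  by apply: eq_is_sum (is_sumZ c^-1 (wavesum_is_sum 0 x)) => n n0; rewrite fE.
have fa : abs_summable S f.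
  have := abs_summable_eta hv ha1 ha2 0.
  set b := `|(besscoef R 0).1| + `|(besscoef R 0).2|.
  apply: (@abs_summable_le _ _ _ _ _ (`|c^-1| * b)); first by rewrite mulr_ge0 ?addr_ge0.
  move=> n n0; rewrite fE // !normrM -!mulrA ler_wpM2l // [leRHS]mulrC -!mulrA.
  by rewrite !ler_wpM2l // besswave_bound.
have -> : gfun v1 v2 a1 a2 x = - (Num.sqrt 2 / pi `^ (3 / 2)) * a1 * a2 * rsum S f by [].
rewrite (is_sum_unique (rsum_is_sum fa) fsum) mulrA; congr (_ * _).
have -> : pi `^ (3 / 2) = pi * Num.sqrt pi :> R.
  rewrite (sqrt_powR pi0) (_ : 3 / 2 = 1 + 1 / 2); last by field.
  by rewrite powRD ?powRr1 ?(ltW pi0) // (lt0r_neq0 pi0) implybT.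
rewrite /kappa /c.
transitivity (- (Num.sqrt 2 / (Num.sqrt pi ^+ 3)) * a1 * a2 * (- 3 * Num.sqrt pi * Num.sqrt 2)^-1).
  by rewrite -{1}sp2 [_ ^+ 3]exprSr.
rewrite -[pi in RHS]sp2; move: (Num.sqrt pi) sp (Num.sqrt 2) s2 => p p0 w w0.
by field; rewrite !lt0r_neq0.
Qed.

End MainExpansion.

Lemma eqaddO_pinfty (R : realType) (A g h : R -> R) K :
  (forall x, 1 <= x -> `|A x - g x| <= K * `|h x|) -> A = g +O_ +oo h.
Proof.
move=> H; apply/eqaddOP; near=> k; near=> x.
have /H : 1 <= x by near: x; apply: nbhs_pinfty_ge; rewrite num_real.
by move=> /le_trans; apply; rewrite ler_wpM2r.
Unshelve. all: by end_near.
Qed.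

Theorem theorem4 (R : realType) (v1 v2 : 'rV[R]_2) (a1 a2 : R)
    (hv : orthonormal_basis v1 v2) (ha1 : 0 < a1) (ha2 : 0 < a2) :
  let A := Aavg v1 v2 a1 a2 in
  let g := gfun v1 v2 a1 a2 in
  A = (fun r => g (Num.sqrt r) * r `^ (- (1 / 4)))
      +O_ +oo (fun r => r `^ (- (3 / 4)))
  /\
  exists gs : nat -> R -> R,
    [/\ gs 1%N = g,
        forall j, (1 <= j)%N ->
          uniformly_almost_periodic (fun x => ((gs j x)%:C)%C)
      & forall m, (1 <= m)%N ->
          A = (fun r => \sum_(1 <= j < m.+1)
                 gs j (Num.sqrt r) * r `^ (1 / 4 - j%:R / 2))
              +O_ +oo (fun r => r `^ (- (1 / 4) - m%:R / 2))].
Proof.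
move=> A g.
pose gs j x := kappa a1 a2 * wavesum v1 v2 a1 a2 j.-1 x.
have gs1 : gs 1%N = g by apply/funext => x; rewrite /g gfun_wavesum.
have expansion m : (1 <= m)%N ->
    A = (fun r => \sum_(1 <= j < m.+1) gs j (Num.sqrt r) * r `^ (1 / 4 - j%:R / 2))
        +O_ +oo (fun r => r `^ (- (1 / 4) - m%:R / 2)).
  case: m => // m _; have [K HK] := Aavg_expansion hv ha1 ha2 m.
  apply: (@eqaddO_pinfty _ _ _ _ K) => T T1.
  rewrite big_add1 big_mkord (ger0_norm (powR_ge0 _ _)).
  have -> : - (1 / 4) - m.+1%:R / 2 = 1 / 4 - m.+2%:R / 2 :> R by rewrite -[m.+2%:R]natr1; field.
  exact: HK.
split.
  have := expansion 1%N isT.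
  have -> : (fun r => \sum_(1 <= j < 2) gs j (Num.sqrt r) * r `^ (1 / 4 - j%:R / 2)) =
      (fun r => g (Num.sqrt r) * r `^ (- (1 / 4))).
    by apply/funext => r; rewrite big_nat1 gs1; congr (_ * _ `^ _); field.
  by have -> : - (1 / 4) - 1%:R / 2 = - (3 / 4) :> R by field.
exists gs; split => // j _.
apply: almost_periodic_waves (abs_summable_eta hv ha1 ha2 j.-1) _ => x.
exact: wavesum_is_sum.
Qed.
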